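(* Let $k$ be a field of characteristic zero and let $\mathscr{U}\subseteq\mathscr{G}$ be a full, replete and widely closed subcategory which is essentially finite and such that the tensor unit of $\mathsf{D}(\mathscr{U})$ is compact. Then every thick ideal of $\mathsf{D}(\mathscr{U})^c$ is radical, and the map $$\pi_0\mathscr{U}\to\mathrm{Spc}(\mathsf{D}(\mathscr{U})^c),\qquad G\mapsto\mathfrak{p}_G=\{X\in\mathsf{D}(\mathscr{U})^c\mid X(G)\simeq0\},$$ is a homeomorphism, where $\pi_0\mathscr{U}$ is discrete. Consequently, $\mathrm{Spc}(\mathsf{D}(\mathscr{U})^c)$ is a finite discrete space consisting only of the group primes $\mathfrak{p}_G$.
   Context: $\mathscr{G}$ is the category of finite groups with morphisms the conjugacy classes of surjective group homomorphisms. A full subcategory $\mathscr{U}\subseteq\mathscr{G}$ closed under isomorphism (replete) is widely closed if whenever $G\twoheadleftarrow H\twoheadrightarrow K$ are surjective homomorphisms with $G,H,K\in\mathscr{U}$, the image of $H\to G\times K$ lies in $\mathscr{U}$; it is essentially finite if the set $\pi_0\mathscr{U}$ of isomorphism classes of objects is finite. $\mathsf{D}(\mathscr{U})$ is the derived category of $\mathrm{Fun}(\mathscr{U}^{\mathrm{op}},\mathrm{Mod}_k)$, with the pointwise tensor product over $k$, and $\mathsf{D}(\mathscr{U})^c$ is its full subcategory of compact objects, an essentially small tensor-triangulated category under these hypotheses. The Balmer spectrum $\mathrm{Spc}(\mathscr{K})$ of an essentially small tensor-triangulated category is the set of prime thick ideals (thick = triangulated and closed under retracts; ideal = closed under tensoring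 with any object; prime = proper and $X\otimes Y\in\mathfrak{p}$ implies $X\in\mathfrak{p}$ or $Y\in\mathfrak{p}$), with the sets $\mathrm{supp}(X)=\{\mathfrak{p}\mid X\notin\mathfrak{p}\}$ as a basis of closed sets. A thick ideal $J$ is radical if $X^{\otimes m}\in J$ for some $m\geq1$ implies $X\in J$. *)

(* Defs.v *)
From HB Require Import structures.
From mathcomp Require Import all_boot all_order all_algebra all_fingroup.
From mathcomp Require Import boolp.

Set Implicit Arguments.
Unset Strict Implicit.
Unset Printing Implicit Defensive.

Import GRing.Theory.
Local Open Scope ring_scope.
Local Obligation Tactic := idtac.

Definition mklin (k : fieldType) (V W : lmodType k) (f : V -> W)
    (Hf : linear f) : {linear V -> W} :=
  let m := GRing.isLinear.Build k V W *:%R f Hf in HB.pack f m.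

Lemma mklinE (k : fieldType) (V W : lmodType k) (f : V -> W) (Hf : linear f) x :
  mklin Hf x = f x.
Proof. by []. Qed.

Section DirectSum.
Context (k : fieldType) (I : Type) (M : I -> lmodType k).

Definition fin_supp (f : forall i, M i) : Prop :=
  exists s : seq {classic I}, forall i : I, f i <> 0 -> (i : {classic I}) \in s.

Record dsum := Dsum { dsum_fun :> forall i, M i; dsum_fin : fin_supp dsum_fun }.

Lemma dsumP (x y : dsum) : (forall i, x i = y i) -> x = y.
Proof.
case: x y => [f Hf] [g Hg] /= fg; have e : f = g by apply: functional_extensionality_dep.
by subst g; congr Dsum; apply: Prop_irrelevance.
Qed.

HB.instance Definition _ := gen_eqMixin dsum.
HB.instance Definition _ := gen_choiceMixin dsum.

Lemma dsum0_fin : fin_supp (fun i => 0 : M i).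
Proof. by exists [::]. Qed.
Lemma dsumN_fin (x : dsum) : fin_supp (fun i => - x i).
Proof.
case: (dsum_fin x) => s Hs; exists s => i H; apply: Hs => xi0.
by apply: H; rewrite xi0 oppr0.
Qed.
Lemma dsumD_fin (x y : dsum) : fin_supp (fun i => x i + y i).
Proof.
case: (dsum_fin x) => s Hs; case: (dsum_fin y) => t Ht; exists (s ++ t) => i H.
rewrite mem_cat; case: (pselect (x i = 0)) => [xi0|/Hs -> //].
by rewrite Ht ?orbT // => yi0; apply: H; rewrite xi0 yi0 addr0.
Qed.
Lemma dsumZ_fin (a : k) (x : dsum) : fin_supp (fun i => a *: x i).
Proof.
case: (dsum_fin x) => s Hs; exists s => i H; apply: Hs => xi0.
by apply: H; rewrite xi0 scaler0.
Qed.

Lemma dsum_addA : associative (fun x y => Dsum (dsumD_fin x y)).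
Proof. by move=> x y z; apply: dsumP => i /=; rewrite addrA. Qed.
Lemma dsum_addC : commutative (fun x y => Dsum (dsumD_fin x y)).
Proof. by move=> x y; apply: dsumP => i /=; rewrite addrC. Qed.
Lemma dsum_add0 : left_id (Dsum dsum0_fin) (fun x y => Dsum (dsumD_fin x y)).
Proof. by move=> x; apply: dsumP => i /=; rewrite add0r. Qed.
Lemma dsum_addN : left_inverse (Dsum dsum0_fin) (fun x => Dsum (dsumN_fin x))
  (fun x y => Dsum (dsumD_fin x y)).
Proof. by move=> x; apply: dsumP => i /=; rewrite addNr. Qed.

HB.instance Definition _ :=
  GRing.isZmodule.Build dsum dsum_addA dsum_addC dsum_add0 dsum_addN.

Lemma dsum_scaleA (a b : k) (x : dsum) :
  Dsum (dsumZ_fin a (Dsum (dsumZ_fin b x))) = Dsum (dsumZ_fin (a * b) x).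
Proof. by apply: dsumP => i /=; rewrite scalerA. Qed.
Lemma dsum_scale1 : left_id 1 (fun a x => Dsum (dsumZ_fin a x)).
Proof. by move=> x; apply: dsumP => i /=; rewrite scale1r. Qed.
Lemma dsum_scaleDr : right_distributive (fun a x => Dsum (dsumZ_fin a x)) +%R.
Proof. by move=> a x y; apply: dsumP => i /=; rewrite scalerDr. Qed.
Lemma dsum_scaleDl (x : dsum) :
  {morph (fun a => Dsum (dsumZ_fin a x)) : a b / a + b}.
Proof. by move=> a b; apply: dsumP => i /=; rewrite scalerDl. Qed.

HB.instance Definition _ := GRing.Zmodule_isLmodule.Build k dsum
  dsum_scaleA dsum_scale1 dsum_scaleDr dsum_scaleDl.

Lemma dsum0E i : (0 : dsum) i = 0. Proof. by []. Qed.
Lemma dsumDE (x y : dsum) i : (x + y) i = x i + y i. Proof. by []. Qed.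
Lemma dsumZE a (x : dsum) i : (a *: x) i = a *: x i. Proof. by []. Qed.
Lemma dsum_sumE (J : Type) (s : seq J) (F : J -> dsum) i :
  (\sum_(j <- s) F j) i = \sum_(j <- s) F j i.
Proof. by elim: s => [|j s IH]; rewrite ?big_nil // !big_cons dsumDE IH. Qed.

Definition dsum_in_fun i (x : M i) (j : I) : M j :=
  if pselect (i = j) is left e then eq_rect i M x j e else 0.

Lemma dsum_in_id i (x : M i) : dsum_in_fun x i = x.
Proof.
rewrite /dsum_in_fun; case: pselect => // e.
by rewrite (Prop_irrelevance e (erefl i)).
Qed.

Lemma dsum_in_neq i (x : M i) j : i <> j -> dsum_in_fun x j = 0.
Proof. by rewrite /dsum_in_fun; case: pselect. Qed.

Lemma dsum_in_fin i (x : M i) : fin_supp (dsum_in_fun x).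
Proof.
exists [:: (i : {classic I})] => j; case: (pselect (i = j)) => [<- _|ij].
  by rewrite inE.
by rewrite dsum_in_neq.
Qed.

Definition dsum_in_map i (x : M i) : dsum := Dsum (dsum_in_fin x).

Lemma dsum_in_linear i : linear (@dsum_in_map i).
Proof.
move=> a x y; apply: dsumP => j; rewrite dsumDE dsumZE /=.
case: (pselect (i = j)) => [<-|ij]; first by rewrite !dsum_in_id.
by rewrite !dsum_in_neq // scaler0 addr0.
Qed.

Definition dsum_in i : {linear M i -> dsum} := mklin (@dsum_in_linear i).

Definition dsum_support (x : dsum) : seq {classic I} :=
  undup (sval (cid (dsum_fin x))).

Lemma dsum_supportP (x : dsum) (i : I) :
  x i <> 0 -> (i : {classic I}) \in dsum_support x.
Proof. by rewrite /dsum_support mem_undup; case: cid => s /= H /H. Qed.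

Lemma dsum_decomp (x : dsum) : x = \sum_(i <- dsum_support x) dsum_in i (x i).
Proof.
apply: dsumP => i; rewrite dsum_sumE /=.
have [iS|niS] := boolP ((i : {classic I}) \in dsum_support x).
  rewrite (bigD1_seq (i : {classic I})) ?undup_uniq //= dsum_in_id.
  rewrite big1 ?addr0 // => j /eqP ji.
  by rewrite dsum_in_neq.
rewrite big_seq big1; last first.
  by move=> j jS; rewrite dsum_in_neq // => ji; move: niS; rewrite -ji jS.
by case: (pselect (x i = 0)) => // /dsum_supportP; rewrite (negPf niS).
Qed.

Section Elim.
Context (V : lmodType k) (f : forall i, {linear M i -> V}).

Definition dsum_elim_fun (x : dsum) : V := \sum_(i <- dsum_support x) f i (x i).

Lemma dsum_elim_supp (x : dsum) (s : seq {classic I}) : uniq s ->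
  (forall i : I, x i <> 0 -> (i : {classic I}) \in s) ->
  dsum_elim_fun x = \sum_(i <- s) f i (x i).
Proof.
move=> us Hs; rewrite /dsum_elim_fun.
rewrite [LHS](bigID (fun i => `[< x i = 0 >])) /= big1 ?add0r; last first.
  by move=> i /asboolP ->; rewrite linear0.
rewrite [RHS](bigID (fun i => `[< x i = 0 >])) /= [X in _ = X + _]big1 ?add0r; last first.
  by move=> i /asboolP ->; rewrite linear0.
rewrite -[LHS]big_filter -[RHS]big_filter.
set s1 := filter _ _; set s2 := filter _ s.
suff p12 : perm_eq (s1 : seq {classic I}) s2.
  exact: (@perm_big V +%R 0 {classic I} s1 s2 xpredT (fun i => f i (x i)) p12).
apply: uniq_perm; rewrite ?filter_uniq ?undup_uniq // => i.
rewrite !mem_filter; case: asboolP => //= xi.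
by rewrite Hs // dsum_supportP.
Qed.

Lemma dsum_elim_linear : linear dsum_elim_fun.
Proof.
move=> a x y; pose s : seq {classic I} := 
  undup (@cat {classic I} (dsum_support x) (dsum_support y)).
have us : uniq s by apply: undup_uniq.
have xs i : x i <> 0 -> (i : {classic I}) \in s.
  by move=> /dsum_supportP xi; rewrite mem_undup mem_cat xi.
have ys i : y i <> 0 -> (i : {classic I}) \in s.
  by move=> /dsum_supportP yi; rewrite mem_undup mem_cat yi orbT.
rewrite (dsum_elim_supp us xs) (dsum_elim_supp us ys) (@dsum_elim_supp _ s) //.
  rewrite scaler_sumr -big_split; apply: eq_bigr => i _ /=.
  by rewrite linearP.
move=> i; case: (pselect (x i = 0)) => [x0|/xs //].
case: (pselect (y i = 0)) => [y0|/ys //].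
by rewrite dsumDE dsumZE x0 y0 scaler0 addr0.
Qed.

Definition dsum_elim : {linear dsum -> V} := mklin dsum_elim_linear.

Lemma dsum_elim_in i (x : M i) : dsum_elim (dsum_in i x) = f i x.
Proof.
rewrite /= (@dsum_elim_supp _ [:: (i : {classic I})]) //.
  by rewrite big_seq1 /= dsum_in_id.
move=> j /=; case: (pselect (i = j)) => [<-|ij]; first by rewrite inE.
by rewrite dsum_in_neq.
Qed.
End Elim.

Lemma dsum_ext (V : lmodType k) (f g : {linear dsum -> V}) :
  (forall i x, f (dsum_in i x) = g (dsum_in i x)) -> f =1 g.
Proof.
move=> fg x; rewrite (dsum_decomp x) !linear_sum /=.
by apply: eq_bigr => i _; apply: fg.
Qed.
End DirectSum.

Section LinearQuotient.
Context (k : fieldType) (V : lmodType k) (R : V -> Prop).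

Inductive in_span : V -> Prop :=
  | in_span_gen x : R x -> in_span x
  | in_span0 : in_span 0
  | in_spanP a x y : in_span x -> in_span y -> in_span (a *: x + y).

Definition span : {pred V} := fun x => `[< in_span x >].

Lemma spanE x : (x \in span) = `[< in_span x >]. Proof. by []. Qed.

Lemma span_zmod_closed : zmod_closed span.
Proof.
split=> [|x y /asboolP Sx /asboolP Sy]; first exact/asboolP/in_span0.
by apply/asboolP; rewrite addrC -scaleN1r; apply: in_spanP.
Qed.

HB.instance Definition _ := GRing.isZmodClosed.Build V span span_zmod_closed.

Definition lquot : Type := {ideal_quot span}.

HB.instance Definition _ := GRing.Zmodule.on lquot.

Definition lpi (x : V) : lquot := \pi_({ideal_quot span})%qT x.

Lemma lpiD x y : lpi (x + y) = lpi x + lpi y.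
Proof. exact: (raddfD (\pi_({ideal_quot span})%qT)). Qed.

Definition lrepr (q : lquot) : V := generic_quotient.repr q.

Lemma lpi_repr (q : lquot) : lpi (lrepr q) = q.
Proof. exact: reprK. Qed.

Lemma lpi_eq x y : lpi x = lpi y <-> in_span (x - y).
Proof.
split=> [/eqP|/asboolP H]; last apply/eqP; rewrite -(Quotient.idealrBE span).
  by move=> /asboolP.
exact: H.
Qed.

Definition lquot_scale (a : k) (q : lquot) : lquot := lpi (a *: lrepr q).

Lemma lpiZ a x : lpi (a *: x) = lquot_scale a (lpi x).
Proof.
rewrite /lquot_scale; apply/lpi_eq; rewrite -scalerBr -[_ *: _]addr0.
by apply: in_spanP in_span0; apply/lpi_eq; rewrite lpi_repr.
Qed.

Lemma lquot_scaleA a b (q : lquot) :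
  lquot_scale a (lquot_scale b q) = lquot_scale (a * b) q.
Proof. by rewrite -[q]lpi_repr -!lpiZ scalerA. Qed.
Lemma lquot_scale1 : left_id 1 lquot_scale.
Proof. by move=> q; rewrite -[q]lpi_repr -lpiZ scale1r. Qed.
Lemma lquot_scaleDr : right_distributive lquot_scale +%R.
Proof.
by move=> a p q; rewrite -[p]lpi_repr -[q]lpi_repr -lpiD -!lpiZ -lpiD scalerDr.
Qed.
Lemma lquot_scaleDl (q : lquot) : {morph lquot_scale^~ q : a b / a + b}.
Proof. by move=> a b; rewrite -[q]lpi_repr -!lpiZ -lpiD scalerDl. Qed.

HB.instance Definition _ := GRing.Zmodule_isLmodule.Build k lquot
  lquot_scaleA lquot_scale1 lquot_scaleDr lquot_scaleDl.

Lemma lpi_linear : linear lpi.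
Proof. by move=> a x y; rewrite lpiD lpiZ. Qed.

HB.instance Definition _ := GRing.isLinear.Build k V lquot *:%R lpi lpi_linear.

Section Lift.
Context (W : lmodType k) (f : {linear V -> W}) (fR : forall x, R x -> f x = 0).

Lemma lquot_lift_span x : in_span x -> f x = 0.
Proof.
elim=> [y /fR //||a y z _ fy _ fz]; first by rewrite linear0.
by rewrite linearP /= fy fz scaler0 addr0.
Qed.

Definition lquot_lift_fun (q : lquot) : W := f (lrepr q).

Lemma lquot_lift_pi x : lquot_lift_fun (lpi x) = f x.
Proof.
apply/eqP; rewrite -subr_eq0 -linearB; apply/eqP/lquot_lift_span.
by apply/lpi_eq; rewrite lpi_repr.
Qed.

Lemma lquot_lift_linear : linear lquot_lift_fun.
Proof.
move=> a p q; rewrite -[p]lpi_repr -[q]lpi_repr -linearP !lquot_lift_pi.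
by rewrite linearP.
Qed.

Definition lquot_lift : {linear lquot -> W} := mklin lquot_lift_linear.
End Lift.
End LinearQuotient.

Section TensorProduct.
Context (k : fieldType) (V W : lmodType k).

Definition free : lmodType k := @dsum k (V * W)%type (fun=> k^o).
Definition basis (v : V) (w : W) : free :=
  @dsum_in k (V * W)%type (fun=> k^o) (v, w) (1 : k^o).

Lemma basisE v w (c : k^o) :
  @dsum_in k (V * W)%type (fun=> k^o) (v, w) c = c *: basis v w.
Proof. by rewrite /basis -linearZ_LR /GRing.scale /= mulr1. Qed.

Inductive tensor_rel : free -> Prop :=
  | tensor_relPl a v v' w :
      tensor_rel (basis (a *: v + v') w - (a *: basis v w + basis v' w))
  | tensor_relPr a v w w' :
      tensor_rel (basis v (a *: w + w') - (a *: basis v w + basis v w')).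

Definition tensor : lmodType k := lquot tensor_rel.

Definition pure (v : V) (w : W) : tensor := lpi tensor_rel (basis v w).

Lemma pure_linearl w : linear (pure^~ w).
Proof.
move=> a v v'; rewrite /pure -linearP; apply/lpi_eq/in_span_gen.
exact: tensor_relPl.
Qed.
Lemma pure_linearr v : linear (pure v).
Proof.
move=> a w w'; rewrite /pure -linearP; apply/lpi_eq/in_span_gen.
exact: tensor_relPr.
Qed.

Lemma tensor_ext (T : lmodType k) (f g : {linear tensor -> T}) :
  (forall v w, f (pure v w) = g (pure v w)) -> f =1 g.
Proof.
move=> fg q; rewrite -[q]lpi_repr; move: (lrepr q) => x.
have := @dsum_ext k _ _ _ (f \o @lpi _ _ tensor_rel) (g \o @lpi _ _ tensor_rel).
apply=> -[v w] c; rewrite basisE !linearZ /=; congr (_ *: _); exact: fg.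
Qed.

Section Lift.
Context (T : lmodType k) (b : V -> W -> T).
Context (bl : forall w, linear (b^~ w)) (br : forall v, linear (b v)).

Lemma tensor_scale_linear (p : V * W) : linear (fun c : k^o => c *: b p.1 p.2).
Proof. by move=> a c c'; rewrite scalerDl scalerA. Qed.

Definition free_lift : {linear free -> T} :=
  dsum_elim (fun p => mklin (tensor_scale_linear p)).

Lemma free_liftE v w : free_lift (basis v w) = b v w.
Proof. by rewrite /free_lift /basis dsum_elim_in mklinE scale1r. Qed.

Lemma free_lift_rel x : tensor_rel x -> free_lift x = 0.
Proof.
by case=> *; rewrite linearB linearP !free_liftE (bl, br) subrr.
Qed.

Definition tensor_lift : {linear tensor -> T} := lquot_lift free_lift_rel.

Lemma tensor_liftE v w : tensor_lift (pure v w) = b v w.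
Proof. exact: etrans (lquot_lift_pi free_lift_rel _) (free_liftE v w). Qed.
End Lift.
End TensorProduct.

Record epi (H G : finGroupType) := Epi {
  epi_fun :> H -> G;
  epiM : {morph epi_fun : x y / (x * y)%g};
  epi_surj : forall y, exists x, epi_fun x = y }.

Definition epi_id (G : finGroupType) : epi G G :=
  @Epi G G id (fun _ _ => erefl) (fun y => ex_intro _ y erefl).

Program Definition epi_comp (K H G : finGroupType) (g : epi H G) (f : epi K H) :
  epi K G := @Epi K G (fun x => g (f x)) _ _.
Next Obligation. by move=> K H G g f x y; rewrite !epiM. Qed.
Next Obligation.
by move=> K H G g f z; have [y <-] := epi_surj g z; have [x <-] := epi_surj f y; exists x.
Qed.

(* The morphisms of the category of groups considered here are the classes of
   this equivalence relation.                                                 *)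
Definition epi_conj (H G : finGroupType) (f g : epi H G) : Prop :=
  exists y : G, forall x, g x = (f x ^ y)%g.

Lemma epi1 (H G : finGroupType) (f : epi H G) : f 1%g = 1%g.
Proof. by apply: (mulgI (f 1%g)); rewrite -epiM !mulg1. Qed.

Definition epi_pair_set (G H K : finGroupType) (f : epi H G) (g : epi H K) :
  {set G * K} := [set (f x, g x) | x in [set: H]].

Lemma epi_pair_group_set (G H K : finGroupType) (f : epi H G) (g : epi H K) :
  group_set (epi_pair_set f g).
Proof.
apply/group_setP; split; first by apply/imsetP; exists 1%g; rewrite ?inE // !epi1.
move=> _ _ /imsetP[x _ ->] /imsetP[y _ ->]; apply/imsetP.
by exists (x * y)%g; rewrite ?inE // !epiM.
Qed.

Canonical epi_pair_group (G H K : finGroupType) (f : epi H G) (g : epi H K) :=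
  Group (epi_pair_group_set f g).

(* A full subcategory is given by its class of objects. *)
Definition replete (U : finGroupType -> Prop) : Prop :=
  forall G H : finGroupType, [set: G] \isog [set: H] -> U G -> U H.

Definition widely_closed (U : finGroupType -> Prop) : Prop :=
  forall (G H K : finGroupType) (f : epi H G) (g : epi H K),
    U G -> U H -> U K -> U (subg_of (epi_pair_group f g)).

Record gobj (U : finGroupType -> Prop) := GObj {
  gobj_group :> finGroupType;
  gobj_in : U gobj_group }.

Definition gobj_iso (U : finGroupType -> Prop) (G H : gobj U) : Prop :=
  [set: G] \isog [set: H].

Definition is_iso_class (U : finGroupType -> Prop) (C : gobj U -> Prop) : Prop :=
  exists G : gobj U, C = gobj_iso G.

Definition pi0 (U : finGroupType -> Prop) : Type :=
  {C : gobj U -> Prop | is_iso_class C}.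

Definition iso_class (U : finGroupType -> Prop) (G : gobj U) : pi0 U :=
  exist _ (gobj_iso G) (ex_intro _ G erefl).

Definition finite_type (T : Type) : Prop :=
  exists (n : nat) (f : 'I_n -> T), forall t, exists i, f i = t.

Definition essentially_finite (U : finGroupType -> Prop) : Prop :=
  finite_type (pi0 U).

Section Presheaves.
Context (k : fieldType) (U : finGroupType -> Prop).

Record psh := Psh {
  psh_ob :> gobj U -> lmodType k;
  psh_res : forall G H : gobj U, epi H G -> {linear psh_ob G -> psh_ob H};
  psh_res_conj : forall (G H : gobj U) (a b : epi H G),
    epi_conj a b -> psh_res a =1 psh_res b;
  psh_res_id : forall G : gobj U, psh_res (epi_id G) =1 id;
  psh_res_comp : forall (G H K : gobj U) (a : epi H G) (b : epi K H),
    psh_res (epi_comp a b) =1 psh_res b \o psh_res a }.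

Record nat_trans (X Y : psh) := NatTrans {
  nat_app :> forall G : gobj U, {linear X G -> Y G};
  nat_appE : forall (G H : gobj U) (a : epi H G) x,
    nat_app H (psh_res X a x) = psh_res Y a (nat_app G x) }.

Program Definition nt_id (X : psh) : nat_trans X X :=
  @NatTrans X X (fun G => idfun) _.
Next Obligation. by []. Qed.

Program Definition nt_comp (X Y Z : psh) (g : nat_trans Y Z) (f : nat_trans X Y) :
  nat_trans X Z := @NatTrans X Z (fun G => g G \o f G) _.
Next Obligation. by move=> X Y Z g f G H a x /=; rewrite !nat_appE. Qed.

Program Definition nt_zero (X Y : psh) : nat_trans X Y :=
  @NatTrans X Y (fun G => \0) _.
Next Obligation. by move=> X Y G H a x /=; rewrite linear0. Qed.

Program Definition nt_opp (X Y : psh) (f : nat_trans X Y) : nat_trans X Y :=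
  @NatTrans X Y (fun G => \- f G) _.
Next Obligation. by move=> X Y f G H a x /=; rewrite nat_appE linearN. Qed.

Program Definition psh_zero : psh :=
  @Psh (fun=> 'rV[k]_0) (fun _ _ _ => idfun) _ _ _.
Next Obligation. by []. Qed.
Next Obligation. by []. Qed.
Next Obligation. by []. Qed.

Program Definition psh_const : psh :=
  @Psh (fun=> k^o) (fun _ _ _ => idfun) _ _ _.
Next Obligation. by []. Qed.
Next Obligation. by []. Qed.
Next Obligation. by []. Qed.

Lemma pairP (A B : Type) (x y : A * B) : x.1 = y.1 -> x.2 = y.2 -> x = y.
Proof. by case: x y => [? ?] [? ?] /= -> ->. Qed.

Lemma pair_linear (A B C D : lmodType k) (f : {linear A -> C}) (g : {linear B -> D}) :
  linear (fun x : A * B => (f x.1, g x.2) : C * D).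
Proof. by move=> a x y /=; rewrite !linearP. Qed.

Program Definition psh_sum (X Y : psh) : psh :=
  @Psh (fun G => (X G * Y G)%type)
    (fun G H a => mklin (pair_linear (psh_res X a) (psh_res Y a))) _ _ _.
Next Obligation.
by move=> X Y G H a b ab x; rewrite !mklinE !(psh_res_conj ab).
Qed.
Next Obligation. by move=> X Y G [x y]; rewrite mklinE !psh_res_id. Qed.
Next Obligation. by move=> X Y G H K a b x; rewrite mklinE !psh_res_comp. Qed.

Section DirectSumMap.
Context (I : Type) (A B : I -> lmodType k) (f : forall i, {linear A i -> B i}).

Lemma dsum_map_fin (x : dsum A) : fin_supp (fun i => f i (x i)).
Proof.
case: (dsum_fin x) => s Hs; exists s => i H; apply: Hs => xi0.
by apply: H; rewrite xi0 linear0.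
Qed.

Lemma dsum_map_linear : linear (fun x => Dsum (dsum_map_fin x)).
Proof. by move=> a x y; apply: dsumP => i /=; rewrite linearP. Qed.

Definition dsum_map : {linear dsum A -> dsum B} := mklin dsum_map_linear.

Lemma dsum_mapE x i : dsum_map x i = f i (x i). Proof. by []. Qed.
End DirectSumMap.

Program Definition psh_dsum (I : Type) (X : I -> psh) : psh :=
  @Psh (fun G => dsum (fun i => X i G))
    (fun G H a => dsum_map (fun i => psh_res (X i) a)) _ _ _.
Next Obligation.
by move=> I X G H a b ab x; apply: dsumP => i; rewrite !dsum_mapE (psh_res_conj ab).
Qed.
Next Obligation.
by move=> I X G x; apply: dsumP => i; rewrite !dsum_mapE psh_res_id.
Qed.
Next Obligation.
by move=> I X G H K a b x; apply: dsumP => i; rewrite !dsum_mapE psh_res_comp.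
Qed.

Record cplx := Cplx {
  cplx_ob :> int -> psh;
  cplx_d : forall n : int, nat_trans (cplx_ob n) (cplx_ob (n + 1));
  cplx_dd : forall n G x, cplx_d (n + 1) G (cplx_d n G x) = 0 }.

Arguments cplx_d X n : rename.

Record cmap (X Y : cplx) := CMap {
  cmap_app :> forall n : int, nat_trans (X n) (Y n);
  cmap_appE : forall n G x,
    cmap_app (n + 1) G (cplx_d X n G x) = cplx_d Y n G (cmap_app n G x) }.

Definition cmap_eq (X Y : cplx) (f g : cmap X Y) : Prop :=
  forall n G x, f n G x = g n G x.

Program Definition cmap_id (X : cplx) : cmap X X :=
  @CMap X X (fun n => nt_id (X n)) _.
Next Obligation. by []. Qed.

Program Definition cmap_comp (X Y Z : cplx) (g : cmap Y Z) (f : cmap X Y) :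
  cmap X Z := @CMap X Z (fun n => nt_comp (g n) (f n)) _.
Next Obligation. by move=> X Y Z g f n G x /=; rewrite !cmap_appE. Qed.

Program Definition cmap_zero (X Y : cplx) : cmap X Y :=
  @CMap X Y (fun n => nt_zero (X n) (Y n)) _.
Next Obligation. by move=> X Y n G x /=; rewrite linear0. Qed.

(* Bijectivity of all the maps H^(n+1)(X(G)) -> H^(n+1)(Y(G)); every integer is
   of the form n + 1, and kernels and cokernels of functors are pointwise.    *)
Definition qis (X Y : cplx) (f : cmap X Y) : Prop :=
  forall (G : gobj U) (n : int),
    (forall x : X (n + 1) G, cplx_d X (n + 1) G x = 0 ->
       (exists y, f (n + 1) G x = cplx_d Y n G y) ->
       exists x', x = cplx_d X n G x') /\
    (forall y : Y (n + 1) G, cplx_d Y (n + 1) G y = 0 ->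
       exists x y', cplx_d X (n + 1) G x = 0 /\
                    y = f (n + 1) G x + cplx_d Y n G y').

Definition acyclic_at (X : cplx) (G : gobj U) : Prop :=
  forall (n : int) (x : X (n + 1) G), cplx_d X (n + 1) G x = 0 ->
    exists x', x = cplx_d X n G x'.

Program Definition cplx_zero : cplx :=
  @Cplx (fun=> psh_zero) (fun n => nt_zero psh_zero psh_zero) _.
Next Obligation. by []. Qed.

(* The unit: the constant functor k in degree 0. *)
Definition cplx_unit_ob (n : int) : psh := if n == 0 then psh_const else psh_zero.
Program Definition cplx_unit : cplx :=
  @Cplx cplx_unit_ob (fun n => nt_zero _ _) _.
Next Obligation. by []. Qed.

Program Definition shift (X : cplx) : cplx :=
  @Cplx (fun n => X (n + 1)) (fun n => nt_opp (cplx_d X (n + 1))) _.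
Next Obligation. by move=> X n G x /=; rewrite linearN opprK cplx_dd. Qed.

Program Definition shift_cmap (X Y : cplx) (f : cmap X Y) :
  cmap (shift X) (shift Y) :=
  @CMap (shift X) (shift Y) (fun n => f (n + 1)) _.
Next Obligation. by move=> X Y f n G x /=; rewrite linearN cmap_appE. Qed.

Lemma oppr_eq0P (V : zmodType) (x : V) : - x = 0 -> x = 0.
Proof. by move=> /eqP; rewrite oppr_eq0 => /eqP. Qed.

Lemma shift_qis (X Y : cplx) (f : cmap X Y) : qis f -> qis (shift_cmap f).
Proof.
move=> qf G n; have [inj sur] := qf G (n + 1); split=> /=.
  move=> x /oppr_eq0P dx [y fx]; have [|x' ->] := inj x dx.
    by exists (- y); rewrite linearN.
  by exists (- x'); rewrite linearN opprK.
move=> y /oppr_eq0P dy; have [x [y' [dx ->]]] := sur y dy.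
by exists x, (- y'); rewrite dx oppr0 linearN opprK.
Qed.

Program Definition nt_pair (X X' Y Y' : psh) (f : nat_trans X Y) (g : nat_trans X' Y') :
  nat_trans (psh_sum X X') (psh_sum Y Y') :=
  @NatTrans (psh_sum X X') (psh_sum Y Y')
    (fun G => mklin (pair_linear (f G) (g G))) _.
Next Obligation. by move=> X X' Y Y' f g G H a x /=; rewrite !nat_appE. Qed.

Program Definition csum (X Y : cplx) : cplx :=
  @Cplx (fun n => psh_sum (X n) (Y n))
    (fun n => nt_pair (cplx_d X n) (cplx_d Y n)) _.
Next Obligation. by move=> X Y n G x /=; rewrite !cplx_dd. Qed.

Program Definition csum_map (X X' Y Y' : cplx) (f : cmap X Y) (g : cmap X' Y') :
  cmap (csum X X') (csum Y Y') :=
  @CMap (csum X X') (csum Y Y') (fun n => nt_pair (f n) (g n)) _.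
Next Obligation. by move=> X X' Y Y' f g n G x /=; rewrite !cmap_appE. Qed.

Lemma csum_map_qis (X X' Y Y' : cplx) (f : cmap X Y) (g : cmap X' Y') :
  qis f -> qis g -> qis (csum_map f g).
Proof.
move=> qf qg G n; have [fi fs] := qf G n; have [gi gs] := qg G n; split=> /=.
  move=> [x x'] /= [dx dx'] [[y y'] /= [fx gx']].
  have [|x1 ->] := fi x dx; first by exists y.
  have [|x1' ->] := gi x' dx'; first by exists y'.
  by exists (x1, x1').
move=> [y y'] /= [dy dy']; have [x [y1 [dx ->]]] := fs y dy.
have [x' [y1' [dx' ->]]] := gs y' dy'.
by exists (x, x'), (y1, y1') => /=; rewrite dx dx'.
Qed.

Lemma diag_linear (V : lmodType k) : linear (fun x : V => (x, x) : V * V).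
Proof. by []. Qed.
Lemma codiag_linear (V : lmodType k) : linear (fun x : V * V => x.1 + x.2).
Proof. by move=> a x y /=; rewrite scalerDr addrACA. Qed.

Program Definition nt_diag (X : psh) : nat_trans X (psh_sum X X) :=
  @NatTrans X (psh_sum X X) (fun G => mklin (@diag_linear (X G))) _.
Next Obligation. by []. Qed.
Program Definition nt_codiag (X : psh) : nat_trans (psh_sum X X) X :=
  @NatTrans (psh_sum X X) X (fun G => mklin (@codiag_linear (X G))) _.
Next Obligation. by move=> X G H a x /=; rewrite linearD. Qed.

Program Definition cmap_diag (X : cplx) : cmap X (csum X X) :=
  @CMap X (csum X X) (fun n => nt_diag (X n)) _.
Next Obligation. by []. Qed.
Program Definition cmap_codiag (X : cplx) : cmap (csum X X) X :=
  @CMap (csum X X) X (fun n => nt_codiag (X n)) _.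
Next Obligation. by move=> X n G x /=; rewrite linearD. Qed.

(* Mapping cone: cone(f)^n = X^(n+1) (+) Y^n, d(x, y) = (- d x, f x + d y). *)
Section Cone.
Context (X Y : cplx) (f : cmap X Y).

Definition cone_ob (n : int) : psh := psh_sum (X (n + 1)) (Y n).

Lemma cone_d_linear n (G : gobj U) :
  linear (fun x : X (n + 1) G * Y n G =>
    (- cplx_d X (n + 1) G x.1, f (n + 1) G x.1 + cplx_d Y n G x.2)
      : X (n + 1 + 1) G * Y (n + 1) G).
Proof.
move=> a x y; apply: pairP => /=.
  by rewrite linearP opprD scalerN.
by rewrite !linearP scalerDr addrACA.
Qed.

Program Definition cone_d (n : int) : nat_trans (cone_ob n) (cone_ob (n + 1)) :=
  @NatTrans (cone_ob n) (cone_ob (n + 1)) (fun G => mklin (@cone_d_linear n G)) _.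
Next Obligation.
move=> n G H a x /=; congr (_, _); first by rewrite nat_appE linearN.
by rewrite !nat_appE linearD.
Qed.

Program Definition cone : cplx := @Cplx cone_ob cone_d _.
Next Obligation.
move=> n G x /=; apply: pairP => /=.
  by rewrite linearN opprK cplx_dd.
by rewrite linearN linearD cmap_appE cplx_dd addr0 addNr.
Qed.

Lemma inr_linear (V W : lmodType k) : linear (fun y : W => (0, y) : V * W).
Proof. by move=> a x y; apply: pairP; rewrite /= ?scaler0 ?addr0. Qed.
Lemma fst_linear (V W : lmodType k) : linear (fun x : V * W => x.1).
Proof. by []. Qed.

Program Definition cone_in : cmap Y cone :=
  @CMap Y cone (fun n => @NatTrans (Y n) (cone_ob n)
    (fun G => mklin (@inr_linear (X (n + 1) G) (Y n G))) _) _.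
Next Obligation. by move=> n G H a x /=; rewrite linear0. Qed.
Next Obligation. by move=> n G x /=; rewrite !linear0 add0r. Qed.

Program Definition cone_out : cmap cone (shift X) :=
  @CMap cone (shift X) (fun n => @NatTrans (cone_ob n) (X (n + 1))
    (fun G => mklin (@fst_linear (X (n + 1) G) (Y n G))) _) _.
Next Obligation. by []. Qed.
Next Obligation. by []. Qed.
End Cone.

Program Definition nt_dsum (I : Type) (X Y : I -> psh)
    (f : forall i, nat_trans (X i) (Y i)) : nat_trans (psh_dsum X) (psh_dsum Y) :=
  @NatTrans (psh_dsum X) (psh_dsum Y) (fun G => dsum_map (fun i => f i G)) _.
Next Obligation. by move=> I X Y f G H a x; apply: dsumP => i /=; rewrite nat_appE. Qed.

Program Definition cdsum (I : Type) (X : I -> cplx) : cplx :=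
  @Cplx (fun n => psh_dsum (fun i => X i n))
    (fun n => nt_dsum (fun i => cplx_d (X i) n)) _.
Next Obligation. by move=> I X n G x; apply: dsumP => i /=; rewrite cplx_dd. Qed.

Lemma dsum_map_in (I : Type) (A B : I -> lmodType k)
    (f : forall i, {linear A i -> B i}) i (x : A i) :
  dsum_map f (dsum_in A i x) = dsum_in B i (f i x).
Proof.
apply: dsumP => j /=; case: (pselect (i = j)) => [<-|ij].
  by rewrite !dsum_in_id.
by rewrite !dsum_in_neq // linear0.
Qed.

Program Definition cdsum_in (I : Type) (X : I -> cplx) (i : I) : cmap (X i) (cdsum X) :=
  @CMap (X i) (cdsum X) (fun n => @NatTrans (X i n) (psh_dsum (fun i => X i n))
    (fun G => dsum_in (fun i => X i n G) i) _) _.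
Next Obligation.
by move=> I X i n G H a x; rewrite [RHS](dsum_map_in (fun i => psh_res (X i n) a)).
Qed.
Next Obligation.
by move=> I X i n G x; rewrite [RHS](dsum_map_in (fun i => cplx_d (X i) n G)).
Qed.

(* Tensor product, taken over k at each group:
   (X (x) Y)^n(G) = (+)_(i + j = n) X^i(G) (x) Y^j(G),
   d(x (x) y) = d x (x) y + (-1)^i x (x) d y. Over a field it is exact in both
   variables, hence it is its own derived functor.                            *)
Section Tensor.
Context (X Y : cplx).

Definition bidegree (n : int) : Type := {p : int * int | p.1 + p.2 == n}.

Definition tens_mod (n : int) (G : gobj U) : lmodType k :=
  dsum (fun p : bidegree n => tensor (X (sval p).1 G) (Y (sval p).2 G)).

Definition tens_in (n : int) (G : gobj U) (i j : int) (e : i + j == n)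
    (x : X i G) (y : Y j G) : tens_mod n G :=
  dsum_in (fun p : bidegree n => tensor (X (sval p).1 G) (Y (sval p).2 G))
    (exist _ (i, j) e) (pure x y).

Lemma tens_in_linearl n G i j e y : linear (fun x => @tens_in n G i j e x y).
Proof. by move=> a x x'; rewrite /tens_in pure_linearl linearP. Qed.
Lemma tens_in_linearr n G i j e x : linear (@tens_in n G i j e x).
Proof. by move=> a y y'; rewrite /tens_in pure_linearr linearP. Qed.

Section Lift.
Context (n : int) (G : gobj U) (T : lmodType k).
Context (b : forall i j : int, i + j == n -> X i G -> Y j G -> T).
Context (bl : forall i j e y, linear (fun x => @b i j e x y)).
Context (br : forall i j e x, linear (@b i j e x)).

Definition tens_lift : {linear tens_mod n G -> T} :=
  dsum_elim (fun p : bidegree n =>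
    tensor_lift (@bl (sval p).1 (sval p).2 (proj2_sig p))
                (@br (sval p).1 (sval p).2 (proj2_sig p))).

Lemma tens_liftE i j (e : i + j == n) x y : tens_lift (tens_in e x y) = b e x y.
Proof. by rewrite /tens_lift /tens_in dsum_elim_in tensor_liftE. Qed.
End Lift.

Lemma tens_ext n G (T : lmodType k) (f g : {linear tens_mod n G -> T}) :
  (forall i j (e : i + j == n) x y, f (tens_in e x y) = g (tens_in e x y)) ->
  f =1 g.
Proof.
move=> fg; apply: dsum_ext => -[[i j] e].
apply: (@tensor_ext _ _ _ _ (f \o dsum_in _ (exist _ (i, j) e))
                            (g \o dsum_in _ (exist _ (i, j) e))) => x y.
exact: fg.
Qed.

Section Restriction.
Context (n : int) (G H : gobj U) (a : epi H G).

Definition tens_res_fun i j (e : i + j == n) (x : X i G) (y : Y j G) :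
  tens_mod n H := tens_in e (psh_res (X i) a x) (psh_res (Y j) a y).

Lemma tens_res_linearl i j e y : linear (fun x => @tens_res_fun i j e x y).
Proof. by move=> c x x'; rewrite /tens_res_fun linearP tens_in_linearl. Qed.
Lemma tens_res_linearr i j e x : linear (@tens_res_fun i j e x).
Proof. by move=> c y y'; rewrite /tens_res_fun linearP tens_in_linearr. Qed.

Definition tens_res : {linear tens_mod n G -> tens_mod n H} :=
  tens_lift tens_res_linearl tens_res_linearr.

Lemma tens_resE i j (e : i + j == n) (x : X i G) (y : Y j G) :
  tens_res (tens_in e x y) = tens_in e (psh_res (X i) a x) (psh_res (Y j) a y).
Proof. exact: tens_liftE. Qed.
End Restriction.

Program Definition tens_ob (n : int) : psh :=
  @Psh (tens_mod n) (tens_res n) _ _ _.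
Next Obligation.
move=> n G H a b ab; apply: tens_ext => i j e x y.
by rewrite !tens_resE !(psh_res_conj ab).
Qed.
Next Obligation.
move=> n G; apply: (tens_ext (g := idfun)) => i j e x y.
by rewrite tens_resE !psh_res_id.
Qed.
Next Obligation.
move=> n G H K a b.
apply: (tens_ext (g := tens_res n b \o tens_res n a)) => i j e x y.
by rewrite -[RHS]/(tens_res n b (tens_res n a _)) !tens_resE !psh_res_comp.
Qed.

Section Differential.
Context (n : int) (G : gobj U).

Lemma bidegreel i j : i + j == n -> (i + 1) + j == n + 1.
Proof. by move=> /eqP <-; rewrite addrAC. Qed.
Lemma bidegreer i j : i + j == n -> i + (j + 1) == n + 1.
Proof. by move=> /eqP <-; rewrite addrA. Qed.

Definition tens_d_fun i j (e : i + j == n) (x : X i G) (y : Y j G) :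
    tens_mod (n + 1) G :=
  tens_in (bidegreel e) (cplx_d X i G x) y +
  (-1) ^+ absz i *: tens_in (bidegreer e) x (cplx_d Y j G y).

Lemma tens_d_linearl i j e y : linear (fun x => @tens_d_fun i j e x y).
Proof.
move=> c x x'; rewrite /tens_d_fun linearP !tens_in_linearl !scalerDr.
by rewrite !scalerA [_ * c]mulrC addrACA.
Qed.
Lemma tens_d_linearr i j e x : linear (@tens_d_fun i j e x).
Proof.
move=> c y y'; rewrite /tens_d_fun linearP !tens_in_linearr !scalerDr.
by rewrite !scalerA [_ * c]mulrC addrACA.
Qed.

Definition tens_d_mod : {linear tens_mod n G -> tens_mod (n + 1) G} :=
  tens_lift tens_d_linearl tens_d_linearr.

Lemma tens_d_modE i j (e : i + j == n) (x : X i G) (y : Y j G) :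
  tens_d_mod (tens_in e x y) =
    tens_in (bidegreel e) (cplx_d X i G x) y +
    (-1) ^+ absz i *: tens_in (bidegreer e) x (cplx_d Y j G y).
Proof. exact: tens_liftE. Qed.
End Differential.

Program Definition tens_d (n : int) : nat_trans (tens_ob n) (tens_ob (n + 1)) :=
  @NatTrans (tens_ob n) (tens_ob (n + 1)) (tens_d_mod n) _.
Next Obligation.
move=> n G H a.
apply: (tens_ext (f := tens_d_mod n H \o tens_res n a)
                 (g := tens_res (n + 1) a \o tens_d_mod n G)) => i j e x y.
rewrite -[LHS]/(tens_d_mod n H (tens_res n a _)).
rewrite -[RHS]/(tens_res (n + 1) a (tens_d_mod n G _)) tens_resE !tens_d_modE linearD linearZ !tens_resE.
by rewrite !nat_appE.
Qed.

Lemma tens_in0l n G i j e y : @tens_in n G i j e 0 y = 0.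
Proof. by have := tens_in_linearl e y (-1) 0 0; rewrite scaler0 addr0 scaleN1r addNr. Qed.
Lemma tens_in0r n G i j e x : @tens_in n G i j e x 0 = 0.
Proof. by have := tens_in_linearr e x (-1) 0 0; rewrite scaler0 addr0 scaleN1r addNr. Qed.

Lemma sign_succ (i : int) : (-1) ^+ absz (i + 1) = - (-1) ^+ absz i :> k.
Proof.
case: i => [m|[|m]].
- have -> : absz (m%:Z + 1) = m.+1 by rewrite -PoszD addn1.
  by rewrite exprS mulN1r.
- by rewrite /= expr1 opprK.
have -> : absz (Negz m.+1 + 1) = m.+1 by rewrite NegzE -[m.+2]addn1 PoszD opprD addrNK abszN.
by rewrite /= [in RHS]exprS mulN1r opprK.
Qed.

Program Definition tens : cplx := @Cplx tens_ob tens_d _.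
Next Obligation.
move=> n G.
apply: (tens_ext (f := tens_d_mod (n + 1) G \o tens_d_mod n G) (g := \0))
  => i j e x y.
rewrite -[LHS]/(tens_d_mod (n + 1) G (tens_d_mod n G _)) -[RHS]/0.
rewrite tens_d_modE linearD linearZ !tens_d_modE.
rewrite !cplx_dd tens_in0l tens_in0r scaler0 addr0 add0r.
rewrite (bool_irrelevance (bidegreel (bidegreer e)) (bidegreer (bidegreel e))).
rewrite -scalerDl; set s := (_ + _ : k); suff -> : s = 0 by rewrite scale0r.
by rewrite /s sign_succ addNr.
Qed.
End Tensor.

Fixpoint tens_pow (X : cplx) (m : nat) : cplx :=
  if m is m'.+1 then (if m' is _.+1 then tens (tens_pow X m') X else X)
  else cplx_unit.

(* The derived category: localization of cochain complexes at the
   quasi-isomorphisms. The morphisms X -> Y are the classes of the elements of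
   dhom X Y modulo deq.                                                       *)
Inductive dhom : cplx -> cplx -> Type :=
  | Dmap X Y (f : cmap X Y) : dhom X Y
  | Dinv X Y (s : cmap X Y) (qs : qis s) : dhom Y X
  | Dcomp X Y Z (g : dhom Y Z) (f : dhom X Y) : dhom X Z.

Definition Did (X : cplx) : dhom X X := Dmap (cmap_id X).
Definition Dzero (X Y : cplx) : dhom X Y := Dmap (cmap_zero X Y).

Inductive deq : forall X Y : cplx, dhom X Y -> dhom X Y -> Prop :=
  | deq_refl X Y (f : dhom X Y) : deq f f
  | deq_sym X Y (f g : dhom X Y) : deq f g -> deq g f
  | deq_trans X Y (f g h : dhom X Y) : deq f g -> deq g h -> deq f h
  | deq_comp X Y Z (g g' : dhom Y Z) (f f' : dhom X Y) :
      deq g g' -> deq f f' -> deq (Dcomp g f) (Dcomp g' f')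
  | deq_assoc X Y Z T (h : dhom Z T) (g : dhom Y Z) (f : dhom X Y) :
      deq (Dcomp h (Dcomp g f)) (Dcomp (Dcomp h g) f)
  | deq_idl X Y (f : dhom X Y) : deq (Dcomp (Did Y) f) f
  | deq_idr X Y (f : dhom X Y) : deq (Dcomp f (Did X)) f
  | deq_map X Y (f g : cmap X Y) : cmap_eq f g -> deq (Dmap f) (Dmap g)
  | deq_map_comp X Y Z (g : cmap Y Z) (f : cmap X Y) :
      deq (Dmap (cmap_comp g f)) (Dcomp (Dmap g) (Dmap f))
  | deq_invl X Y (s : cmap X Y) (qs : qis s) :
      deq (Dcomp (Dinv qs) (Dmap s)) (Did X)
  | deq_invr X Y (s : cmap X Y) (qs : qis s) :
      deq (Dcomp (Dmap s) (Dinv qs)) (Did Y).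

Lemma cmap_id_qis (X : cplx) : qis (cmap_id X).
Proof.
move=> G n; split=> [x _ [y e]|y dy]; first by exists y.
by exists y, 0; rewrite linear0 addr0.
Qed.

Fixpoint Dshift (X Y : cplx) (f : dhom X Y) : dhom (shift X) (shift Y) :=
  match f in dhom X Y return dhom (shift X) (shift Y) with
  | Dmap _ _ f => Dmap (shift_cmap f)
  | Dinv _ _ _ qs => Dinv (shift_qis qs)
  | Dcomp _ _ _ g f => Dcomp (Dshift g) (Dshift f)
  end.

(* f (+) id_A and id_A (+) f *)
Fixpoint Dsumr (A X Y : cplx) (f : dhom X Y) : dhom (csum X A) (csum Y A) :=
  match f in dhom X Y return dhom (csum X A) (csum Y A) with
  | Dmap _ _ f => Dmap (csum_map f (cmap_id A))
  | Dinv _ _ _ qs => Dinv (csum_map_qis qs (cmap_id_qis A))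
  | Dcomp _ _ _ g f => Dcomp (Dsumr A g) (Dsumr A f)
  end.
Fixpoint Dsuml (A X Y : cplx) (f : dhom X Y) : dhom (csum A X) (csum A Y) :=
  match f in dhom X Y return dhom (csum A X) (csum A Y) with
  | Dmap _ _ f => Dmap (csum_map (cmap_id A) f)
  | Dinv _ _ _ qs => Dinv (csum_map_qis (cmap_id_qis A) qs)
  | Dcomp _ _ _ g f => Dcomp (Dsuml A g) (Dsuml A f)
  end.

(* The addition of an additive category, obtained from its biproducts:
   X -> X (+) X -> Y (+) X -> Y (+) Y -> Y.                                   *)
Definition Dadd (X Y : cplx) (f g : dhom X Y) : dhom X Y :=
  Dcomp (Dmap (cmap_codiag Y))
    (Dcomp (Dsuml Y g) (Dcomp (Dsumr X f) (Dmap (cmap_diag X)))).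

Definition Diso (X Y : cplx) (f : dhom X Y) : Prop :=
  exists g : dhom Y X, deq (Dcomp g f) (Did X) /\ deq (Dcomp f g) (Did Y).

Definition Dretract (X Y : cplx) : Prop :=
  exists (i : dhom X Y) (r : dhom Y X), deq (Dcomp r i) (Did X).

(* Isomorphic to X -> Y -> cone(f) -> X[1] for a map of complexes f. *)
Definition distinguished (X Y Z : cplx)
    (u : dhom X Y) (v : dhom Y Z) (w : dhom Z (shift X)) : Prop :=
  exists (A B : cplx) (f : cmap A B)
    (a : dhom X A) (b : dhom Y B) (c : dhom Z (cone f)),
    [/\ Diso a, Diso b & Diso c] /\
    [/\ deq (Dcomp b u) (Dcomp (Dmap f) a),
        deq (Dcomp c v) (Dcomp (Dmap (cone_in f)) b) &
        deq (Dcomp (Dshift a) w) (Dcomp (Dmap (cone_out f)) c)].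

(* The image in Hom(X, (+)_i Y_i) of the element of (+)_i Hom(X, Y_i) with
   components f i for i in the duplicate-free list s, and 0 elsewhere.        *)
Definition Dcomb (I : Type) (X : cplx) (Y : I -> cplx)
    (f : forall i, dhom X (Y i)) (s : seq I) : dhom X (cdsum Y) :=
  foldr (fun i h => Dadd (Dcomp (Dmap (cdsum_in Y i)) (f i)) h)
        (Dzero X (cdsum Y)) s.

(* (+)_i Hom(X, Y_i) -> Hom(X, (+)_i Y_i) is bijective for all families Y.
   Direct sums of complexes are coproducts in the derived category, because
   direct sums of vector spaces are exact.                                    *)
Definition compact (X : cplx) : Prop :=
  forall (I : Type) (Y : I -> cplx),
    (forall h : dhom X (cdsum Y),
       exists (s : seq {classic I}) (f : forall i, dhom X (Y i)),
         uniq s /\ deq h (Dcomb f s)) /\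
    (forall (s : seq {classic I}) (f : forall i, dhom X (Y i)),
       uniq s -> deq (Dcomb f s) (Dzero X (cdsum Y)) ->
       forall i : I, (i : {classic I}) \in s -> deq (f i) (Dzero X (Y i))).

(* A full subcategory of the category of compact objects is given by its class
   of objects, a predicate on all complexes.                                  *)
Record thick (J : cplx -> Prop) : Prop := {
  thick_compact : forall X, J X -> compact X;
  thick_zero : J cplx_zero;
  thick_shift : forall X, compact X -> (J (shift X) <-> J X);
  thick_triangle : forall X Y Z (u : dhom X Y) (v : dhom Y Z) (w : dhom Z (shift X)),
    compact X -> compact Y -> compact Z -> distinguished u v w ->
    [/\ J X -> J Y -> J Z, J Y -> J Z -> J X & J X -> J Z -> J Y];
  thick_retract : forall X Y, compact X -> Dretract X Y -> J Y -> J X }.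

Record thick_ideal (J : cplx -> Prop) : Prop := {
  thick_ideal_thick : thick J;
  thick_ideal_tens : forall X Y, J X -> compact Y -> J (tens X Y) }.

Definition radical (J : cplx -> Prop) : Prop :=
  forall X (m : nat), compact X -> (0 < m)%N -> J (tens_pow X m) -> J X.

Record prime_ideal (P : cplx -> Prop) : Prop := {
  prime_thick_ideal : thick_ideal P;
  prime_proper : exists X, compact X /\ ~ P X;
  prime_tens : forall X Y, compact X -> compact Y -> P (tens X Y) -> P X \/ P Y }.

Definition Spc : Type := {P : cplx -> Prop | prime_ideal P}.

Definition supp (X : cplx) : Spc -> Prop := fun P => ~ sval P X.

Definition group_prime (G : gobj U) : cplx -> Prop :=
  fun X => compact X /\ acyclic_at X G.
End Presheaves.

(* A topology is given by its class of closed sets; here the closed sets are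
   the intersections of members of a basis B of closed sets.                  *)
Definition closed_from (T : Type) (B : (T -> Prop) -> Prop) (Z : T -> Prop) : Prop :=
  exists F : (T -> Prop) -> Prop,
    (forall A, F A -> B A) /\ forall t, Z t <-> forall A, F A -> A t.

Definition Spc_closed (k : fieldType) (U : finGroupType -> Prop) :
    (Spc k U -> Prop) -> Prop :=
  closed_from (fun A => exists X : cplx k U, compact X /\ A = supp X).

Definition discrete_closed (T : Type) : (T -> Prop) -> Prop := fun=> True.

Record homeomorphism (S T : Type) (closedS : (S -> Prop) -> Prop)
    (closedT : (T -> Prop) -> Prop) (f : S -> T) : Prop := {
  homeo_inj : injective f;
  homeo_surj : forall t, exists s, f s = t;
  homeo_continuous : forall Z, closedT Z -> closedS (fun s => Z (f s));
  homeo_closed : forall Z, closedS Z -> closedT (fun t => exists2 s, Z s & f s = t) }.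

(* Main.v *)
Require Import Defs.
From HB Require Import structures.
From mathcomp Require Import all_boot all_order all_algebra all_fingroup.
From mathcomp Require Import boolp.
From mathcomp Require classical_sets.
From Corelib Require Import Setoid Morphisms.

(* A complex X is compact if and only if the total cohomology of X(G) is
   finite-dimensional for every G. If it is, X has a resolution by finitely many
   twisted copies of left Kan extensions from the automorphism group of one group
   (free complexes), built by treating the groups in increasing order; averaging
   over automorphisms, possible in characteristic zero, makes these extensions
   projective. Conversely, mapping a compact X to the direct sum, over a basis of
   the cohomology of X(G), of copies of the right Kan extension of k from G, and
   factoring that map through a finite sum, bounds the dimension.

   Let T be the functor with value k[Iso(K, G)/conj] at K, zero off the class of
   G. If X(G) has a nonzero class, it splits off T, in the right degree, from
   X (x) T; conversely, by averaging, the part of any X concentrated at G is a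
   retract of T (x) X. Filtering X by the order of the groups, a compact X
   therefore lies in a thick ideal J as soon as its support is contained in that
   of J. Radicality and the classification of primes follow, using that supports
   of tensor products are intersections of supports (Kuenneth).                *)

Set Implicit Arguments.
Unset Strict Implicit.
Unset Printing Implicit Defensive.

Import GRing.Theory.
Local Open Scope ring_scope.
Local Obligation Tactic := idtac.

(** * Identities in additive groups *)

(** A surjection between finite groups of equal order is an isomorphism, and every other surjection
    strictly lowers the order. So a presheaf consists of representations of outer automorphism
    groups, one for each isomorphism class, linked by maps in one direction only: from a group to
    the groups that map onto it. The values on large groups thus form a subobject, which is why both
    the resolutions and the filtrations run along lists sorted by order.

    The obstacle is that morphisms of the derived category are words in maps and formal inverses,
    modulo a generated relation. Equalities are produced through a cylinder object (homotopic maps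
    agree) and K-projective resolutions (each word becomes one fraction); consequences of equalities
    are extracted by following cohomology classes along words. K-projectivity holds because over a
    field acyclic complexes are contractible at each group, and averaging makes the contraction
    compatible with automorphisms.

    The object T keeps track of an isomorphism with G. This is why a functional on X(G) that detects
    one class suffices to split off T, without being invariant under automorphisms. *)

Section AdditiveExpressions.
(** Syntax for a reflexive decision procedure: two additive expressions agree in every abelian group
    as soon as their integer coefficients do, and these are compared by computation. *)
Inductive zexp := ZVar of nat | Z0 | ZAdd of zexp & zexp | ZOpp of zexp.

Fixpoint zval (V : zmodType) (env : seq V) (e : zexp) : V :=
  match e with
  | ZVar i => nth 0 env i
  | Z0 => 0
  | ZAdd a b => zval env a + zval env b
  | ZOpp a => - zval env a
  end.

Fixpoint zcoef (e : zexp) (i : nat) : int :=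
  match e with
  | ZVar j => (i == j)%:R
  | Z0 => 0
  | ZAdd a b => zcoef a i + zcoef b i
  | ZOpp a => - zcoef a i
  end.

Lemma zvalE (V : zmodType) (env : seq V) (e : zexp) :
  zval env e = \sum_(i < size env) env`_i *~ zcoef e i.
Proof.
elim: e => [j||a Ha b Hb|a Ha] /=.
- have [jlt|jge] := ltnP j (size env); last first.
    rewrite nth_default // big1 // => i _; case: eqP => [ij|_]; rewrite ?mulr0z //.
    by move: (ltn_ord i); rewrite ij ltnNge jge.
  rewrite (bigD1 (Ordinal jlt)) //= eqxx mulr1z big1 ?addr0 // => i ij.
  by rewrite -val_eqE /= in ij; rewrite (negPf ij) mulr0z.
- by rewrite big1 // => i _; rewrite mulr0z.
- by rewrite Ha Hb -big_split; apply: eq_bigr => i _; rewrite mulrzDr.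
- by rewrite Ha -sumrN; apply: eq_bigr => i _; rewrite mulrNz.
Qed.

Lemma zval_eq (V : zmodType) (env : seq V) (a b : zexp) :
  all (fun i => zcoef a i == zcoef b i) (iota 0 (size env)) ->
  zval env a = zval env b.
Proof.
move=> /allP ab; rewrite !zvalE; apply: eq_bigr => i _.
by have /eqP -> : zcoef a i == zcoef b i by apply: ab; rewrite mem_iota /=.
Qed.

(** Feeds a known equation to the procedure: what remains is an identity between differences, free
    of hypotheses. *)
Lemma eq_by_sub (V : zmodType) (a b c d : V) : c = d -> a - b = c - d -> a = b.
Proof. by move=> -> /eqP; rewrite subrr subr_eq0 => /eqP. Qed.
End AdditiveExpressions.

(* Atoms are compared up to conversion: the same module structure is often
   reached along different inheritance paths. *)
Ltac zmod_mem x l :=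
  match l with
  | nil => constr:(false)
  | cons ?y ?l' =>
    match constr:(Set) with
    | _ => let _ := match constr:(Set) with _ => unify x y end in constr:(true)
    | _ => zmod_mem x l'
    end
  end.

Ltac zmod_env t l :=
  match t with
  | @Algebra.add _ ?a ?b => let l := zmod_env a l in zmod_env b l
  | @Algebra.opp _ ?a => zmod_env a l
  | @Algebra.zero _ => l
  | _ => match zmod_mem t l with
         | true => l
         | false => constr:(cons t l)
         end
  end.

Ltac zmod_index x l :=
  match l with
  | cons ?y ?l' =>
    match constr:(Set) with
    | _ => let _ := match constr:(Set) with _ => unify x y end in constr:(0%N)
    | _ => let n := zmod_index x l' in constr:(S n)
    end
  end.

Ltac zmod_reify t l :=
  match t with
  | @Algebra.add _ ?a ?b =>
    let a := zmod_reify a l in let b := zmod_reify b l in constr:(ZAdd a b)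
  | @Algebra.opp _ ?a => let a := zmod_reify a l in constr:(ZOpp a)
  | @Algebra.zero _ => constr:(Z0)
  | _ => let n := zmod_index t l in constr:(ZVar n)
  end.

Ltac zmod :=
  lazymatch goal with
  | |- @eq ?T ?a ?b =>
    let l := zmod_env a (@nil T) in
    let l := zmod_env b l in
    let ea := zmod_reify a l in
    let eb := zmod_reify b l in
    exact (@zval_eq _ l ea eb isT)
  end.

(** * Vector spaces *)

Section Span.
Context (k : fieldType) (V : lmodType k).
Implicit Types R S : V -> Prop.

Lemma in_spanD R x y : in_span R x -> in_span R y -> in_span R (x + y).
Proof. by move=> Rx Ry; rewrite -[x]scale1r; apply: in_spanP. Qed.

Lemma in_spanZ R a x : in_span R x -> in_span R (a *: x).
Proof. by move=> Rx; rewrite -[_ *: _]addr0; apply: in_spanP => //; apply: in_span0. Qed.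

Lemma in_spanB R x y : in_span R x -> in_span R y -> in_span R (x - y).
Proof. by move=> Rx Ry; apply: in_spanD => //; rewrite -scaleN1r; apply: in_spanZ. Qed.

Lemma in_span_sum R (J : Type) (s : seq J) (P : pred J) (F : J -> V) :
  (forall j, P j -> in_span R (F j)) -> in_span R (\sum_(j <- s | P j) F j).
Proof.
move=> RF; elim/big_rec: _ => [|j x Pj Rx]; first exact: in_span0.
by apply: in_spanD => //; apply: RF.
Qed.

Lemma in_span_map (W : lmodType k) (f : {linear V -> W}) R (S : W -> Prop) :
  (forall x, R x -> in_span S (f x)) -> forall x, in_span R x -> in_span S (f x).
Proof.
move=> RS x; elim=> {x} [x /RS //||a x y _ Sx _ Sy].
  by rewrite linear0; apply: in_span0.
by rewrite linearP; apply: in_spanP.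
Qed.

Lemma in_span_sub R S : (forall x, R x -> in_span S x) ->
  forall x, in_span R x -> in_span S x.
Proof. by move=> RS x; apply: (in_span_map (f := idfun)). Qed.

Lemma in_span_none R : (forall x, ~ R x) -> forall x, in_span R x -> x = 0.
Proof.
move=> nR x; elim=> {x} [x /nR //|//|a x y _ -> _ ->].
by rewrite scaler0 addr0.
Qed.

Lemma in_span_add1 R x y :
  in_span (fun z => R z \/ z = x) y -> exists a, in_span R (y - a *: x).
Proof.
elim=> {y} [y [Ry|->]||b y z _ [c Hy] _ [d Hz]].
- by exists 0; rewrite scale0r subr0; apply: in_span_gen.
- by exists 1; rewrite scale1r subrr; apply: in_span0.
- by exists 0; rewrite scale0r subr0; apply: in_span0.
exists (b * c + d); rewrite scalerDl opprD addrACA -scalerA -scalerBr.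
exact: in_spanP.
Qed.

(** A vector of the span uses finitely many members of the union, and in a chain one set contains
    them all. The set [A0] serves the zero vector, which uses none. *)
Lemma in_span_chain (F : (V -> Prop) -> Prop) (A0 : V -> Prop) (v x : V) :
  classical_sets.total_on F classical_sets.subset -> F A0 ->
  in_span (fun z => (exists2 A, F A & A z) /\ z <> v) x ->
  exists2 A, F A & in_span (fun z => A z /\ z <> v) x.
Proof.
move=> totF FA0; elim=> {x} [x [[A FA Ax] xv]||a x y _ [A FA Ax] _ [B FB By]].
- by exists A => //; apply: in_span_gen.
- by exists A0 => //; apply: in_span0.
have mono (C D : V -> Prop) z : classical_sets.subset C D ->
    in_span (fun z => C z /\ z <> v) z -> in_span (fun z => D z /\ z <> v) z.
  by move=> CD; apply: in_span_sub => t [/CD Dt tv]; apply: in_span_gen.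
case: (totF _ _ FA FB) => [AB|BA].
  by exists B => //; apply: in_spanP => //; apply: mono Ax.
by exists A => //; apply: in_spanP => //; apply: mono By.
Qed.

Definition indep (B : V -> Prop) := forall v, B v -> ~ in_span (fun z => B z /\ z <> v) v.

Lemma maximal_indep : exists B : V -> Prop, indep B /\ forall x, in_span B x.
Proof.
have [|B [iB maxB]] := @classical_sets.Zorn_bigcup V indep.
  move=> F Fi totF v [A FA Av] Hv.
  have [|C FC Cv] := @in_span_chain F A v v totF FA.
    by apply: in_span_sub Hv => z [[C FC Cz] zv]; apply: in_span_gen; split=> //; exists C.
  case: (totF _ _ FA FC) => [AC|CA]; first exact: (Fi _ FC v (AC _ Av)).
  by apply: (Fi _ FA v Av); apply: in_span_sub Cv => z [/CA Az zv]; apply: in_span_gen.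
exists B; split=> // x; apply: contrapT => nBx.
apply: (maxB (fun z => B z \/ z = x)).
  split; first by move=> z; left.
  by move=> /(_ x (or_intror erefl)) Bx; apply: nBx; apply: in_span_gen.
move=> v Bxv Hv.
case: Bxv => [Bv|vx].
  have : in_span (fun z => (B z /\ z <> v) \/ z = x) v.
    by apply: in_span_sub Hv => z [[Bz|zx] zv]; apply: in_span_gen; [left|right].
  move=> /in_span_add1[a Ha].
  (* [a] is the coefficient of [x] in an expression of [v] through [x] and the other members of [B].
     If it vanishes, [B] itself is dependent; otherwise the relation can be solved for [x]. *)
  have [a0|a0] := eqVneq a 0; first by move: Ha; rewrite a0 scale0r subr0; apply: iB.
  apply: nBx; have -> : x = a^-1 *: (v - (v - a *: x)).
    by rewrite subKr scalerA mulVf // scale1r.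
  apply: in_spanZ; apply: in_spanB; first exact: in_span_gen.
  by apply: in_span_sub Ha => z [Bz _]; apply: in_span_gen.
apply: nBx; rewrite -vx; apply: in_span_sub Hv => z [[Bz|->] //]; last by rewrite vx.
by move=> _; apply: in_span_gen.
Qed.
End Span.

Lemma dsum_lift (k : fieldType) (V : lmodType k) (I : Type) (v : I -> V) :
  exists f : {linear dsum (fun _ : I => k^o) -> V},
    forall i c, f (dsum_in (fun=> k^o) i c) = c *: v i.
Proof.
have lin1 (w : V) : linear (fun c : k^o => c *: w).
  by move=> a x y; rewrite scalerDl scalerA.
exists (dsum_elim (fun i : I => mklin (lin1 (v i)))) => i c.
by rewrite dsum_elim_in.
Qed.

Lemma basis_iso (k : fieldType) (V : lmodType k) :
  exists (I : Type) (f : {linear dsum (fun _ : I => k^o) -> V})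
         (g : {linear V -> dsum (fun _ : I => k^o)}), cancel f g /\ cancel g f.
Proof.
have [B [iB spB]] := maximal_indep V.
pose I := {v : V | B v}.
have [f fin] := dsum_lift (fun i : I => sval i).
have sinj (i j : I) : sval i = sval j -> i = j.
  by case: i j => [u Bu] [w Bw] /= e; apply: eq_exist.
have f_inj0 x : f x = 0 -> x = 0.
  move=> fx0; apply: dsumP => i; apply: contrapT => xi0.
  apply: (iB (sval i) (svalP i)).
  have iS : (i : {classic I}) \in dsum_support x by apply: dsum_supportP.
  have := fx0; rewrite [x in f x]dsum_decomp linear_sum.
  rewrite (bigD1_seq (i : {classic I})) ?undup_uniq //= fin => /eqP.
  rewrite addr_eq0 => /eqP E.
  have Ei : sval i = (x i : k)^-1 *: (x i *: sval i).
    by rewrite scalerA mulVf ?scale1r //; apply/eqP.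
  rewrite [X in in_span _ X]Ei E; apply: in_spanZ; rewrite -scaleN1r; apply: in_spanZ.
  apply: in_span_sum => j /eqP ji; rewrite fin; apply: in_spanZ.
  apply: in_span_gen; split; first exact: svalP.
  by move=> /sinj.
have f_surj y : exists x, f x = y.
  elim: (spB y) => {y} [y By||a y z _ [y' <-] _ [z' <-]].
  - by exists (dsum_in (fun=> k^o) (exist _ y By : I) 1); rewrite fin scale1r.
  - by exists 0; rewrite linear0.
  by exists (a *: y' + z'); rewrite linearP.
pose g y := sval (cid (f_surj y)).
have gK y : f (g y) = y by rewrite /g; case: cid.
have fK x : g (f x) = x.
  by apply/eqP; rewrite -subr_eq0; apply/eqP/f_inj0; rewrite linearB gK subrr.
have glin : linear g by move=> a x y; rewrite -{1}[x]gK -{1}[y]gK -linearP fK.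
by exists I, f, (mklin glin).
Qed.

Section LinearAlgebra.
Context (k : fieldType).

Lemma lquot_section (V : lmodType k) (R : V -> Prop) :
  exists s : {linear lquot R -> V}, forall q, lpi R (s q) = q.
Proof.
have [I [f [g [fK gK]]]] := basis_iso (lquot R).
have [s0 s0in] := dsum_lift (fun i : I => lrepr (f (dsum_in (fun=> k^o) i 1))).
have s0K x : lpi R (s0 x) = f x.
  have := @dsum_ext k I (fun=> k^o) _ (lpi R \o s0) f; apply=> i c.
  pose e : dsum (fun _ : I => k^o) := dsum_in (fun=> k^o) i 1.
  have -> : dsum_in (fun=> k^o) i c = (c : k) *: e.
    by rewrite -linearZ_LR /GRing.scale /= mulr1.
  by rewrite !linearZ; congr (_ *: _); rewrite -[LHS]/(lpi R (s0 _)) s0in scale1r lpi_repr.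
by exists (s0 \o g) => q /=; rewrite s0K gK.
Qed.

(** A generalised inverse from complements of the image and the kernel: [p] projects onto the image,
    and [t] lifts classes modulo the kernel. It replaces the choice of cocycles and complements in
    each degree of a complex. *)
Lemma pseudo_inverse (V W : lmodType k) (d : {linear V -> W}) :
  exists h : {linear W -> V}, forall x, d (h (d x)) = d x.
Proof.
pose Rk (x : V) := d x = 0.
pose Ri (y : W) := exists x, y = d x.
have span_im y : in_span Ri y -> Ri y.
  elim=> {y} [//||a y z _ [x ->] _ [x' ->]]; first by exists 0; rewrite linear0.
  by exists (a *: x + x'); rewrite linearP.
have [s sK] := lquot_section Ri.
have [t tK] := lquot_section Rk.
pose p y := y - s (lpi Ri y).
have pim y : Ri (p y).
  by apply: span_im; apply/lpi_eq; rewrite sK.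
have pid x : p (d x) = d x.
  rewrite /p; suff -> : lpi Ri (d x) = 0 by rewrite linear0 subr0.
  rewrite -(linear0 (lpi Ri)); apply/lpi_eq; rewrite subr0; apply: in_span_gen.
  by exists x.
have ex y : exists q, d (t q) = p y.
  have [x px] := pim y; exists (lpi Rk x); rewrite px.
  apply/eqP; rewrite -subr_eq0 -linearB; apply/eqP.
  have : in_span Rk (t (lpi Rk x) - x) by apply/lpi_eq; rewrite tK.
  elim=> [//||a u v _ du _ dv]; first by rewrite linear0.
  by rewrite linearP du dv scaler0 addr0.
pose q y := sval (cid (ex y)).
have qE y : d (t (q y)) = p y by rewrite /q; case: cid.
have inj q1 q2 : d (t q1) = d (t q2) -> q1 = q2.
  move=> e; rewrite -[q1]tK -[q2]tK; apply/lpi_eq; apply: in_span_gen.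
  by rewrite /Rk linearB e subrr.
have plin : linear p.
  by move=> a x y; rewrite /p linearP linearP scalerBr opprD addrACA.
have hlin : linear (fun y => t (q y)).
  move=> a x y; rewrite -linearP; congr (t _); apply: inj.
  by rewrite qE !linearP /= !qE plin.
by exists (mklin hlin) => x; rewrite mklinE qE.
Qed.

Lemma functional (V : lmodType k) (R : V -> Prop) x : ~ in_span R x ->
  exists f : {linear V -> k^o}, f x = 1 /\ forall y, R y -> f y = 0.
Proof.
move=> nRx; have [I [f [g [fK gK]]]] := basis_iso (lquot R).
have [i gi] : exists i, g (lpi R x) i <> 0.
  apply: contrapT => H; apply: nRx; rewrite -[x]subr0; apply/lpi_eq.
  rewrite linear0 -[LHS]gK (_ : g _ = 0) ?linear0 //.
  by apply: dsumP => i; apply: contrapT => gi; apply: H; exists i.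
have lin : linear (fun y => (g (lpi R x) i : k)^-1 *: g (lpi R y) i : k^o).
  move=> a y z; rewrite lpi_linear linearP -[X in _ *: X]/(a *: g (lpi R y) i + g (lpi R z) i).
  by rewrite scalerDr !scalerA [_ * a]mulrC.
exists (mklin lin); split=> [|y Ry]; rewrite mklinE.
  by apply: mulVf; apply/eqP.
suff -> : lpi R y = 0 by rewrite linear0 dsum0E scaler0.
by rewrite -(linear0 (lpi R)); apply/lpi_eq; rewrite subr0; apply: in_span_gen.
Qed.

(** Take a finite family from [S] of maximal rank: appending a further vector of [S] cannot raise
    the rank, so this vector lies in the row space. *)
Lemma finite_span_rV r (S : 'rV[k]_r -> Prop) :
  exists m (F : 'I_m -> 'rV[k]_r), (forall i, S (F i)) /\
    forall v, S v -> exists c : 'I_m -> k, v = \sum_i c i *: F i.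
Proof.
pose P n := `[< exists m (F : 'I_m -> 'rV[k]_r),
  (forall i, S (F i)) /\ \rank (\matrix_i F i) = n >].
have P0 : exists n, P n.
  exists 0%N; apply/asboolP; exists 0%N, (fun=> 0); split; first by case.
  by apply/eqP; rewrite -leqn0 (leq_trans (rank_leq_row _)).
have Pr n : P n -> (n <= r)%N.
  by move=> /asboolP[m [F [_ <-]]]; apply: rank_leq_col.
case: (ex_maxnP P0 Pr) => n /asboolP[m [F [SF rF]]] maxn.
exists m, F; split=> // v Sv.
have /submxP[D vD] : (v <= \matrix_i F i)%MS; last first.
  exists (fun i => D 0 i); rewrite vD; apply/rowP => j; rewrite mxE summxE.
  by apply: eq_bigr => i _; rewrite !mxE.
pose F' (i : 'I_(m + 1)) := if split i is inl j then F j else v.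
have E : \matrix_i F' i = col_mx (\matrix_i F i) v.
  apply/matrixP => i j; rewrite !mxE /F'; case: splitP => l _; rewrite ?mxE //.
  by rewrite [l]ord1.
have /maxn : P (\rank (col_mx (\matrix_i F i) v)).
  apply/asboolP; exists (m + 1)%N, F'; rewrite E; split=> // i.
  by rewrite /F'; case: split.
rewrite -addsmxE -rF => rle.
have [_] := mxrank_leqif_sup (addsmxSl (\matrix_i F i) v).
rewrite eqn_leq rle mxrankS ?addsmxSl //= => /esym H.
by apply: submx_trans H; apply: addsmxSr.
Qed.
End LinearAlgebra.

(** * Complexes and their cohomology *)

Section Epimorphisms.
Implicit Types G H K : finGroupType.

Lemma epi_ext H G (f g : epi H G) : (forall x, f x = g x) -> f = g.
Proof.
case: f g => [f fM fS] [g gM gS] /= fg.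
have e : f = g by apply: functional_extensionality_dep.
by subst g; congr Epi; apply: Prop_irrelevance.
Qed.

Lemma epi_comp_idl H G (f : epi H G) : epi_comp (epi_id G) f = f.
Proof. exact: epi_ext. Qed.

Lemma epi_comp_idr H G (f : epi H G) : epi_comp f (epi_id H) = f.
Proof. exact: epi_ext. Qed.

Lemma epi_compA G H K L (f : epi H G) (g : epi K H) (h : epi L K) :
  epi_comp f (epi_comp g h) = epi_comp (epi_comp f g) h.
Proof. exact: epi_ext. Qed.

HB.instance Definition _ H G := gen_eqMixin (epi H G).
HB.instance Definition _ H G := gen_choiceMixin (epi H G).

(** Embedding surjections into finite functions makes [epi H G] a finite type, over which sums and
    averages can be taken. *)
Definition epi_code H G (f : epi H G) : {ffun H -> G} := [ffun x => f x].

Definition epi_decode H G (u : {ffun H -> G}) : option (epi H G) :=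
  if pselect (exists f : epi H G, epi_code f = u) is left e then Some (sval (cid e))
  else None.

Lemma epi_codeK H G : pcancel (@epi_code H G) (@epi_decode H G).
Proof.
move=> f; rewrite /epi_decode; case: pselect => [e|]; last by case; exists f.
congr Some; apply: epi_ext => x; move: (svalP (cid e)) => /ffunP/(_ x).
by rewrite !ffunE.
Qed.

HB.instance Definition _ H G := PCanIsCountable (@epi_codeK H G).
HB.instance Definition _ H G : isFinite (epi H G) := PCanIsFinite (@epi_codeK H G).

Lemma epi_leq H G (f : epi H G) : (#|G| <= #|H|)%N.
Proof.
have [g gK] : exists g : G -> H, forall y, f (g y) = y.
  by exists (fun y => sval (cid (epi_surj f y))) => y; case: cid.
exact: leq_card (can_inj gK).
Qed.

Lemma epi_bij H G (f : epi H G) : #|H| = #|G| -> bijective f.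
Proof.
move=> HG; apply: inj_card_bij; last by rewrite HG.
have /image_injP : #|image f H| == #|H|.
  rewrite HG; apply/eqP/eq_card => y; rewrite inE.
  by have [x <-] := epi_surj f y; apply: image_f.
by move=> inj x y; apply: inj.
Qed.

Lemma epi_inverse H G (f : epi H G) : #|H| = #|G| ->
  exists g : epi G H, epi_comp f g = epi_id G /\ epi_comp g f = epi_id H.
Proof.
move=> /(epi_bij f)[g fK gK].
have gM : {morph g : x y / (x * y)%g}.
  by move=> x y; rewrite -{1}[x]gK -{1}[y]gK -epiM fK.
have gS y : exists x, g x = y by exists (f y).
by exists (Epi gM gS); split; apply: epi_ext => x /=.
Qed.

Lemma isog_epi G H : [set: G] \isog [set: H] <-> (exists f : epi H G, #|H| = #|G|).
Proof.
split=> [GH|[f HG]].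
  have HG : #|H| = #|G| by rewrite -!cardsT (card_isog GH).
  move: GH; rewrite isog_sym => /isogP[f injf fim].
  have fM : {morph f : x y / (x * y)%g} by move=> x y; rewrite morphM ?inE.
  have fS y : exists x, f x = y.
    have : y \in (f @* [set: H])%g by rewrite fim inE.
    by rewrite morphimEdom => /imsetP[x _ ->]; exists x.
  by exists (Epi fM fS).
have /bij_inj injf := epi_bij f HG.
have fM : {in [set: H] &, {morph f : x y / (x * y)%g}} by move=> x y _ _; apply: epiM.
rewrite isog_sym; apply/isogP; exists (Morphism fM).
  by apply/injmP => x y _ _; apply: injf.
apply/setP => y; rewrite inE morphimEdom; apply/imsetP.
by have [x <-] := epi_surj f y; exists x; rewrite ?inE.
Qed.

Lemma epiJ H G (f : epi H G) x y : f (x ^ y)%g = (f x ^ f y)%g.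
Proof.
rewrite /conjg !epiM; congr (_ * _)%g; apply: (mulgI (f y)).
by rewrite mulgV -epiM mulgV epi1.
Qed.

End Epimorphisms.

Lemma gobj_isoP (U : finGroupType -> Prop) (G H : gobj U) :
  gobj_iso G H <-> (exists f : epi H G, #|H| = #|G|).
Proof. exact: isog_epi. Qed.

Lemma gobj_iso_refl (U : finGroupType -> Prop) (G : gobj U) : gobj_iso G G.
Proof. exact: isog_refl. Qed.

Lemma gobj_iso_sym (U : finGroupType -> Prop) (G H : gobj U) :
  gobj_iso G H -> gobj_iso H G.
Proof. by rewrite /gobj_iso isog_sym. Qed.

Lemma gobj_iso_trans (U : finGroupType -> Prop) (G H K : gobj U) :
  gobj_iso G H -> gobj_iso H K -> gobj_iso G K.
Proof. exact: isog_trans. Qed.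

Lemma int_succ (P : int -> Prop) : (forall n, P (n + 1)) -> forall n, P n.
Proof. by move=> HP n; rewrite -[n](subrK 1); apply: HP. Qed.

Section Complexes.
Context (k : fieldType) (U : finGroupType -> Prop).
Implicit Types (M : psh k U) (X Y Z : cplx k U) (G H K : gobj U).

Lemma psh_res_comp' M G H K (a : epi H G) (b : epi K H) x :
  psh_res M b (psh_res M a x) = psh_res M (epi_comp a b) x.
Proof. by rewrite psh_res_comp. Qed.

Lemma res_inv M G H (a : epi H G) (b : epi G H) x :
  epi_comp a b = epi_id G -> psh_res M b (psh_res M a x) = x.
Proof. by move=> e; rewrite psh_res_comp' e psh_res_id. Qed.

(** The degree is an index of the inductive type, so that being a boundary makes sense in every
    degree [n] without a cast along [n = m + 1]. *)
Inductive bdry X G : forall n : int, X n G -> Prop :=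
  | Bdry n w : bdry (cplx_d X n G w).

Lemma bdryP X G n (z : X (n + 1) G) : bdry z <-> exists w, z = cplx_d X n G w.
Proof.
split=> [|[w ->]]; last exact: Bdry.
suff H m (y : X m G) : bdry y -> forall n (e : m = n + 1),
    exists w, eq_rect m (fun m => X m G) y (n + 1) e = cplx_d X n G w.
  by move=> bz; have [w /= ->] := H _ z bz n erefl; exists w.
case=> {m y} m w n' e; have e' := addIr _ e; subst n'.
by rewrite (eq_axiomK e); exists w.
Qed.

Lemma bdry0 X G n : bdry (0 : X n G).
Proof.
by elim/int_succ: n => n; apply/bdryP; exists 0; rewrite linear0.
Qed.

Lemma bdryPl X G n a (x y : X n G) : bdry x -> bdry y -> bdry (a *: x + y).
Proof.
elim/int_succ: n x y => n x y /bdryP[x' ->] /bdryP[y' ->].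
by apply/bdryP; exists (a *: x' + y'); rewrite linearP.
Qed.

Lemma bdry_span X G n (z : X n G) : in_span (@bdry X G n) z <-> bdry z.
Proof.
split=> [|bz]; last exact: in_span_gen.
by elim=> {z} [//||a x y _ bx _ by_]; [apply: bdry0|apply: bdryPl].
Qed.

Lemma bdryD X G n (x y : X n G) : bdry x -> bdry y -> bdry (x + y).
Proof. by move=> bx ?; rewrite -[x]scale1r; apply: bdryPl. Qed.

Lemma bdryN X G n (x : X n G) : bdry x -> bdry (- x).
Proof.
by move=> bx; rewrite -scaleN1r -[_ *: _]addr0; apply: bdryPl => //; apply: bdry0.
Qed.

Lemma bdryB X G n (x y : X n G) : bdry x -> bdry y -> bdry (x - y).
Proof. by move=> bx /bdryN; apply: bdryD. Qed.

Lemma bdry_cmap X Y (f : cmap X Y) G n (x : X n G) : bdry x -> bdry (f n G x).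
Proof. by case=> {n x} n w; rewrite cmap_appE; apply: Bdry. Qed.

Lemma bdry_res X G H (a : epi H G) n (x : X n G) :
  bdry x -> bdry (psh_res (X n) a x).
Proof. by case=> {n x} n w; rewrite -nat_appE; apply: Bdry. Qed.

Lemma acyclicP X G :
  acyclic_at X G <-> forall n (x : X n G), cplx_d X n G x = 0 -> bdry x.
Proof.
split=> [aX|aX n x dx]; last by apply/bdryP; apply: aX.
by elim/int_succ => n x dx; apply/bdryP; apply: aX.
Qed.

Lemma acyclic_iso X G H : gobj_iso G H -> acyclic_at X G -> acyclic_at X H.
Proof.
move=> /gobj_isoP[f HG] /acyclicP aX; apply/acyclicP => n x dx.
have [g [fg gf]] := epi_inverse f HG.
rewrite -(res_inv x gf); apply/bdry_res/aX.
by rewrite nat_appE dx linear0.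
Qed.

Lemma qisP X Y (f : cmap X Y) : qis f <-> forall G n,
  (forall x : X n G, cplx_d X n G x = 0 -> bdry (f n G x) -> bdry x) /\
  (forall y : Y n G, cplx_d Y n G y = 0 ->
     exists2 x : X n G, cplx_d X n G x = 0 & bdry (y - f n G x)).
Proof.
split=> [qf G|qf G n].
  elim/int_succ => n; have [fi fs] := qf G n; split=> [x dx /bdryP fx|y dy].
    by apply/bdryP; apply: fi.
  have [x [y' [dx ->]]] := fs y dy; exists x => //.
  by rewrite addrAC subrr add0r; apply: Bdry.
have [fi fs] := qf G (n + 1); split=> [x dx [y fx]|y dy].
  by apply/bdryP; apply: fi => //; rewrite fx; apply: Bdry.
have [x dx /bdryP[y' e]] := fs y dy; exists x, y'; split=> //.
by rewrite -e [RHS]addrC subrK.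
Qed.

(** The right-hand side says that [f] is bijective on cohomology at [G]. Unlike [qis] it concerns a
    single group, which the inductions over groups require. *)
Lemma cone_acyclic X Y (f : cmap X Y) G : acyclic_at (cone f) G <->
  forall n,
  (forall x : X n G, cplx_d X n G x = 0 -> bdry (f n G x) -> bdry x) /\
  (forall y : Y n G, cplx_d Y n G y = 0 ->
     exists2 x : X n G, cplx_d X n G x = 0 & bdry (y - f n G x)).
Proof.
split=> [/acyclicP aC|H].
  elim/int_succ => n; split=> [x dx /bdryP[y fx]|y dy].
    have : bdry ((x, - y) : cone f n G).
      by apply: aC; apply: pairP => /=; rewrite ?dx ?oppr0 // linearN fx subrr.
    move: dx fx; elim/int_succ: n x y => n x y dx fx /bdryP[[x' y'] /= [-> _]].
    by apply/bdryN/Bdry.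
  have /aC /bdryP[[x y'] /= [/esym/oppr_eq0P dx ->]] :
    cplx_d (cone f) (n + 1) G ((0, y) : cone f (n + 1) G) = 0.
    by apply: pairP => /=; rewrite ?linear0 ?oppr0 // dy addr0.
  by exists x => //; rewrite addrAC subrr add0r; apply: Bdry.
apply/acyclicP; elim/int_succ=> n [x y] /= [/oppr_eq0P dx] fx.
have [/(_ x dx) fi _] := H (n + 1 + 1).
have /bdryP[x' ex] : bdry x.
  apply: fi; move/eqP: fx; rewrite addr_eq0 => /eqP ->.
  by apply/bdryN/Bdry.
have [_ /(_ (y + f (n + 1) G x'))[|x1 dx1 /bdryP[y1 e]]] := H (n + 1).
  by rewrite linearD -cmap_appE -ex [LHS]addrC.
apply/bdryP; exists (x1 - x', y1); apply: pairP => /=.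
  by rewrite linearB dx1 sub0r opprK.
by rewrite -e linearB [RHS]addrC -[RHS]addrA addKr addrK.
Qed.

Lemma qis_cone X Y (f : cmap X Y) : qis f <-> forall G, acyclic_at (cone f) G.
Proof.
split=> [/qisP qf G|aC]; first by apply/cone_acyclic.
by apply/qisP => G; apply/cone_acyclic.
Qed.
End Complexes.

(** * Homotopies and the derived category *)

Section Morphisms.
Context (k : fieldType) (U : finGroupType -> Prop).
Implicit Types (M N : psh k U) (X Y Z : cplx k U) (G H K : gobj U).

Lemma snd_linear (V W : lmodType k) : linear (fun x : V * W => x.2).
Proof. by []. Qed.
Lemma pairing_linear (V W T : lmodType k) (f : {linear V -> W}) (g : {linear V -> T}) :
  linear (fun x : V => (f x, g x) : W * T).
Proof. by move=> a x y; rewrite !linearP. Qed.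

Program Definition nt_add M N (f g : nat_trans M N) : nat_trans M N :=
  @NatTrans k U M N (fun G => f G \+ g G) _.
Next Obligation. by move=> M N f g G H a x /=; rewrite !nat_appE linearD. Qed.

Program Definition nt_fst M N : nat_trans (psh_sum M N) M :=
  @NatTrans k U (psh_sum M N) M (fun G => mklin (@fst_linear k (M G) (N G))) _.
Next Obligation. by []. Qed.

Program Definition nt_snd M N : nat_trans (psh_sum M N) N :=
  @NatTrans k U (psh_sum M N) N (fun G => mklin (@snd_linear (M G) (N G))) _.
Next Obligation. by []. Qed.

Program Definition nt_pairing (L M N : psh k U) (f : nat_trans L M) (g : nat_trans L N) :
  nat_trans L (psh_sum M N) :=
  @NatTrans k U L (psh_sum M N) (fun G => mklin (pairing_linear (f G) (g G))) _.
Next Obligation. by move=> L M N f g G H a x /=; rewrite !nat_appE. Qed.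

Program Definition cmap_fst X Y : cmap (csum X Y) X :=
  @CMap k U (csum X Y) X (fun n => nt_fst (X n) (Y n)) _.
Next Obligation. by []. Qed.

Program Definition cmap_snd X Y : cmap (csum X Y) Y :=
  @CMap k U (csum X Y) Y (fun n => nt_snd (X n) (Y n)) _.
Next Obligation. by []. Qed.

Program Definition cmap_pairing X Y Z (f : cmap Z X) (g : cmap Z Y) : cmap Z (csum X Y) :=
  @CMap k U Z (csum X Y) (fun n => nt_pairing (f n) (g n)) _.
Next Obligation. by move=> X Y Z f g n G x /=; rewrite !cmap_appE. Qed.

Program Definition cmap_add X Y (f g : cmap X Y) : cmap X Y :=
  @CMap k U X Y (fun n => nt_add (f n) (g n)) _.
Next Obligation. by move=> X Y f g n G x /=; rewrite !cmap_appE linearD. Qed.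

Program Definition cmap_opp X Y (f : cmap X Y) : cmap X Y :=
  @CMap k U X Y (fun n => nt_opp (f n)) _.
Next Obligation. by move=> X Y f n G x /=; rewrite cmap_appE linearN. Qed.

Definition htpy X Y := forall n : int, nat_trans (X (n + 1)) (Y n).

(** The operator $dh + hd$ in degree [n + 1]. Every degree has this form, and so no subtraction
    occurs in the types. *)
Definition hbd X Y (h : htpy X Y) n G (x : X (n + 1) G) : Y (n + 1) G :=
  cplx_d Y n G (h n G x) + h (n + 1) G (cplx_d X (n + 1) G x).

Definition homotopic X Y (f g : cmap X Y) :=
  exists h : htpy X Y, forall (n : int) G x, f (n + 1) G x - g (n + 1) G x = hbd h x.

(** The cylinder of [X] as the cone of $x \mapsto (x, -x)$: the shifted copy of [X] is the universal
    homotopy between the two others. *)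
Definition cyl X : cplx k U := cone (cmap_pairing (cmap_id X) (cmap_opp (cmap_id X))).

Program Definition cyl_in1 X : cmap X (cyl X) :=
  @CMap k U X (cyl X) (fun n => nt_pairing (nt_zero _ _) (nt_pairing (nt_id _) (nt_zero _ _))) _.
Next Obligation.
by move=> X n G x; apply: pairP => /=; rewrite ?linear0 ?oppr0 // ?add0r //; apply: pairP => /=; rewrite ?linear0 ?add0r ?oppr0.
Qed.

Program Definition cyl_in2 X : cmap X (cyl X) :=
  @CMap k U X (cyl X) (fun n => nt_pairing (nt_zero _ _) (nt_pairing (nt_zero _ _) (nt_id _))) _.
Next Obligation.
by move=> X n G x; apply: pairP => /=; rewrite ?linear0 ?oppr0 // ?add0r //; apply: pairP => /=; rewrite ?linear0 ?add0r ?oppr0.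
Qed.

Section CylMap.
Context (X Y : cplx k U) (f g : cmap X Y) (h : htpy X Y).
Hypothesis fg : forall (n : int) G x, f (n + 1) G x - g (n + 1) G x = hbd h x.

Program Definition cyl_map : cmap (cyl X) Y :=
  @CMap k U (cyl X) Y (fun n =>
    nt_add (nt_comp (h n) (nt_fst _ _))
      (nt_add (nt_comp (f n) (nt_comp (nt_fst _ _) (nt_snd _ _)))
              (nt_comp (g n) (nt_comp (nt_snd _ _) (nt_snd _ _))))) _.
Next Obligation.
move=> n G [z [x y]] /=; rewrite !(linearN, linearD) /= -!cmap_appE.
by apply: (eq_by_sub (fg z)); rewrite /hbd; zmod.
Qed.
End CylMap.

Lemma hbd_zero X Y (n : int) G x :
  hbd (fun n => nt_zero (X (n + 1)) (Y n)) x = 0 :> Y (n + 1) G.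
Proof. by rewrite /hbd /= linear0 addr0. Qed.

Lemma hbd0 X (n : int) G x :
  cmap_id X (n + 1) G x - cmap_id X (n + 1) G x = hbd (fun n => nt_zero (X (n + 1)) (X n)) x.
Proof. by rewrite subrr hbd_zero. Qed.

Definition cyl_proj X : cmap (cyl X) X :=
  @cyl_map X X (cmap_id X) (cmap_id X) (fun n => nt_zero _ _) (@hbd0 X).

Lemma cyl_proj_qis X : qis (cyl_proj X).
Proof.
move=> G n; split=> [[z [x y]] /= [/oppr_eq0P dz ex ey] [w]|y /= dy].
  rewrite add0r => e; exists (x, (0, w)); apply: pairP => /=.
    by apply: (eq_by_sub ex); zmod.
  by apply: pairP => /=; rewrite ?linear0 -?e; zmod.
exists (0, (y, 0)), 0; split; last by rewrite /= !linear0; zmod.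
apply: pairP => /=; first by rewrite linear0 oppr0.
by apply: pairP => /=; rewrite ?linear0 ?dy; zmod.
Qed.

Lemma deq_mapcomp X Y Z (g : cmap Y Z) (f : cmap X Y) (h : cmap X Z) :
  cmap_eq (cmap_comp g f) h -> deq (Dcomp (Dmap g) (Dmap f)) (Dmap h).
Proof.
move=> e; apply: deq_trans (deq_sym (deq_map_comp g f)) _; exact: deq_map.
Qed.

Lemma deq_compl X Y Z (g g' : dhom Y Z) (f : dhom X Y) :
  deq g g' -> deq (Dcomp g f) (Dcomp g' f).
Proof. by move=> e; apply: deq_comp (deq_refl _). Qed.

Lemma deq_compr X Y Z (g : dhom Y Z) (f f' : dhom X Y) :
  deq f f' -> deq (Dcomp g f) (Dcomp g f').
Proof. by move=> e; apply: deq_comp (deq_refl _) _. Qed.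

(** Both ends of the cylinder are sections of the quasi-isomorphism [cyl_proj], hence both equal its
    formal inverse; [f] and [g] are their composites with the same map [cyl_map]. *)
Lemma deq_homotopic X Y (f g : cmap X Y) : homotopic f g -> deq (Dmap f) (Dmap g).
Proof.
move=> [h fg]; pose F := cyl_map fg; pose s := cyl_proj_qis X.
have E (i : cmap X (cyl X)) : cmap_eq (cmap_comp (cyl_proj X) i) (cmap_id X) ->
    deq (Dmap i) (Dinv s).
  move=> ei; apply: deq_trans (deq_sym (deq_idl _)) _.
  apply: deq_trans (deq_compl _ (deq_sym (deq_invl s))) _.
  apply: deq_trans (deq_sym (deq_assoc _ _ _)) _.
  apply: deq_trans (deq_compr _ (deq_mapcomp ei)) _.
  exact: deq_idr.
have E1 : deq (Dmap (cyl_in1 X)) (Dinv s).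
  by apply: E => n G x /=; rewrite add0r addr0.
have E2 : deq (Dmap (cyl_in2 X)) (Dinv s).
  by apply: E => n G x /=; rewrite !add0r.
have F1 : deq (Dcomp (Dmap F) (Dmap (cyl_in1 X))) (Dmap f).
  by apply: deq_mapcomp => n G x /=; rewrite !linear0 add0r addr0.
have F2 : deq (Dcomp (Dmap F) (Dmap (cyl_in2 X))) (Dmap g).
  by apply: deq_mapcomp => n G x /=; rewrite !linear0 !add0r.
apply: deq_trans (deq_sym F1) (deq_trans _ F2); apply: deq_compr.
exact: deq_trans E1 (deq_sym E2).
Qed.
End Morphisms.

Section IntRect.
Context (T : int -> Type) (F : forall n, T (n + 1)).

Definition int_rect_succ (m : int) : T m := eq_rect (m - 1 + 1) T (F (m - 1)) m (subrK 1 m).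

Lemma int_rectE n : int_rect_succ (n + 1) = F n.
Proof.
rewrite /int_rect_succ; move: (n + 1 - 1) (subrK 1 (n + 1)) => j e.
have e' := addIr _ e; subst j.
by rewrite (eq_axiomK e).
Qed.
End IntRect.

(** * Fractions out of K-projective complexes, and a criterion for compactness *)

Section Derived.
Context (k : fieldType) (U : finGroupType -> Prop).
Implicit Types (M N : psh k U) (X Y Z P : cplx k U) (G H K : gobj U).

Lemma cmap_of_succ X Y (g : forall n : int, nat_trans (X (n + 1)) (Y (n + 1))) :
  (forall (n : int) G x, g (n + 1) G (cplx_d X (n + 1) G x) = cplx_d Y (n + 1) G (g n G x)) ->
  exists f : cmap X Y, forall (n : int) G x, f (n + 1) G x = g n G x.
Proof.
move=> gd; pose f n := int_rect_succ (T := fun n => nat_trans (X n) (Y n)) g n.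
have fd n G x : f (n + 1) G (cplx_d X n G x) = cplx_d Y n G (f n G x).
  by elim/int_succ: n x => n x; rewrite /f !int_rectE gd.
by exists (CMap fd) => n G x /=; rewrite /f int_rectE.
Qed.

(** K-projectivity: every map to an acyclic complex is null-homotopic. *)
Definition kproj P := forall N : cplx k U, (forall G, acyclic_at N G) ->
  forall f : cmap P N, exists h : htpy P N, forall (n : int) G x, f (n + 1) G x = hbd h x.

(** The composite of [f] with the inclusion into the acyclic cone of [s] is null-homotopic. The
    first component of the null-homotopy is the lift, and the second is the homotopy between [f] and
    [s] after the lift. *)
Lemma kproj_lift P X Y (s : cmap X Y) (f : cmap P Y) :
  kproj P -> qis s -> exists g : cmap P X, homotopic f (cmap_comp s g).
Proof.
move=> Pproj /qis_cone aC; have [h fh] := Pproj _ aC (cmap_comp (cone_in s) f).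
have [n G x|g gE] := @cmap_of_succ P X (fun n => nt_comp (nt_fst _ _) (h n)).
  have := fh n G x; rewrite /hbd /= => /(congr1 fst) /= e.
  by apply: (eq_by_sub (esym e)); zmod.
exists g, (fun n => nt_comp (nt_snd _ _) (h n)) => n G x.
have := fh n G x; rewrite /hbd /= gE /= => /(congr1 snd) /= ->.
by zmod.
Qed.

#[local] Instance deq_equiv X Y : Equivalence (@deq k U X Y).
Proof.
split; [exact: deq_refl | exact: deq_sym | exact: deq_trans].
Qed.
#[local] Instance Dcomp_proper X Y Z :
  Proper (@deq k U Y Z ==> @deq k U X Y ==> @deq k U X Z) (@Dcomp k U X Y Z).
Proof. by move=> g g' eg f f' ef; apply: deq_comp. Qed.

#[local] Hint Resolve deq_refl : core.

Lemma deq_assoc' X Y Z T (h : dhom Z T) (g : dhom Y Z) (f : dhom X Y) :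
  deq (Dcomp (Dcomp h g) f) (Dcomp h (Dcomp g f)).
Proof. exact/deq_sym/deq_assoc. Qed.

(** By induction on the word [u]: each formal inverse is absorbed by lifting through the
    quasi-isomorphism. *)
Lemma kproj_comp P X Y (u : dhom X Y) (f : cmap P X) : kproj P ->
  exists g : cmap P Y, deq (Dcomp u (Dmap f)) (Dmap g).
Proof.
move=> Pproj; elim: u f => {X Y} [X Y g|X Y s qs|X Y Z g IHg f IHf] u.
- by exists (cmap_comp g u); apply: deq_mapcomp.
- have [g /deq_homotopic e] := kproj_lift u Pproj qs; exists g.
  rewrite e deq_map_comp deq_assoc deq_invl; exact: deq_idl.
have [f' ef] := IHf u; have [g' eg] := IHg f'; exists g'.
by rewrite deq_assoc' ef.
Qed.

Lemma kproj_frac P X Y (p : cmap P X) (qp : qis p) (u : dhom X Y) : kproj P ->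
  exists g : cmap P Y, deq u (Dcomp (Dmap g) (Dinv qp)).
Proof.
move=> Pproj; have [g eg] := kproj_comp u p Pproj; exists g.
by rewrite -eg deq_assoc' deq_invr deq_idr.
Qed.

Lemma Dsumr_deq A X Y (f g : dhom X Y) : deq f g -> deq (Dsumr A f) (Dsumr A g).
Proof.
elim=> {X Y f g} /=.
- by move=> X Y f; apply: deq_refl.
- by move=> X Y f g _ IH; apply: deq_sym.
- by move=> X Y f g h _ IH1 _ IH2; apply: deq_trans IH1 IH2.
- by move=> X Y Z g g' f f' _ Hg _ Hf; apply: deq_comp.
- by move=> *; apply: deq_assoc.
- move=> X Y f; apply: deq_trans (deq_idl _); apply: deq_compl.
  by apply: deq_map => n G [].
- move=> X Y f; apply: deq_trans (deq_idr _); apply: deq_compr.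
  by apply: deq_map => n G [].
- by move=> X Y f g fg; apply: deq_map => n G x /=; rewrite fg.
- by move=> X Y Z g f; rewrite -deq_map_comp; apply: deq_map.
- by move=> X Y s qs; rewrite deq_invl; apply: deq_map => n G [].
- by move=> X Y s qs; rewrite deq_invr; apply: deq_map => n G [].
Qed.

Lemma Dsuml_deq A X Y (f g : dhom X Y) : deq f g -> deq (Dsuml A f) (Dsuml A g).
Proof.
elim=> {X Y f g} /=.
- by move=> X Y f; apply: deq_refl.
- by move=> X Y f g _ IH; apply: deq_sym.
- by move=> X Y f g h _ IH1 _ IH2; apply: deq_trans IH1 IH2.
- by move=> X Y Z g g' f f' _ Hg _ Hf; apply: deq_comp.
- by move=> *; apply: deq_assoc.
- move=> X Y f; apply: deq_trans (deq_idl _); apply: deq_compl.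
  by apply: deq_map => n G [].
- move=> X Y f; apply: deq_trans (deq_idr _); apply: deq_compr.
  by apply: deq_map => n G [].
- by move=> X Y f g fg; apply: deq_map => n G x /=; rewrite fg.
- by move=> X Y Z g f; rewrite -deq_map_comp; apply: deq_map.
- by move=> X Y s qs; rewrite deq_invl; apply: deq_map => n G [].
- by move=> X Y s qs; rewrite deq_invr; apply: deq_map => n G [].
Qed.

#[local] Instance Dadd_proper X Y :
  Proper (@deq k U X Y ==> @deq k U X Y ==> @deq k U X Y) (@Dadd k U X Y).
Proof.
move=> f f' ef g g' eg; rewrite /Dadd.
by rewrite (Dsuml_deq Y eg) (Dsumr_deq X ef).
Qed.

Lemma Dcomb_deq (I : Type) X (Y : I -> cplx k U) (f g : forall i, dhom X (Y i)) s :
  (forall i, deq (f i) (g i)) -> deq (Dcomb f s) (Dcomb g s).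
Proof. by move=> fg; elim: s => [|i s IH]; rewrite /Dcomb //= -/(Dcomb _ _) fg IH. Qed.

Lemma deq_frac P X Y (p : cmap P X) (qp : qis p) (f : cmap P Y) (u : dhom X Y) :
  deq (Dcomp u (Dmap p)) (Dmap f) -> deq u (Dcomp (Dmap f) (Dinv qp)).
Proof. by move=> <-; rewrite deq_assoc' deq_invr deq_idr. Qed.

Lemma Dadd_frac P X Y (p : cmap P X) (qp : qis p) (a b : cmap P Y) :
  deq (Dadd (Dcomp (Dmap a) (Dinv qp)) (Dcomp (Dmap b) (Dinv qp)))
      (Dcomp (Dmap (cmap_add a b)) (Dinv qp)).
Proof.
apply: deq_frac; rewrite /Dadd /= !deq_assoc'.
set qr := csum_map_qis qp _; set ql := csum_map_qis _ qp.
pose id1 := csum_map (cmap_id P) p.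
rewrite -(deq_map_comp (cmap_diag X) p).
(* Naturality of the diagonal, with $p \oplus p$ factored so that $p \oplus 1$ meets its formal
   inverse; $1 \oplus p$ is then carried across $a \oplus 1$ to meet the other one. *)
rewrite (deq_map (_ : cmap_eq _ (cmap_comp (csum_map p (cmap_id X))
   (cmap_comp (csum_map (cmap_id P) p) (cmap_diag P))))) //.
rewrite deq_map_comp (deq_assoc (Dinv qr)) deq_invl deq_idl.
rewrite -(deq_map_comp (csum_map a _)).
rewrite (deq_map (_ : cmap_eq _ (cmap_comp (csum_map (cmap_id Y) p)
   (cmap_comp (csum_map a (cmap_id P)) (cmap_diag P))))) //.
rewrite deq_map_comp (deq_assoc (Dinv ql)) deq_invl deq_idl.
rewrite -!deq_map_comp; exact: deq_map.
Qed.

Lemma dapp_linear (I : Type) (A : I -> lmodType k) i : linear (fun x : dsum A => x i).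
Proof. by []. Qed.

Program Definition cdsum_pr (I : Type) (Y : I -> cplx k U) (i : I) : cmap (cdsum Y) (Y i) :=
  @CMap k U (cdsum Y) (Y i) (fun n => @NatTrans k U (psh_dsum (fun i => Y i n)) (Y i n)
    (fun G => mklin (@dapp_linear I (fun i => Y i n G) i)) _) _.
Next Obligation. by []. Qed.
Next Obligation. by []. Qed.

Definition nt_if (M N : psh k U) (b : bool) (f : nat_trans M N) : nat_trans M N :=
  if b then f else nt_zero M N.

Program Definition cdsum_restr (I : Type) (Y : I -> cplx k U) (s : seq {classic I}) :
    cmap (cdsum Y) (cdsum Y) :=
  @CMap k U (cdsum Y) (cdsum Y)
    (fun n => nt_dsum (fun i => nt_if ((i : {classic I}) \in s) (nt_id (Y i n)))) _.
Next Obligation.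
move=> I Y s n G x; apply: dsumP => i; rewrite /= /nt_if.
by case: ifP => _ //=; rewrite linear0.
Qed.

Lemma cdsum_restrE (I : Type) (Y : I -> cplx k U) (s : seq {classic I}) n G x i :
  cdsum_restr Y s n G x i = if (i : {classic I}) \in s then x i else 0.
Proof. by rewrite /= /nt_if; case: ifP. Qed.

(** Smallness at the level of complexes: up to homotopy, a map to a direct sum has values in
    finitely many summands, the same ones for all degrees, groups and elements. *)
Definition ffin P := forall (I : Type) (Y : I -> cplx k U) (f : cmap P (cdsum Y)),
  exists (h : htpy P (cdsum Y)) (s : seq {classic I}),
    forall (n : int) G x i, (i : {classic I}) \notin s ->
      (f (n + 1) G x - hbd h x) i = 0.

Fixpoint cmap_comb P (I : Type) (Y : I -> cplx k U) (a : forall i, cmap P (Y i))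
    (s : seq I) : cmap P (cdsum Y) :=
  if s is i :: s then cmap_add (cmap_comp (cdsum_in Y i) (a i)) (cmap_comb a s)
  else cmap_zero P (cdsum Y).

Lemma cmap_combE P (I : Type) (Y : I -> cplx k U) (a : forall i, cmap P (Y i))
    (s : seq {classic I}) n G x i : uniq s ->
  cmap_comb a s n G x i = if (i : {classic I}) \in s then a i n G x else 0.
Proof.
elim: s => [//|j s IH] /= /andP[js us].
rewrite -[LHS]/(dsum_in_fun (M := fun i => Y i n G) (a j n G x) i + cmap_comb a s n G x i).
rewrite IH // inE.
have [ij|/eqP ij] := eqVneq (i : {classic I}) j.
  by subst j; rewrite dsum_in_id (negPf js) addr0.
by rewrite dsum_in_neq ?add0r // => ji; apply: ij.
Qed.

Lemma Dcomb_frac P X (p : cmap P X) (qp : qis p) (I : Type) (Y : I -> cplx k U)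
    (a : forall i, cmap P (Y i)) (s : seq I) :
  deq (Dcomb (fun i => Dcomp (Dmap (a i)) (Dinv qp)) s)
      (Dcomp (Dmap (cmap_comb a s)) (Dinv qp)).
Proof.
elim: s => [|i s IH] /=.
  by apply: deq_frac; rewrite -deq_map_comp; apply: deq_map => n G x.
rewrite /Dcomb /= -/(Dcomb _ _) IH deq_assoc -deq_map_comp.
exact: Dadd_frac.
Qed.

(* Maps out of X in the derived category are fractions f p^-1, and finiteness of P
   moves f, up to homotopy, into a finite sum. *)
Lemma compact_res P X (p : cmap P X) : qis p -> kproj P -> ffin P -> compact X.
Proof.
move=> qp Pproj Pfin I Y; split=> [u|s f us].
  have [g ug] := kproj_frac qp u Pproj.
  have [h [s0 gs]] := Pfin I Y g; pose s := undup s0.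
  pose a i := cmap_comp (cdsum_pr Y i) g.
  exists s, (fun i => Dcomp (Dmap (a i)) (Dinv qp)); split; first exact: undup_uniq.
  rewrite ug Dcomb_frac; apply: deq_compl; apply: deq_homotopic.
  (* The homotopy [h] is kept only on the summands outside [s]: there it removes [g], while the
     summands in [s] are left as they are. *)
  exists (fun n => nt_add (h n) (nt_opp (nt_comp (cdsum_restr Y s n) (h n)))).
  move=> n G x; apply: dsumP => i.
  rewrite -[LHS]/(g (n + 1) G x i - cmap_comb a s (n + 1) G x i) cmap_combE ?undup_uniq //.
  rewrite /hbd !dsumDE.
  rewrite -[X in _ = X + _]/(cplx_d (Y i) n G (h n G x i - cdsum_restr Y s n G (h n G x) i)).
  rewrite -[X in _ = _ + X]/(h (n + 1) G (cplx_d P (n + 1) G x) i -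
    cdsum_restr Y s (n + 1) G (h (n + 1) G (cplx_d P (n + 1) G x)) i).
  rewrite !cdsum_restrE mem_undup; case: ifPn => [_|/(gs n G x i)].
    by rewrite !subrr linear0 addr0.
  by rewrite !subr0 => /eqP; rewrite subr_eq0 => /eqP.
move=> f0 i is_.
pose a j := sval (cid (kproj_frac qp (f j) Pproj)).
have fa j : deq (f j) (Dcomp (Dmap (a j)) (Dinv qp)) by rewrite /a; case: cid.
have : deq (Dcomp (Dmap (cdsum_pr Y i)) (Dcomb f s)) (Dzero X (Y i)).
  by rewrite f0; apply: deq_mapcomp => n G x.
rewrite (Dcomb_deq s fa) Dcomb_frac fa => <-.
rewrite deq_assoc -deq_map_comp; apply: deq_compl; apply: deq_map => n G x.
by rewrite -[RHS]/(cmap_comb a s n G x i) cmap_combE // is_.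
Qed.
End Derived.

(** * Free complexes *)

Section Induced.
Context (k : fieldType) (U : finGroupType -> Prop) (G : gobj U) (V : lmodType k).
Context (S : epi G G -> Prop) (rho : epi G G -> {linear V -> V}) (kill : Prop).
(** Conjugate surjections must induce the same restriction. If [d] is conjugate to [c], then [p d]
    is [a p c] with [a] inner, so inner automorphisms have to be among those identified, and to act
    trivially. *)
Hypothesis inner : forall a : epi G G,
  epi_conj (epi_id G) a -> S a /\ forall v, rho a v = v.
Implicit Types (K : gobj U).

(* If S and kill are trivial, this presents the left Kan extension of V from the
   automorphisms of G; kill makes it vanish off the isomorphism class of G. *)
Inductive ind_rel K : dsum (fun _ : epi K G => V) -> Prop :=
  | ind_rel_act (p : epi K G) (a : epi G G) v : S a ->
      ind_rel (dsum_in (fun=> V) p (rho a v) - dsum_in (fun=> V) (epi_comp a p) v)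
  | ind_rel_kill (p : epi K G) v : kill -> #|K| <> #|G| ->
      ind_rel (dsum_in (fun=> V) p v).

Definition ind_ob K : lmodType k := lquot (@ind_rel K).

Definition ind_gen K (p : epi K G) : {linear V -> ind_ob K} :=
  lpi (@ind_rel K) \o dsum_in (fun _ : epi K G => V) p.

Lemma ind_gen_act K (p : epi K G) (a : epi G G) v : S a ->
  ind_gen p (rho a v) = ind_gen (epi_comp a p) v.
Proof. by move=> Sa; apply/lpi_eq/in_span_gen/ind_rel_act. Qed.

Lemma ind_gen_kill K (p : epi K G) v : kill -> #|K| <> #|G| -> ind_gen p v = 0.
Proof.
move=> kl KG; rewrite -(linear0 (lpi (@ind_rel K))); apply/lpi_eq.
by rewrite subr0; apply/in_span_gen/ind_rel_kill.
Qed.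

Lemma ind_span K (z : ind_ob K) : in_span (fun z => exists p v, z = ind_gen p v) z.
Proof.
rewrite -[z]lpi_repr (dsum_decomp (lrepr z)) linear_sum; apply: in_span_sum => p _.
by apply: in_span_gen; exists p, (lrepr z p).
Qed.

Lemma ind_ext K (W : lmodType k) (f g : {linear ind_ob K -> W}) :
  (forall p v, f (ind_gen p v) = g (ind_gen p v)) -> f =1 g.
Proof.
move=> fg q; rewrite -[q]lpi_repr; move: (lrepr q) => x.
by have := @dsum_ext k _ _ _ (f \o @lpi _ _ (@ind_rel K)) (g \o @lpi _ _ (@ind_rel K));
  apply=> p v; apply: fg.
Qed.

Section Lift.
Context (K : gobj U) (W : lmodType k) (b : epi K G -> {linear V -> W}).
Hypothesis b_act : forall p a v, S a -> b p (rho a v) = b (epi_comp a p) v.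
Hypothesis b_kill : forall p v, kill -> #|K| <> #|G| -> b p v = 0.

Lemma ind_lift_rel x : ind_rel x -> dsum_elim b x = 0.
Proof.
case=> [p a v Sa|p v kl KG]; last by rewrite dsum_elim_in b_kill.
by rewrite linearB !dsum_elim_in b_act // subrr.
Qed.

Definition ind_lift : {linear ind_ob K -> W} := lquot_lift ind_lift_rel.

Lemma ind_liftE p v : ind_lift (ind_gen p v) = b p v.
Proof. exact: etrans (lquot_lift_pi ind_lift_rel _) (dsum_elim_in _ _). Qed.
End Lift.

Section Restriction.
Context (K L : gobj U) (c : epi L K).

Lemma ind_res_act (p : epi K G) (a : epi G G) v : S a ->
  ind_gen (epi_comp p c) (rho a v) = ind_gen (epi_comp (epi_comp a p) c) v.
Proof. by move=> Sa; rewrite ind_gen_act // epi_compA. Qed.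

Lemma ind_res_kill (p : epi K G) v : kill -> #|K| <> #|G| ->
  ind_gen (epi_comp p c) v = 0.
Proof.
(* Since $|G| \le |K| \le |L|$, equality of the orders of [L] and [G] would force it for [K] as
   well: a generator killed at [K] stays killed at [L]. *)
move=> kl KG; apply: ind_gen_kill => // LG; apply: KG; apply/eqP.
by rewrite eqn_leq (epi_leq p) -LG (epi_leq c).
Qed.

Definition ind_res : {linear ind_ob K -> ind_ob L} := ind_lift ind_res_act ind_res_kill.

Lemma ind_resE p v : ind_res (ind_gen p v) = ind_gen (epi_comp p c) v.
Proof. exact: ind_liftE. Qed.
End Restriction.

Program Definition ind_psh : psh k U := @Psh k U ind_ob ind_res _ _ _.
Next Obligation.
move=> K L c d [y cd]; apply: ind_ext => p v; rewrite !ind_resE.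
have aM : {morph (fun x : G => x ^ (p y)) : x y / (x * y)}%g by move=> u w; rewrite conjMg.
have aS u : exists x : G, (x ^ (p y))%g = u by exists (u ^ (p y)^-1)%g; rewrite conjgKV.
pose a := Epi aM aS.
have [Sa ra] : S a /\ forall v, rho a v = v by apply: inner; exists (p y).
rewrite -{1}[v]ra ind_gen_act //; congr (ind_gen _ v); apply: epi_ext => x /=.
by rewrite cd epiJ.
Qed.
Next Obligation.
by move=> K; apply: (ind_ext (g := idfun)) => p v; rewrite ind_resE epi_comp_idr.
Qed.
Next Obligation.
move=> K L M c d; apply: (ind_ext (g := ind_res d \o ind_res c)) => p v.
rewrite -[RHS]/(ind_res d (ind_res c _)) !ind_resE.
by rewrite epi_compA.
Qed.

Lemma ind_pshE K (L : gobj U) (c : epi L K) (p : epi K G) v :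
  psh_res ind_psh c (ind_gen p v) = ind_gen (epi_comp p c) v.
Proof. exact: ind_resE. Qed.

Lemma ind_gen_id K (p : epi K G) v :
  ind_gen p v = psh_res ind_psh p (ind_gen (epi_id G) v).
Proof. by rewrite ind_pshE epi_comp_idl. Qed.

Section NatLift.
Context (Y : psh k U) (L : {linear V -> Y G}).
Hypothesis L_act : forall a v, S a -> L (rho a v) = psh_res Y a (L v).
Hypothesis L_kill : forall K (p : epi K G) v, kill -> #|K| <> #|G| ->
  psh_res Y p (L v) = 0.

Lemma ind_nt_act K (p : epi K G) (a : epi G G) v : S a ->
  (psh_res Y p \o L) (rho a v) = (psh_res Y (epi_comp a p) \o L) v.
Proof. by move=> Sa /=; rewrite L_act // psh_res_comp'. Qed.

Lemma ind_nt_kill K (p : epi K G) v : kill -> #|K| <> #|G| ->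
  (psh_res Y p \o L) v = 0.
Proof. exact: L_kill. Qed.

Definition ind_nt_fun K : {linear ind_ob K -> Y K} :=
  ind_lift (@ind_nt_act K) (@ind_nt_kill K).

Lemma ind_nt_funE K (p : epi K G) v : ind_nt_fun K (ind_gen p v) = psh_res Y p (L v).
Proof. exact: ind_liftE. Qed.

(** The universal property: the generator at [p] is the restriction along [p] of the generator at
    the identity, so that a transformation is given by its values at [G]. *)
Program Definition ind_nt : nat_trans ind_psh Y := @NatTrans k U ind_psh Y ind_nt_fun _.
Next Obligation.
move=> K H c x.
pose f : {linear ind_ob K -> Y H} := ind_nt_fun H \o ind_res c.
pose g : {linear ind_ob K -> Y H} := psh_res Y c \o ind_nt_fun K.
suff fg : f =1 g by apply: fg.
apply: ind_ext => p v.
rewrite -[LHS]/(ind_nt_fun H (ind_res c (ind_gen p v))).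
rewrite -[RHS]/(psh_res Y c (ind_nt_fun K (ind_gen p v))).
by rewrite ind_resE !ind_nt_funE psh_res_comp'.
Qed.

Lemma ind_ntE K (p : epi K G) v : ind_nt K (ind_gen p v) = psh_res Y p (L v).
Proof. exact: ind_liftE. Qed.
End NatLift.
End Induced.

(** * Finite-dimensional cohomology *)

Lemma epi_comp_inj (G H K : finGroupType) (b : epi H G) :
  #|H| = #|G| -> injective (fun a : epi K H => epi_comp b a).
Proof.
move=> HG a a' e; have [c [_ cb]] := epi_inverse b HG.
by rewrite -[a]epi_comp_idl -[a']epi_comp_idl -cb -!epi_compA e.
Qed.

Lemma epi_compr_bij (G H K : finGroupType) (b : epi K H) :
  #|K| = #|H| -> bijective (fun a : epi H G => epi_comp a b).
Proof.
move=> KH; have [c [bc cb]] := epi_inverse b KH.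
exists (fun a => epi_comp a c) => a; rewrite -epi_compA ?bc ?cb epi_comp_idr //.
Qed.

Definition epi_inv (G : finGroupType) (a : epi G G) : epi G G :=
  sval (cid (epi_inverse a (erefl #|G|))).

Lemma epi_invr (G : finGroupType) (a : epi G G) : epi_comp a (epi_inv a) = epi_id G.
Proof. by rewrite /epi_inv; case: cid => ? []. Qed.

Section FiniteCohomology.
Context (k : fieldType) (U : finGroupType -> Prop).
Implicit Types (M N : psh k U) (X Y Z P : cplx k U) (G H K : gobj U).

(** As for boundaries, the degree is an index: the members of degree [n] of a family of mixed
    degrees are selected without casts. *)
Inductive listed X G (I : Type) (deg : I -> int) (x : forall i, X (deg i) G) :
    forall n : int, X n G -> Prop :=
  | Listed i : listed x (x i).

(* The members of a spanning family need not be cocycles; this is what makes the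
   existence of a finite one pass to cones without a choice of kernels. *)
Definition spans X G (I : Type) (deg : I -> int) (x : forall i, X (deg i) G) :=
  forall (n : int) (z : X n G), cplx_d X n G z = 0 ->
    exists2 y, in_span (@listed X G I deg x n) y & bdry (z - y).

Definition fdcoh X G := exists (I : finType) (deg : I -> int) (x : forall i, X (deg i) G),
  spans x.

Lemma listed_span_map X Y G H (I J : Type) (degI : I -> int) (degJ : J -> int)
    (x : forall i, X (degI i) G) (y : forall j, Y (degJ j) H)
    (f : forall n, {linear X n G -> Y n H}) :
  (forall i, in_span (@listed Y H J degJ y _) (f _ (x i))) ->
  forall n z, in_span (@listed X G I degI x n) z -> in_span (@listed Y H J degJ y n) (f n z).
Proof.
by move=> fx n z; apply: in_span_map => {}z [i]; apply: fx.
Qed.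

(** Acyclicity is the case of an empty spanning family. Applied to it, the splitting lemmas below
    yield contractions, as their error terms lie in the span of nothing. *)
Lemma acyclic_spans X G : acyclic_at X G ->
  spans (X := X) (G := G) (I := void) (deg := fun=> 0) (fun i => match i with end).
Proof.
move=> /acyclicP aX n z dz; exists 0; first exact: in_span0.
by rewrite subr0; apply: aX.
Qed.

(* For h with d h d = d, the map p = 1 - (d h + h d) takes values in the cocycles
   and kills the boundaries, so p o p takes values in the span of the p (x i). *)
Lemma splitting X G (I : Type) (deg : I -> int) (x : forall i, X (deg i) G) :
  spans x -> exists (h : forall n : int, {linear X (n + 1) G -> X n G})
    (y : forall i, X (deg i) G), (forall i, cplx_d X (deg i) G (y i) = 0) /\
    forall n (v : X (n + 1) G),
     in_span (@listed X G I deg y (n + 1))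
       (v - (cplx_d X n G (h n v) + h (n + 1) (cplx_d X (n + 1) G v))).
Proof.
move=> sx.
pose h n := sval (cid (pseudo_inverse (cplx_d X n G))).
have hP n v : cplx_d X n G (h n (cplx_d X n G v)) = cplx_d X n G v.
  by rewrite /h; case: cid.
have pl n : linear (fun v : X (n + 1) G =>
    v - (cplx_d X n G (h n v) + h (n + 1) (cplx_d X (n + 1) G v))).
  by move=> a u v; rewrite !linearP /= !scalerDr scalerN scalerDr; zmod.
pose p := int_rect_succ (T := fun n => {linear X n G -> X n G}) (fun n => mklin (pl n)).
have pE n (v : X (n + 1) G) :
    p (n + 1) v = v - (cplx_d X n G (h n v) + h (n + 1) (cplx_d X (n + 1) G v)).
  by rewrite /p int_rectE mklinE.
have dp n (v : X n G) : cplx_d X n G (p n v) = 0.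
  elim/int_succ: n v => n v; rewrite pE linearB linearD cplx_dd hP add0r subrr //.
have pb n (v : X n G) : bdry v -> p n v = 0.
  elim/int_succ: n v => n v /bdryP[w ->]; rewrite pE cplx_dd linear0 hP; zmod.
(* Replacing $h$ by $h(1 + p)$ turns the error $1 - (dh + hd) = p$ into $p - dhp = p \circ p$,
   because $pd = 0$ and $dp = 0$. *)
have Hl n : linear (fun v : X (n + 1) G => h n (v + p (n + 1) v)).
  by move=> a u v; rewrite -linearP; congr (h n _); rewrite linearP scalerDr; zmod.
exists (fun n => mklin (Hl n)), (fun i => p _ (x i)); split=> // n v; rewrite !mklinE.
have -> : v - (cplx_d X n G (h n (v + p (n + 1) v)) +
    h (n + 1) (cplx_d X (n + 1) G v + p (n + 1 + 1) (cplx_d X (n + 1) G v))) =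
    p (n + 1) (p (n + 1) v).
  rewrite (pb _ _ (Bdry v)) addr0 [RHS]pE dp linear0 addr0 !linearD.
  by rewrite /=; apply: (eq_by_sub (esym (pE n v))); zmod.
have [y sy by_] := sx _ _ (dp _ v).
rewrite -[p _ v](subrK y) linearD pb // add0r.
by apply: listed_span_map sy => i; apply: in_span_gen; exact: Listed.
Qed.

Hypothesis char0 : [pchar k] =i pred0.

Lemma natr_unit n : (0 < n)%N -> n%:R != 0 :> k.
Proof. by move/pcharf0P: char0 => ->; case: n. Qed.

Lemma card_epi_unit G : #|{: epi G G}|%:R != 0 :> k.
Proof. by apply: natr_unit; apply/card_gt0P; exists (epi_id G). Qed.

(** The average over all automorphisms [a] of the conjugates of [h] by [a]. Its error is an average
    of conjugated errors, so it needs the translates of the [y i] by all automorphisms, still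
    finitely many. *)
Lemma equivariant_splitting X G (I : Type) (deg : I -> int) (x : forall i, X (deg i) G) :
  spans x -> exists (h : forall n : int, {linear X (n + 1) G -> X n G})
    (y : forall i : I * epi G G, X (deg i.1) G),
    (forall n (a : epi G G) v, h n (psh_res (X (n + 1)) a v) = psh_res (X n) a (h n v)) /\
    forall n (v : X (n + 1) G),
     in_span (@listed X G _ (fun i : I * epi G G => deg i.1) y (n + 1))
       (v - (cplx_d X n G (h n v) + h (n + 1) (cplx_d X (n + 1) G v))).
Proof.
move=> /splitting[h [y [_ hy]]].
pose N : k := #|{: epi G G}|%:R^-1.
have Hl n : linear (fun v : X (n + 1) G =>
    N *: \sum_(a : epi G G) psh_res (X n) (epi_inv a) (h n (psh_res (X (n + 1)) a v))).
  move=> c u v; rewrite scalerA mulrC -scalerA -scalerDr; congr (_ *: _).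
  rewrite scaler_sumr -big_split; apply: eq_bigr => a _ /=.
  by rewrite !linearP.
exists (fun n => mklin (Hl n)), (fun i => psh_res (X _) (epi_inv i.2) (y i.1)).
split=> [n b v|n v]; rewrite !mklinE.
  rewrite linearZ; congr (_ *: _); rewrite linear_sum /=.
  rewrite [RHS](reindex_inj (epi_comp_inj (b := b) erefl)); apply: eq_bigr => a _.
  rewrite [in LHS]psh_res_comp' [in RHS]psh_res_comp'; congr (psh_res _ _ _).
  apply: (epi_comp_inj (b := epi_comp b a)) => //.
  by rewrite epi_compA epi_invr epi_comp_idl -epi_compA epi_invr epi_comp_idr.
set z := (X in in_span _ X).
have -> : z = N *: \sum_(a : epi G G) psh_res (X (n + 1)) (epi_inv a)
   (psh_res (X (n + 1)) a v - (cplx_d X n G (h n (psh_res (X (n + 1)) a v)) +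
     h (n + 1) (cplx_d X (n + 1) G (psh_res (X (n + 1)) a v)))).
  rewrite (eq_bigr (fun a : epi G G => v +
      (- psh_res (X (n + 1)) (epi_inv a) (cplx_d X n G (h n (psh_res (X (n + 1)) a v))) -
       psh_res (X (n + 1)) (epi_inv a) (h (n + 1) (cplx_d X (n + 1) G (psh_res (X (n + 1)) a v)))))).
    rewrite big_split sumr_const -scaler_nat scalerDr scalerA mulVf ?card_epi_unit //.
    rewrite scale1r; congr (_ + _); rewrite linearZ /= -scalerDr -scalerN; congr (_ *: _).
    rewrite linear_sum -big_split -sumrN; apply: eq_bigr => a _ /=.
    by rewrite opprD !nat_appE.
  move=> a _; rewrite linearB linearD psh_res_comp' epi_invr psh_res_id; zmod.
apply: in_spanZ; apply: in_span_sum => a _.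
apply: (listed_span_map (f := fun n => psh_res (X n) (epi_inv a)) _ (hy n _)) => i.
apply: in_span_gen.
exact: (@Listed X G _ (fun i : I * epi G G => deg i.1)
  (fun i => psh_res (X (deg i.1)) (epi_inv i.2) (y i.1)) (i, a)).
Qed.
End FiniteCohomology.

Section Free.
Context (k : fieldType) (U : finGroupType -> Prop) (G : gobj U).
Implicit Types (M N : psh k U) (X Y Z P : cplx k U) (H K : gobj U).

Lemma free_inner M (a : epi G G) : epi_conj (epi_id G) a ->
  True /\ forall v, psh_res M a v = v.
Proof.
by move=> ca; split=> // v; rewrite -(psh_res_conj ca) psh_res_id.
Qed.

Definition freeP M : psh k U :=
  @ind_psh k U G (M G) (fun=> True) (fun a => psh_res M a) False (@free_inner M).

Definition fgen M K (p : epi K G) : {linear M G -> freeP M K} :=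
  @ind_gen k U G (M G) (fun=> True) (fun a => psh_res M a) False K p.

Lemma fgen_id M K (p : epi K G) v : fgen M p v = psh_res (freeP M) p (fgen M (epi_id G) v).
Proof. exact: ind_gen_id. Qed.

Lemma fgen_res M (a : epi G G) v :
  fgen M (epi_id G) (psh_res M a v) = psh_res (freeP M) a (fgen M (epi_id G) v).
Proof.
rewrite -fgen_id -[a in RHS]epi_comp_idr.
exact: (@ind_gen_act k U G (M G) (fun=> True) (fun a => psh_res M a)).
Qed.

Lemma free_span M K (z : freeP M K) : in_span (fun z => exists p v, z = fgen M p v) z.
Proof. exact: ind_span. Qed.

Lemma free_ext M K (W : lmodType k) (f g : {linear freeP M K -> W}) :
  (forall p v, f (fgen M p v) = g (fgen M p v)) -> f =1 g.
Proof. exact: ind_ext. Qed.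

Section Lift.
Context (M Y : psh k U) (L : {linear M G -> Y G}).
Hypothesis L_act : forall a v, L (psh_res M a v) = psh_res Y a (L v).

Definition free_nt : nat_trans (freeP M) Y :=
  @ind_nt k U G (M G) (fun=> True) (fun a => psh_res M a) False (@free_inner M) Y L
    (fun a v _ => L_act a v) (fun K p v (f : False) => match f with end).

Lemma free_ntE K (p : epi K G) v : free_nt K (fgen M p v) = psh_res Y p (L v).
Proof. exact: ind_ntE. Qed.
End Lift.

Section Complex.
Context (X : cplx k U).

Lemma free_d_act (n : int) (a : epi G G) v :
  (fgen (X (n + 1)) (epi_id G) \o cplx_d X n G) (psh_res (X n) a v) =
  psh_res (freeP (X (n + 1))) a ((fgen (X (n + 1)) (epi_id G) \o cplx_d X n G) v).
Proof. by rewrite /= nat_appE; apply: fgen_res. Qed.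

Definition free_d (n : int) : nat_trans (freeP (X n)) (freeP (X (n + 1))) :=
  free_nt (@free_d_act n).

Lemma free_dE n K (p : epi K G) v :
  free_d n K (fgen (X n) p v) = fgen (X (n + 1)) p (cplx_d X n G v).
Proof. by rewrite free_ntE [RHS]fgen_id. Qed.

Program Definition freeC : cplx k U := @Cplx k U (fun n => freeP (X n)) free_d _.
Next Obligation.
move=> n K.
pose f : {linear freeP (X n) K -> freeP (X (n + 1 + 1)) K} := free_d (n + 1) K \o free_d n K.
suff fg : f =1 \0 by apply: fg.
apply: free_ext => p v; rewrite -[LHS]/(free_d (n + 1) K (free_d n K _)) !free_dE.
by rewrite cplx_dd linear0.
Qed.

Lemma freeC_dE n K (p : epi K G) v :
  cplx_d freeC n K (fgen (X n) p v) = fgen (X (n + 1)) p (cplx_d X n G v).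
Proof. exact: free_dE. Qed.

Section Homotopy.
Context (Y : cplx k U) (f : cmap freeC Y).
Context (h : forall n : int, {linear X (n + 1) G -> Y n G}).
Hypothesis h_act : forall n a v, h n (psh_res (X (n + 1)) a v) = psh_res (Y n) a (h n v).

(** By the universal property, an equivariant family of maps at the single group [G] extends to all
    groups. *)
Definition free_htpy : htpy freeC Y := fun n => free_nt (@h_act n).

Lemma free_htpyE (n : int) K (p : epi K G) v :
  hbd free_htpy (fgen (X (n + 1)) p v : freeC (n + 1) K) =
  psh_res (Y (n + 1)) p (cplx_d Y n G (h n v) + h (n + 1) (cplx_d X (n + 1) G v)).
Proof.
rewrite /hbd freeC_dE -[free_htpy n K _]/(free_nt _ K _) -[free_htpy (n + 1) K _]/(free_nt _ K _).
by rewrite !free_ntE nat_appE linearD.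
Qed.
End Homotopy.

Lemma free_counit_act n (a : epi G G) (v : X n G) :
  idfun (psh_res (X n) a v : X n G) = psh_res (X n) a (idfun v).
Proof. by []. Qed.

Program Definition free_counit : cmap freeC X :=
  @CMap k U freeC X (fun n => free_nt (L := idfun) (@free_counit_act n)) _.
Next Obligation.
move=> n K.
pose f : {linear freeP (X n) K -> X (n + 1) K} :=
  free_nt (L := idfun) (@free_counit_act (n + 1)) K \o free_d n K.
pose g : {linear freeP (X n) K -> X (n + 1) K} :=
  cplx_d X n K \o free_nt (L := idfun) (@free_counit_act n) K.
suff fg : f =1 g by apply: fg.
apply: free_ext => p v.
rewrite -[LHS]/(free_nt (@free_counit_act (n + 1)) K (free_d n K (fgen (X n) p v))).
rewrite -[RHS]/(cplx_d X n K (free_nt (@free_counit_act n) K (fgen (X n) p v))).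
by rewrite free_dE !free_ntE /= nat_appE.
Qed.

Lemma free_counitE n K (p : epi K G) v :
  free_counit n K (fgen (X n) p v) = psh_res (X n) p v.
Proof. exact: free_ntE. Qed.

Lemma free_zero K n (x : freeC n K) : (forall p : epi K G, False) -> x = 0.
Proof.
by move=> np; apply: (free_ext (f := idfun) (g := \0)) => p; have := np p.
Qed.

Lemma free_gen_iso K n (x : freeC n K) (p : epi K G) : #|K| = #|G| ->
  exists v, x = fgen (X n) p v.
Proof.
move=> KG; have [q [pq qp]] := epi_inverse p KG.
have E r v : fgen (X n) r v = fgen (X n) p (psh_res (X n) (epi_comp r q) v) :> freeC n K.
  rewrite [RHS]fgen_id fgen_res psh_res_comp' -epi_compA qp epi_comp_idr.
  exact: fgen_id.
have [f fE] : exists f : {linear freeC n K -> X n G},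
    forall r v, f (fgen (X n) r v) = psh_res (X n) (epi_comp r q) v.
  exists (psh_res (X n) q \o free_counit n K) => r v.
  by rewrite -[LHS]/(psh_res (X n) q (free_counit n K _)) free_counitE psh_res_comp'.
exists (f x); pose g : {linear freeC n K -> freeC n K} := fgen (X n) p \o f.
suff fg : idfun =1 g by apply: fg.
by apply: free_ext => r v; rewrite -[RHS]/(fgen (X n) p (f _)) fE; apply: E.
Qed.

(** Any isomorphism [p] from [K] to [G] brings all elements at [K] to the form [fgen _ p v], and so
    the counit is bijective at [K]. *)
Lemma cone_free_iso K : gobj_iso G K -> acyclic_at (cone free_counit) K.
Proof.
move=> /gobj_isoP[p KG]; have [q [pq qp]] := epi_inverse p KG.
apply/cone_acyclic => n; split=> [x dx b|y dy].
  suff inj m (z : freeC m K) : free_counit m K z = 0 -> z = 0.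
    elim/int_succ: n x dx b => n x dx /bdryP[y e].
    rewrite -[x]subr0; apply/bdryP; exists (fgen (X n) p (psh_res (X n) q y)).
    apply/eqP; rewrite -subr_eq0; apply/eqP/inj; rewrite linearB cmap_appE free_counitE.
    by rewrite subr0 e (res_inv _ qp) subrr.
  have [v ->] := free_gen_iso z p KG; rewrite free_counitE => /(congr1 (psh_res (X m) q)).
  by rewrite (res_inv _ pq) linear0 => ->; rewrite linear0.
exists (fgen (X n) p (psh_res (X n) q y)).
  by rewrite freeC_dE nat_appE dy !linear0.
by rewrite free_counitE (res_inv _ qp) subrr; apply: bdry0.
Qed.

Hypothesis char0 : [pchar k] =i pred0.

(** An equivariant contraction of [N] at [G], composed with the values of [f] on generators at the
    identity, extends to a null-homotopy of [f]. *)
Lemma free_kproj : kproj freeC.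
Proof.
move=> N /(_ G)/acyclic_spans/(equivariant_splitting char0)[h [y [hact hE]]] f.
have {}hE (n : int) (v : N (n + 1) G) :
    v = cplx_d N n G (h n v) + h (n + 1) (cplx_d N (n + 1) G v).
  apply/eqP; rewrite -subr_eq0; apply/eqP.
  by apply: in_span_none (hE n v) => z [] [[]].
pose L n : {linear X (n + 1) G -> N n G} :=
  h n \o (f (n + 1) G \o fgen (X (n + 1)) (epi_id G)).
have LE n v : L n v = h n (f (n + 1) G (fgen (X (n + 1)) (epi_id G) v)) by [].
have Lact (n : int) a v : L n (psh_res (X (n + 1)) a v) = psh_res (N n) a (L n v).
  by rewrite !LE fgen_res -hact nat_appE.
exists (free_htpy Lact) => n K x.
pose F : {linear freeC (n + 1) K -> N (n + 1) K} :=
  (cplx_d N n K \o free_htpy Lact n K) \+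
  (free_htpy Lact (n + 1) K \o cplx_d freeC (n + 1) K).
have -> : hbd (free_htpy Lact) x = F x by [].
move: x; apply: free_ext => p v.
rewrite -[RHS]/(hbd (free_htpy Lact) _) free_htpyE !LE -freeC_dE cmap_appE.
by rewrite -hE -nat_appE; congr (f _ _ _); apply: fgen_id.
Qed.

Section Finite.
Context (I : finType) (deg : I -> int) (x : forall i, X (deg i) G).
Hypothesis sx : spans x.

(** The equivariant splitting at [G], transported to the free complex: at each group, the identity
    is homotopic to a map with values in the span of a finite family. Both finiteness properties
    below rest on it. *)
Lemma free_finite : exists (H : htpy freeC freeC) (y : forall i : I * epi G G, X (deg i.1) G),
  forall K (n : int) (z : freeC (n + 1) K),
    in_span (@listed k U freeC K _ (fun i : (I * epi G G) * epi K G => deg i.1.1)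
       (fun i => fgen (X (deg i.1.1)) i.2 (y i.1)) (n + 1)) (z - hbd H z).
Proof.
have [h [y [hact hE]]] := equivariant_splitting char0 sx.
pose L (n : int) : {linear X (n + 1) G -> freeC n G} := fgen (X n) (epi_id G) \o h n.
have LE n v : L n v = fgen (X n) (epi_id G) (h n v) by [].
have Lact (n : int) a v : L n (psh_res (X (n + 1)) a v) = psh_res (freeC n) a (L n v).
  by rewrite !LE hact; apply: fgen_res.
exists (free_htpy Lact), y => K n z.
pose F : {linear freeC (n + 1) K -> freeC (n + 1) K} := idfun \- (
  (cplx_d freeC n K \o free_htpy Lact n K) \+
  (free_htpy Lact (n + 1) K \o cplx_d freeC (n + 1) K)).
have FE p v : F (fgen (X (n + 1)) p v) = fgen (X (n + 1)) p
   (v - (cplx_d X n G (h n v) + h (n + 1) (cplx_d X (n + 1) G v))).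
  rewrite -[LHS]/(_ - hbd (free_htpy Lact) _) free_htpyE !LE freeC_dE linearB.
  by congr (_ - _); rewrite -linearD; exact/esym/fgen_id.
rewrite -[z - _]/(F z).
apply: (in_span_map (f := F) _ (free_span z)) => {}z [p [v ->]]; rewrite FE.
apply: (@listed_span_map k U X freeC G K _ _ _ _ y _ (fun n => fgen (X n) p) _ _ _ (hE n _)) => i.
apply: in_span_gen.
exact: (@Listed k U freeC K _ (fun i : (I * epi G G) * epi K G => deg i.1.1)
  (fun i => fgen (X (deg i.1.1)) i.2 (y i.1)) (i, p)).
Qed.

Lemma free_ffin : ffin freeC.
Proof.
have [H [y Hy]] := free_finite => J Y f.
exists (fun n => nt_comp (f n) (H n)).
(* The finite family at any [K] consists of restrictions of elements at [G], so the supports of the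
   images at [G] bound those at all groups. *)
exists (flatten [seq dsum_support (f (deg i.1) G (fgen (X (deg i.1)) (epi_id G) (y i)))
   | i <- enum {: I * epi G G}]) => n K z j njs.
have -> : f (n + 1) K z - hbd (fun n => nt_comp (f n) (H n)) z = f (n + 1) K (z - hbd H z).
  by rewrite linearB; congr (_ - _); rewrite /hbd [RHS]linearD cmap_appE.
elim: {z} (z - hbd H z) / (Hy K n z).
- move=> _ [i]; rewrite fgen_id nat_appE.
  rewrite -[LHS]/(psh_res (Y j (deg i.1.1)) i.2 (f (deg i.1.1) G (fgen _ _ (y i.1)) j)).
  suff -> : f (deg i.1.1) G (fgen (X (deg i.1.1)) (epi_id G) (y i.1)) j = 0 by rewrite linear0.
  apply: contrapT => fj; move/negP: njs; apply; apply/flatten_mapP; exists i.1.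
    by rewrite mem_enum.
  exact: dsum_supportP fj.
- by rewrite linear0.
by move=> a u v _ fu _ fv; rewrite linearP dsumDE dsumZE fu fv scaler0 addr0.
Qed.

Lemma free_fdcoh K : fdcoh freeC K.
Proof.
have [H [y Hy]] := free_finite.
exists ((I * epi G G) * epi K G)%type, (fun i => deg i.1.1),
  (fun i => fgen (X (deg i.1.1)) i.2 (y i.1)).
move=> n; elim/int_succ: n => n z dz; exists (z - hbd H z); first exact: Hy.
by rewrite /hbd dz linear0 addr0 subKr; apply: Bdry.
Qed.
End Finite.
End Complex.
End Free.

(** * Resolutions *)

Section Twist.
Context (k : fieldType) (U : finGroupType -> Prop).
Implicit Types (X Y N : cplx k U) (G H K : gobj U).
Context (X Q P : cplx k U) (f : cmap Q X) (phi : cmap P (cone f)).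

Definition tw (n : int) : nat_trans (P n) (Q (n + 1)) :=
  nt_comp (nt_fst (Q (n + 1)) (X n)) (phi n).

Lemma phiE n G p : phi n G p = (tw n G p, (phi n G p).2).
Proof. exact: surjective_pairing. Qed.

Lemma twE n G p : tw (n + 1) G (cplx_d P n G p) = - cplx_d Q (n + 1) G (tw n G p).
Proof.
by rewrite -[LHS]/((phi (n + 1) G (cplx_d P n G p)).1) cmap_appE.
Qed.

Lemma tw2E n G p : (phi (n + 1) G (cplx_d P n G p)).2 =
  f (n + 1) G (tw n G p) + cplx_d X n G (phi n G p).2.
Proof. by rewrite cmap_appE. Qed.

(* The fibre of the composite of phi with cone_out f; when phi is a resolution of
   the cone, this is a resolution of X. *)
Program Definition twist : cplx k U := @Cplx k U (fun n => psh_sum (Q n) (P n))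
  (fun n => nt_pairing
    (nt_add (nt_comp (cplx_d Q n) (nt_fst _ _)) (nt_opp (nt_comp (tw n) (nt_snd _ _))))
    (nt_comp (cplx_d P n) (nt_snd _ _))) _.
Next Obligation.
move=> n G [q p]; apply: pairP; last exact: cplx_dd.
rewrite -[LHS]/(cplx_d Q (n + 1) G (cplx_d Q n G q - tw n G p) -
  tw (n + 1) G (cplx_d P n G p)).
by rewrite linearB cplx_dd twE opprK sub0r addNr.
Qed.

Lemma twist_dE n G (q : Q n G) (p : P n G) :
  cplx_d twist n G (q, p) = (cplx_d Q n G q - tw n G p, cplx_d P n G p).
Proof. by []. Qed.

Program Definition twist_map : cmap twist X := @CMap k U twist X
  (fun n => nt_add (nt_comp (f n) (nt_fst _ _))
    (nt_comp (nt_snd (Q (n + 1)) (X n)) (nt_comp (phi n) (nt_snd _ _)))) _.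
Next Obligation.
move=> n G [q p].
rewrite -[LHS]/(f (n + 1) G (cplx_d Q n G q - tw n G p) +
  (phi (n + 1) G (cplx_d P n G p)).2).
rewrite -[RHS]/(cplx_d X n G (f n G q + (phi n G p).2)).
by rewrite linearB tw2E linearD cmap_appE; zmod.
Qed.

Lemma twist_mapE n G q p : twist_map n G (q, p) = f n G q + (phi n G p).2.
Proof. by []. Qed.

Lemma twist_qis : qis phi -> qis twist_map.
Proof.
move=> qphi G; elim/int_succ => n; split=> [[q p]|y dy].
  rewrite twist_dE => -[dq dp] [x fx].
  have {}dq : cplx_d Q (n + 1 + 1) G q = tw (n + 1 + 1) G p.
    by apply/eqP; rewrite -subr_eq0; apply/eqP.
  have [|p' pp'] := (qphi G (n + 1)).1 p dp.
    exists (- q, x); rewrite phiE -dq; apply: pairP => /=; first by rewrite linearN opprK.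
    by rewrite linearN -fx twist_mapE; zmod.
  subst p; pose q' := q + tw (n + 1) G p'.
  have dq' : cplx_d Q (n + 1 + 1) G q' = 0 by rewrite /q' linearD dq twE addNr.
  pose x' := x - (phi (n + 1) G p').2.
  have fq' : f (n + 1 + 1) G q' = cplx_d X (n + 1) G x'.
    by rewrite /q' /x' linearB -fx twist_mapE tw2E linearD; zmod.
  (* The cocycle [q'] need not be a boundary, but [(q', - x')] is a cocycle of the cone. A cocycle
     [p2] of [P] representing its class corrects [p']. *)
  have [|p2 [[q3 x3] [dp2]]] := (qphi G n).2 (q', - x').
    by apply: pairP; rewrite /= ?dq' ?oppr0 // linearN fq' subrr.
  rewrite phiE => -[eq' _].
  exists (- q3, p' - p2); rewrite twist_dE; apply: pairP; last by rewrite /= linearB dp2 subr0.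
  rewrite -[RHS]/(cplx_d Q (n + 1) G (- q3) - tw (n + 1) G (p' - p2)) linearB linearN.
  by apply: (eq_by_sub eq'); rewrite /q' /=; zmod.
have [|p [[q x] [dp]]] := (qphi G (n + 1)).2 (0, y).
  by apply: pairP; rewrite /= ?linear0 ?oppr0 // dy addr0.
rewrite phiE => -[e1 e2].
exists (q, p), x; split.
  by rewrite twist_dE dp; congr (_, _); apply: (eq_by_sub e1) => /=; zmod.
by rewrite twist_mapE e2 /=; zmod.
Qed.

Program Definition twist_in : cmap Q twist :=
  @CMap k U Q twist (fun n => nt_pairing (nt_id _) (nt_zero _ _)) _.
Next Obligation.
by move=> n G q; rewrite -[RHS]/(cplx_d Q n G q - tw n G 0, cplx_d P n G 0) !linear0 addr0.
Qed.

Lemma twist_split n G (q : Q n G) (p : P n G) :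
  ((q, p) : twist n G) = (q, 0) + ((0, p) : twist n G).
Proof. by apply: pairP => /=; rewrite ?addr0 ?add0r. Qed.

Definition twist_rest (N : cplx k U) (g : cmap twist N) (h : htpy Q N) n :
    nat_trans (P n) (N n) :=
  nt_add (nt_comp (g n) (nt_pairing (nt_zero _ _) (nt_id _))) (nt_comp (h n) (tw n)).

Lemma twist_restE N (g : cmap twist N) (h : htpy Q N) n G p :
  twist_rest g h n G p = g n G (0, p) + h n G (tw n G p).
Proof. by []. Qed.

(** The last term vanishes if [h] is a null-homotopy of [g] on [Q]; then the remainder is a map of
    complexes on [P], to which the property of [P] applies. *)
Lemma twist_rest_d N (g : cmap twist N) (h : htpy Q N) n G p :
  cplx_d N n G (twist_rest g h n G p) = twist_rest g h (n + 1) G (cplx_d P n G p) -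
    (g (n + 1) G (tw n G p, 0) - hbd h (tw n G p)).
Proof.
rewrite !twist_restE linearD -cmap_appE twist_dE linear0 sub0r twE linearN.
rewrite twist_split linearD /hbd.
have -> : (- tw n G p, 0) = - ((tw n G p, 0) : twist (n + 1) G).
  by apply: pairP => /=; rewrite ?oppr0.
by rewrite linearN; zmod.
Qed.

Definition twist_htpy N (h : htpy Q N) (h' : htpy P N) : htpy twist N :=
  fun n => nt_add (nt_comp (h n) (nt_fst _ _)) (nt_comp (h' n) (nt_snd _ _)).

Lemma twist_htpyE N (g : cmap twist N) (h : htpy Q N) (h' : htpy P N) (n : int) G
    (q : Q (n + 1) G) (p : P (n + 1) G) :
  g (n + 1) G (q, p) - hbd (twist_htpy h h') ((q, p) : twist (n + 1) G) =
  (g (n + 1) G (q, 0) - hbd h q) + (twist_rest g h (n + 1) G p - hbd h' p).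
Proof.
rewrite /hbd twist_dE -[twist_htpy h h' n G _]/(h n G q + h' n G p).
rewrite -[twist_htpy h h' (n + 1) G _]/(h (n + 1) G (cplx_d Q (n + 1) G q - tw (n + 1) G p) +
  h' (n + 1) G (cplx_d P (n + 1) G p)).
by rewrite twist_split twist_restE (linearD (g (n + 1) G)) (linearB (h (n + 1) G)) (linearD (cplx_d N n G)); zmod.
Qed.

Lemma twist_kproj : kproj Q -> kproj P -> kproj twist.
Proof.
move=> Qp Pp N aN g.
have [h hE] := Qp N aN (cmap_comp g twist_in).
have hE' (n : int) G (q : Q (n + 1) G) : g (n + 1) G (q, 0) - hbd h q = 0.
  by apply/eqP; rewrite subr_eq0; apply/eqP; apply: hE.
have gd n G p : twist_rest g h (n + 1) G (cplx_d P n G p) =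
    cplx_d N n G (twist_rest g h n G p) by rewrite twist_rest_d hE' subr0.
have [h' h'E] := Pp N aN (CMap gd).
exists (twist_htpy h h') => n G [q p]; apply/eqP; rewrite -subr_eq0 twist_htpyE hE' add0r.
by rewrite -[twist_rest _ _ _ _ _]/(CMap gd (n + 1) G p) h'E subrr.
Qed.

Lemma twist_ffin : ffin Q -> ffin P -> ffin twist.
Proof.
move=> Qf Pf I Y g.
have [h [s hE]] := Qf I Y (cmap_comp g twist_in).
have hE' (n : int) G (q : Q (n + 1) G) i : (i : {classic I}) \notin s ->
  (g (n + 1) G (q, 0) - hbd h q) i = 0 by apply: hE.
(* On the summands in [s] the remainder need not commute with differentials. They are cut off, which
   is harmless as [s] is finite and enters the final list. *)
pose r := cdsum_restr Y s.
have gd n G p : twist_rest g h (n + 1) G (cplx_d P n G p) -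
    r (n + 1) G (twist_rest g h (n + 1) G (cplx_d P n G p)) =
    cplx_d (cdsum Y) n G (twist_rest g h n G p - r n G (twist_rest g h n G p)).
  rewrite linearB -cmap_appE twist_rest_d (linearB (r (n + 1) G)); apply: dsumP => i.
  set a := twist_rest _ _ _ _ _; set b := (g _ _ _ - _).
  rewrite -[LHS]/(a i - r _ G a i) -[RHS]/((a i - b i) - (r _ G a i - r _ G b i)).
  rewrite /r !cdsum_restrE; case: ifPn => [_|/(hE' n G (tw n G p)) -> ].
    by zmod.
  by zmod.
pose g' : cmap P (cdsum Y) :=
  @CMap k U P (cdsum Y) (fun n => nt_add (twist_rest g h n) (nt_opp (nt_comp (r n) (twist_rest g h n)))) gd.
have [h' [s' h'E]] := Pf I Y g'.
exists (twist_htpy h h'), (s ++ s') => n G [q p] i.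
rewrite mem_cat negb_or => /andP[is_ is']; rewrite twist_htpyE dsumDE hE' // add0r.
rewrite -[RHS](h'E n G p i is').
rewrite -[LHS]/(twist_rest g h (n + 1) G p i - hbd h' p i).
rewrite -[RHS]/(twist_rest g h (n + 1) G p i - r (n + 1) G (twist_rest g h (n + 1) G p) i -
  hbd h' p i).
by rewrite /r cdsum_restrE (negPf is_) subr0.
Qed.
End Twist.

Section Resolution.
Context (k : fieldType) (U : finGroupType -> Prop).
Implicit Types (X Y N P Q : cplx k U) (G H K : gobj U).

Lemma listed_eq_rect X G (I : Type) (deg : I -> int) (x : forall i, X (deg i) G)
    n m (e : n = m) (z : X n G) :
  listed x (eq_rect n (fun n => X n G) z m e) -> listed x z.
Proof. by subst m. Qed.

Lemma listed_inv X G (I : Type) (deg : I -> int) (x : forall i, X (deg i) G) n (z : X n G) :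
  listed x z -> exists i (e : deg i = n), z = eq_rect (deg i) (fun n => X n G) (x i) n e.
Proof. by case=> {n z} i; exists i, erefl. Qed.

(** Degrees are put in the form in which [X] enters its shift and cones: degree [m + 1] of [X] sits
    in degree [m]. *)
Lemma fdcoh_succ X G : fdcoh X G ->
  exists (I : finType) (m : I -> int) (x : forall i, X (m i + 1) G),
    spans (deg := fun i => m i + 1) x.
Proof.
move=> [I [deg [x sx]]]; exists I, (fun i => deg i - 1).
exists (fun i => eq_rect (deg i) (fun n => X n G) (x i) (deg i - 1 + 1) (esym (subrK 1 (deg i)))).
move=> n z dz; have [y sy byz] := sx n z dz; exists y => //.
apply: in_span_sub sy => t [i]; apply: in_span_gen.
apply: (listed_eq_rect (e := esym (subrK 1 (deg i)))).
exact: (@Listed k U X G I (fun i => deg i - 1 + 1)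
 (fun i => eq_rect (deg i) (fun n => X n G) (x i) (deg i - 1 + 1) (esym (subrK 1 (deg i))))).
Qed.

(** With [h] a pseudo-inverse of the differential of [Y], the linear map [H] sends [x] to $(x, -h f
    x)$. This is a cocycle whenever [x] is one and [f x] is a boundary, so [H] applied to
    combinations of the [x i] reaches all first components, up to boundaries; the family of [Y]
    covers the rest. *)
Lemma cone_fdcoh X Y (f : cmap X Y) G : fdcoh X G -> fdcoh Y G -> fdcoh (cone f) G.
Proof.
move=> /fdcoh_succ[I [m [x sx]]] [J [deg [y sy]]].
pose h n := sval (cid (pseudo_inverse (cplx_d Y n G))).
have hP n v : cplx_d Y n G (h n (cplx_d Y n G v)) = cplx_d Y n G v.
  by rewrite /h; case: cid.
have Hl n : linear (fun v : X (n + 1) G => (v, - h n (f (n + 1) G v)) : cone f n G).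
  by move=> a u v; apply: pairP => //=; rewrite (linearP (f (n + 1) G)) (linearP (h n)) opprD scalerN.
pose H n := mklin (Hl n).
pose degC (c : I + J) := match c with inl i => m i | inr j => deg j end.
pose c i : cone f (degC i) G := match i with
  | inl i => H (m i) (x i) | inr j => cone_in f (deg j) G (y j) end.
have cl (a : int) (t : X (a + 1) G) : listed x t -> in_span (@listed k U (cone f) G _ degC c a) (H a t).
  move=> /listed_inv[i [e ->]]; have e' := addIr _ e; subst a.
  rewrite (eq_axiomK e) /=; apply: in_span_gen.
  exact: (@Listed k U (cone f) G _ degC c (inl i)).
have cr (a : int) (t : Y a G) : listed y t -> in_span (@listed k U (cone f) G _ degC c a) (cone_in f a G t).
  by case=> {a t} j; apply: in_span_gen; exact: (@Listed k U (cone f) G _ degC c (inr j)).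
exists (I + J)%type, degC, c => n; elim/int_succ: n => n [u v] dz.
move/(congr1 fst): (dz) => /= /oppr_eq0P du; move/(congr1 snd): dz => /= dv.
have [u1 su1 /bdryP[w eu]] := sx _ u du.
have fu : f (n + 1 + 1) G u1 = cplx_d Y (n + 1) G (- (v + f (n + 1) G w)).
  by rewrite linearN linearD -cmap_appE -eu (linearB (f (n + 1 + 1) G)); apply: (eq_by_sub dv); zmod.
pose v1 := v + f (n + 1) G w + h (n + 1) (f (n + 1 + 1) G u1).
have dv1 : cplx_d Y (n + 1) G v1 = 0.
  by rewrite /v1 linearD fu hP -linearD subrr linear0.
have [v2 sv2 bv] := sy _ v1 dv1.
exists (H (n + 1) u1 + cone_in f (n + 1) G v2).
  apply: in_spanD; first exact: in_span_map (cl _) _ su1.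
  exact: in_span_map (cr _) _ sv2.
have -> : (u, v) - (H (n + 1) u1 + cone_in f (n + 1) G v2) =
    cplx_d (cone f) n G (- w, 0) + cone_in f (n + 1) G (v1 - v2).
  apply: pairP => /=; first by rewrite linearN -eu; zmod.
  by rewrite linearN linear0 /v1 /=; zmod.
by apply: bdryD; [apply: Bdry|apply: bdry_cmap].
Qed.

Lemma cone_acyclic2 X Y (f : cmap X Y) G :
  acyclic_at X G -> acyclic_at Y G -> acyclic_at (cone f) G.
Proof.
move=> /acyclicP aX /acyclicP aY; apply/cone_acyclic => n; split=> [x dx _|y dy].
  exact: aX.
by exists 0; [rewrite linear0|rewrite linear0 subr0; apply: aY].
Qed.

Section Covering.
Context (I0 : finType) (rep : I0 -> gobj U).
Implicit Types l : seq I0.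

Definition covered l K := has (fun i => `[< gobj_iso (rep i) K >]) l.

Definition below l K := all (fun i => #|K| <= #|rep i|)%N l.

Definition order_le i j := (#|rep i| <= #|rep j|)%N.

(* This holds for the final segments of a list of representatives of all classes,
   sorted by order. *)
Definition upward l := sorted order_le l /\ forall K, covered l K \/ below l K.

Lemma covered_cons i l K : covered (i :: l) K <-> gobj_iso (rep i) K \/ covered l K.
Proof.
by rewrite /covered /=; split=> [/orP[/asboolP|]|[/asboolP ->|->]]; rewrite ?orbT; auto.
Qed.

Lemma gobj_iso_card G K : gobj_iso G K -> #|K| = #|G|.
Proof. by move=> /gobj_isoP[]. Qed.

(** A group covered only by the dropped representative has its order, which is at most that of all
    the remaining ones. *)
Lemma upward_cons i l : upward (i :: l) -> upward l.
Proof.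
move=> [sl ul]; split; first exact: path_sorted sl.
have Gl : all (order_le i) l.
  by apply: order_path_min sl => x y z; apply: leq_trans.
move=> K; case: (ul K) => [/covered_cons[/gobj_iso_card KG|]|]; [|by left|].
  by right; rewrite /below KG.
by move=> /andP[_]; right.
Qed.

Lemma upward_sort l : (forall K, covered l K) ->
  upward (sort order_le l) /\ forall K, covered (sort order_le l) K.
Proof.
move=> cl; have cs K : covered (sort order_le l) K.
  have /hasP[i il iK] := cl K; apply/hasP; exists i; rewrite ?mem_sort //.
split=> //; split; last by left.
by apply: sort_sorted => x y; apply: leq_total.
Qed.
End Covering.

Lemma upward_exists : essentially_finite U ->
  exists n (rep : 'I_n -> gobj U) l, upward rep l /\ forall K, covered rep l K.
Proof.
move=> [n [f fsurj]].
have [r rP] : exists r : 'I_n -> gobj U, forall i, sval (f i) = gobj_iso (r i).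
  by exists (fun i => sval (cid (svalP (f i)))) => i; case: cid.
exists n, r, (sort (order_le r) (enum 'I_n)); apply: upward_sort => K.
have [i fi] := fsurj (iso_class K); apply/hasP; exists i; rewrite ?mem_enum //=.
by apply/asboolP; rewrite -rP fi; apply: gobj_iso_refl.
Qed.

Hypothesis char0 : [pchar k] =i pred0.

(** The cone of the counit at the first group [G] of the list is acyclic at [G]. A group [K] not
    covered by the rest of the list has order at most that of [G], so unless it is isomorphic to [G]
    it has no surjection onto [G]: the free complex vanishes at [K] and acyclicity of [X] there
    persists. Hence the list can be shortened, and a resolution of the cone is twisted into one of
    [X]. *)
Lemma resolution (I0 : finType) (rep : I0 -> gobj U) l X :
  upward rep l -> (forall G, fdcoh X G) -> (forall K, acyclic_at X K \/ covered rep l K) ->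
  exists (P : cplx k U) (p : cmap P X), [/\ qis p, kproj P & ffin P].
Proof.
elim: l X => [|i0 l IH] X ul fX cX.
  exists (cplx_zero k U), (cmap_zero _ _); split.
  - apply/qisP => G n; split=> [x _ _|y dy].
      by rewrite (_ : x = 0); [apply: bdry0|apply/rowP => -[]].
    by exists 0 => //; rewrite subr0; have [/acyclicP aX|//] := cX G; apply: aX.
  - move=> N _ f; exists (fun n => nt_zero _ _) => n G x.
    rewrite hbd_zero; have -> : x = 0 by apply/rowP => -[].
    exact: (linear0 (f (n + 1) G)).
  move=> I Y f; exists (fun n => nt_zero _ _), [::] => n G x i _.
  have -> : x = 0 by apply/rowP => -[].
  rewrite hbd_zero subr0; have -> : f (n + 1) G 0 = 0 by apply: (linear0 (f (n + 1) G)).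
  by [].
pose G := rep i0; pose f := free_counit G X.
have [I [deg [x sx]]] := fX G.
have [||K|P [phi [qphi Pp Pf]]] := IH (cone f).
- exact: upward_cons ul.
- by move=> K; apply: cone_fdcoh => //; apply: (free_fdcoh char0 sx).
- have [GK|nGK] := pselect (gobj_iso G K); first by left; apply: cone_free_iso.
  have [aX|/covered_cons[//|]] := cX K; last by right.
  have [cK|bK] := ul.2 K; first by right; move/covered_cons: cK => [].
  left; apply: cone_acyclic2 aX => n z _; exists 0; rewrite linear0.
  apply: free_zero => p; apply: nGK; apply/gobj_isoP; exists p.
  by apply/eqP; rewrite eqn_leq (epi_leq p) andbT; case/andP: bK.
exists (twist phi), (twist_map phi); split; first exact: twist_qis.
  by apply: twist_kproj => //; apply: free_kproj.
by apply: twist_ffin => //; apply: (free_ffin char0 sx).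
Qed.

Lemma fdcoh_compact X : essentially_finite U -> (forall G, fdcoh X G) -> compact X.
Proof.
move=> /upward_exists[n [rep [l [ul cl]]]] fX.
have [|P [p [qp Pp Pf]]] := resolution ul fX; first by right.
exact: compact_res qp Pp Pf.
Qed.
End Resolution.

(** * Compact objects have finite-dimensional cohomology *)

Section CohomologyRelation.
Context (k : fieldType) (U : finGroupType -> Prop).
Implicit Types (X Y Z A : cplx k U) (G H K : gobj U).

Lemma bdry_csum X Y n G (z : csum X Y n G) : bdry z -> bdry z.1 /\ bdry z.2.
Proof.
move=> bz; split; first exact: (bdry_cmap (cmap_fst X Y) bz).
exact: (bdry_cmap (cmap_snd X Y) bz).
Qed.

Lemma bdry_sym X n G (x y : X n G) : bdry (x - y) -> bdry (y - x).
Proof. by move=> /bdryN; rewrite opprB. Qed.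

Lemma bdry_trans X n G (y x z : X n G) : bdry (x - y) -> bdry (y - z) -> bdry (x - z).
Proof.
move=> b1 b2; have -> : x - z = (x - y) + (y - z) by zmod.
exact: bdryD.
Qed.

(* For cocycles x and y: f maps the class of x to the class of y. *)
Fixpoint Hrel G n X Y (f : dhom X Y) : X n G -> Y n G -> Prop :=
  match f in dhom X Y return X n G -> Y n G -> Prop with
  | Dmap _ _ f => fun x y => bdry (y - f n G x)
  | Dinv X Y s _ => fun y x => bdry (y - s n G x)
  | Dcomp _ Y _ g f => fun x z => exists y : Y n G,
      [/\ cplx_d Y n G y = 0, Hrel f x y & Hrel g y z]
  end.

Lemma Hrel_bdry G n X Y (f : dhom X Y) (x x' : X n G) (y y' : Y n G) :
  bdry (x' - x) -> bdry (y' - y) -> Hrel f x y -> Hrel f x' y'.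
Proof.
elim: f x x' y y' => {X Y} [X Y f|X Y s qs|X Y Z g IHg f IHf] x x' y y' /= bx by_ H.
- apply: bdry_trans by_ (bdry_trans H _); rewrite -linearB.
  exact/bdry_cmap/bdry_sym.
- apply: bdry_trans bx (bdry_trans H _); rewrite -linearB.
  exact/bdry_cmap/bdry_sym.
have [z [dz Hf Hg]] := H; exists z; split=> //.
  by apply: IHf Hf => //; rewrite subrr; apply: bdry0.
by apply: IHg Hg => //; rewrite subrr; apply: bdry0.
Qed.

Lemma Hrel_fun G n X Y (f : dhom X Y) (x : X n G) (y : Y n G) :
  cplx_d Y n G y = 0 -> bdry x -> Hrel f x y -> bdry y.
Proof.
elim: f x y => {X Y} [X Y f|X Y s qs|X Y Z g IHg f IHf] x y /= dy bx H.
- by rewrite -[y](subrK (f n G x)); apply/bdryD => //; apply: bdry_cmap.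
- have /qisP/(_ G n)[inj _] := qs; apply: inj => //.
  have -> : s n G y = x - (x - s n G y) by rewrite subKr.
  exact: bdryB.
by have [z [dz Hf Hg]] := H; apply: IHg Hg => //; apply: IHf Hf.
Qed.

(** This turns equalities in the derived category, known only through generating rules, into
    statements about classes. The cocycle hypotheses supply the intermediate cocycles that [Hrel] of
    a composite asks for. *)
Lemma Hrel_deq G n X Y (f g : dhom X Y) : deq f g ->
  forall (x : X n G) (y : Y n G), cplx_d X n G x = 0 -> cplx_d Y n G y = 0 ->
  (Hrel f x y <-> Hrel g x y).
Proof.
elim=> {X Y f g}.
- by [].
- by move=> X Y f g _ IH x y dx dy; rewrite IH.
- by move=> X Y f g h _ IH1 _ IH2 x y dx dy; rewrite IH1 // IH2.
- move=> X Y Z g g' f f' _ IHg _ IHf x z dx dz /=.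
  by split=> -[y [dy Hf Hg]]; exists y; split=> //; try exact/IHf; exact/IHg.
- move=> X Y Z T h g f x z dx dz /=; split=> [[y [dy [w [dw Hf Hg] Hh]]]|].
    by exists w; split=> //; exists y.
  by move=> [w [dw Hf [y [dy Hg Hh]]]]; exists y; split=> //; exists w.
- move=> X Y f x y dx dy /=; split=> [[z [dz Hf byz]]|Hf].
    by apply: Hrel_bdry Hf => //; rewrite subrr; apply: bdry0.
  by exists y; split=> //; rewrite subrr; apply: bdry0.
- move=> X Y f x y dx dy /=; split=> [[z [dz Hf byz]]|Hf].
    apply: (Hrel_bdry (x := z) (y := y)) => //; first exact: bdry_sym.
    by rewrite subrr; apply: bdry0.
  by exists x; split=> //; rewrite subrr; apply: bdry0.
- by move=> X Y f g fg x y dx dy /=; rewrite fg.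
- move=> X Y Z g f x z dx dz /=; split=> [b|[y [dy byx bzy]]].
    exists (f n G x); split=> //; last by rewrite subrr; apply: bdry0.
    by elim/int_succ: n x z dx dz b => n x z dx dz b; rewrite -cmap_appE dx linear0.
  by apply: bdry_trans bzy _; rewrite -linearB; apply: bdry_cmap.
- move=> X Y s qs x x' dx dx' /=; split=> [[y [dy byx byx']]|bx].
    have /qisP/(_ G n)[inj _] := qs; apply: inj; first by rewrite linearB dx dx' subrr.
    by rewrite linearB; apply: bdry_trans (bdry_sym byx') byx.
  exists (s n G x); split; first by rewrite -cmap_appE dx linear0.
    by rewrite subrr; apply: bdry0.
  by rewrite -linearB; apply/bdry_cmap/bdry_sym.
move=> X Y s qs y y' dy dy' /=; split=> [[x [dx byx by'x]]|byy'].
  exact: bdry_trans by'x (bdry_sym byx).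
have /qisP/(_ G n)[_ /(_ y dy)[x dx byx]] := qs.
by exists x; split=> //; apply: bdry_trans byx.
Qed.

Lemma retract_acyclic X Y G : Dretract X Y -> acyclic_at Y G -> acyclic_at X G.
Proof.
move=> [i [r ri]] /acyclicP aY; apply/acyclicP => n x dx.
have /(Hrel_deq ri) : Hrel (Did X) x x by rewrite /= subrr; apply: bdry0.
move=> /(_ dx dx)[y [dy Hi Hr]]; apply: Hrel_fun Hr => //; exact: aY.
Qed.

Lemma Diso_acyclic X Y (f : dhom X Y) G : Diso f -> acyclic_at X G <-> acyclic_at Y G.
Proof.
by move=> [g [gf fg]]; split; apply: retract_acyclic; [exists g, f|exists f, g].
Qed.

Lemma Hrel_Dsumr G n A X Y (f : dhom X Y) (u : csum X A n G) (v : csum Y A n G) :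
  Hrel (Dsumr A f) u v -> Hrel f u.1 v.1 /\ bdry (v.2 - u.2).
Proof.
elim: f u v => {X Y} [X Y f|X Y s qs|X Y Z g IHg f IHf] u v /=.
- by move/bdry_csum.
- by move=> /bdry_csum /= [? /bdry_sym].
move=> [w [/(congr1 fst) /= dw /IHf[Hf b1] /IHg[Hg b2]]].
by split; [exists w.1|apply: bdry_trans b2 b1].
Qed.

Lemma Hrel_Dsuml G n A X Y (f : dhom X Y) (u : csum A X n G) (v : csum A Y n G) :
  Hrel (Dsuml A f) u v -> bdry (v.1 - u.1) /\ Hrel f u.2 v.2.
Proof.
elim: f u v => {X Y} [X Y f|X Y s qs|X Y Z g IHg f IHf] u v /=.
- by move/bdry_csum.
- by move=> /bdry_csum /= [/bdry_sym ? ?].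
move=> [w [/(congr1 snd) /= dw /IHf[b1 Hf] /IHg[b2 Hg]]].
by split; [apply: bdry_trans b2 b1|exists w.2].
Qed.

Lemma Hrel_Dadd G n X Y (f g : dhom X Y) (x : X n G) (y : Y n G) :
  Hrel (Dadd f g) x y -> exists y1 y2,
    [/\ Hrel f x y1, Hrel g x y2 & bdry (y - (y1 + y2))].
Proof.
move=> /= [a [da [b [db [c [dc /bdry_csum[/= c1 c2]]]]]]].
move=> /Hrel_Dsumr[Hf b2] /Hrel_Dsuml[a1 Hg] bya.
exists b.1, a.2; split.
- by apply: Hrel_bdry Hf; [apply: bdry_sym|rewrite subrr; apply: bdry0].
- apply: Hrel_bdry Hg; last by rewrite subrr; apply: bdry0.
  exact: bdry_sym (bdry_trans b2 c2).
apply: bdry_trans bya _.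
by have -> : a.1 + a.2 - (b.1 + a.2) = a.1 - b.1 by zmod.
Qed.

Lemma Hrel_Dcomb G n X (I : Type) (Y : I -> cplx k U) (f : forall i, dhom X (Y i))
    (s : seq {classic I}) (x : X n G) (y : cdsum Y n G) i :
  Hrel (Dcomb f s) x y -> (i : {classic I}) \notin s -> bdry (y i).
Proof.
have pr (z : cdsum Y n G) : bdry z -> bdry (z i : Y i n G) by apply: (bdry_cmap (cdsum_pr Y i)).
elim: s y => [|j s IH] y.
  by rewrite /= subr0 => /pr.
move=> /Hrel_Dadd[y1 [y2 [/= [z [dz _ b1]] H2 b]]].
rewrite inE negb_or => /andP[/eqP ij is_].
have {}b : bdry (y i - (y1 i + y2 i)) := pr _ b.
rewrite -[y i](subrK (y1 i + y2 i)); apply: bdryD => //; apply: bdryD; last exact: IH.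
have : bdry (y1 i - dsum_in_fun (M := fun i => Y i n G) z i) := pr _ b1.
rewrite dsum_in_neq ?subr0 //.
by move=> ji; apply: ij.
Qed.
End CohomologyRelation.

(** * Subspaces as vector spaces *)

Record subspace (k : fieldType) (V : lmodType k) := Subspace {
  in_subspace :> V -> Prop;
  subspace0 : in_subspace 0;
  subspaceP : forall a x y, in_subspace x -> in_subspace y -> in_subspace (a *: x + y) }.

Section SubspaceModule.
Context (k : fieldType) (V : lmodType k) (W : subspace V).

Definition subspace_pred : {pred V} := fun x => `[< W x >].

Lemma subspace_closed : submod_closed subspace_pred.
Proof.
split=> [|a x y /asboolP Wx /asboolP Wy]; first exact/asboolP/subspace0.
exact/asboolP/subspaceP.
Qed.

HB.instance Definition _ := GRing.isSubmodClosed.Build k V subspace_pred subspace_closed.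

Record lsub := LSub { lsub_val : V; lsub_in : lsub_val \in subspace_pred }.

HB.instance Definition _ := [isSub for lsub_val].
HB.instance Definition _ := [Choice of lsub by <:].
HB.instance Definition _ := [SubChoice_isSubLmodule of lsub by <:].

Definition lsub_mod : lmodType k := lsub.

Definition lval : {linear lsub_mod -> V} := val.

Lemma lvalP (x : lsub_mod) : W (lval x).
Proof. exact/asboolP/lsub_in. Qed.

Lemma lval_inj : injective lval.
Proof. exact: val_inj. Qed.

Section Corestriction.
Context (T : lmodType k) (f : {linear T -> V}) (fW : forall x, W (f x)).

Definition lcor_fun (x : T) : lsub_mod := LSub (asboolT (fW x) : f x \in subspace_pred).

Lemma lcor_linear : linear lcor_fun.
Proof. by move=> a x y; apply: lval_inj; rewrite !linearP /= linearP. Qed.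

Definition lcor : {linear T -> lsub_mod} := mklin lcor_linear.

Lemma lcorE x : lval (lcor x) = f x. Proof. by []. Qed.
End Corestriction.
End SubspaceModule.

(** * Right Kan extensions and the dimension bound for compact objects *)

Section ClassFunctions.
Context (k : fieldType) (U : finGroupType -> Prop) (G : gobj U).
Implicit Types (X Y Z : cplx k U) (H K : gobj U).

Program Definition class_fun K : subspace {ffun epi G K -> k^o} :=
  @Subspace k _ (fun f => forall p q, epi_conj p q -> f p = f q) _ _.
Next Obligation. by move=> K p q _; rewrite !ffunE. Qed.
Next Obligation. by move=> K a f g Hf Hg p q pq; rewrite !ffunE (Hf p q) // (Hg p q). Qed.

Lemma precomp_linear H K (a : epi H K) :
  linear (fun f : {ffun epi G K -> k^o} => [ffun p : epi G H => f (epi_comp a p)]).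
Proof. by move=> c f g; apply/ffunP => p; rewrite !ffunE. Qed.

Lemma precomp_class H K (a : epi H K) (f : lsub_mod (class_fun K)) :
  class_fun H ((mklin (precomp_linear a) \o lval (class_fun K)) f).
Proof.
move=> p q [y pq]; rewrite /= !ffunE; apply: (lvalP f); exists (a y) => x /=.
by rewrite pq epiJ.
Qed.

(* The right Kan extension of k from G. *)
Program Definition coind_psh : psh k U := @Psh k U (fun K => lsub_mod (class_fun K))
  (fun K H a => lcor (precomp_class a)) _ _ _.
Next Obligation.
move=> K H a b [y ab] f; apply/lval_inj/ffunP => p /=; rewrite !ffunE.
by apply: (lvalP f); exists y => x /=.
Qed.
Next Obligation.
by move=> K f; apply/lval_inj/ffunP => p /=; rewrite !ffunE epi_comp_idl.
Qed.
Next Obligation.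
by move=> K H L a b f; apply/lval_inj/ffunP => p /=; rewrite !ffunE epi_compA.
Qed.

(** One copy in every degree with zero differential, so that a single map tests the cohomology in
    all degrees at once. *)
Program Definition coind_cplx : cplx k U :=
  @Cplx k U (fun=> coind_psh) (fun=> nt_zero _ _) _.
Next Obligation. by []. Qed.

Section Coefficients.
Context (X : cplx k U) (I : Type).
Context (c : forall n : int, {linear X n G -> dsum (fun _ : I => k^o)}).
Hypothesis c_d : forall n x, c (n + 1) (cplx_d X n G x) = 0.

Definition coef_fun n K (x : X n K) (i : I) : {ffun epi G K -> k^o} :=
  [ffun p => c n (psh_res (X n) p x) i].

Lemma coef_class n K (x : X n K) i : class_fun K (coef_fun x i).
Proof. by move=> p q pq; rewrite !ffunE (psh_res_conj pq). Qed.

Definition coef n K (x : X n K) i : coind_psh K :=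
  LSub (asboolT (coef_class x i) : coef_fun x i \in subspace_pred (class_fun K)).

(** There are finitely many surjections from [G] to [K], and each contributes finitely many
    coordinates; hence the map lands in the direct sum and not only in the product. *)
Lemma coef_fin n K (x : X n K) : fin_supp (coef x).
Proof.
exists (flatten [seq dsum_support (c n (psh_res (X n) p x)) | p <- enum {: epi G K}]).
move=> i; apply: contra_notT => nis; apply/lval_inj/ffunP => p; rewrite !ffunE.
apply: contrapT => ci; move/negP: nis; apply; apply/flatten_mapP; exists p.
  by rewrite mem_enum.
exact: dsum_supportP ci.
Qed.

Lemma coef_linear n K : linear (fun x : X n K => Dsum (coef_fin x)).
Proof.
move=> a x y; apply: dsumP => i; apply/lval_inj/ffunP => p.
by rewrite /= !ffunE !linearP.
Qed.

Program Definition coef_map : cmap X (cdsum (fun _ : I => coind_cplx)) :=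
  @CMap k U X (cdsum (fun _ : I => coind_cplx))
   (fun n => @NatTrans k U (X n) (psh_dsum (fun _ : I => coind_psh))
     (fun K => mklin (@coef_linear n K)) _) _.
Next Obligation.
move=> n K H a x; apply: dsumP => i; apply/lval_inj/ffunP => p.
by rewrite /= !ffunE psh_res_comp'.
Qed.
Next Obligation.
move=> n K x; apply: dsumP => i; apply/lval_inj/ffunP => p.
by rewrite /= !ffunE -nat_appE c_d.
Qed.

Lemma coef_mapE n (x : X n G) i : lval _ (coef_map n G x i) (epi_id G) = c n x i.
Proof. by rewrite /= ffunE psh_res_id. Qed.
End Coefficients.

Lemma bdry_coind K n (z : coind_cplx n K) : bdry z -> z = 0.
Proof. by case=> {n z}. Qed.

Lemma compact_fdcoh X : compact X -> fdcoh X G.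
Proof.
(* A map of complexes needs coordinates on all cochains, so the basis is taken in the cochains
   modulo boundaries of all degrees; the total cohomology is a subspace of this. *)
pose W := dsum (fun n : int => lquot (@bdry k U X G n)).
have [I [f [g [fK gK]]]] := basis_iso W.
pose inW n : {linear lquot (@bdry k U X G n) -> W} :=
  dsum_in (fun n : int => lquot (@bdry k U X G n)) n.
pose c n : {linear X n G -> dsum (fun _ : I => k^o)} := g \o (inW n \o lpi (@bdry k U X G n)).
have cE n x : c n x = g (inW n (lpi (@bdry k U X G n) x)) by [].
have cd n x : c (n + 1) (cplx_d X n G x) = 0.
  rewrite cE; have -> : lpi (@bdry k U X G (n + 1)) (cplx_d X n G x) = 0.
    rewrite -(linear0 (lpi _)); apply/lpi_eq; rewrite subr0; apply: in_span_gen; exact: Bdry.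
  by rewrite !linear0.
pose F := coef_map cd.
move=> /(_ _ (fun _ : I => coind_cplx))[/(_ (Dmap F))[s [h [us Fh]]] _].
have c0 n x i : cplx_d X n G x = 0 -> (i : {classic I}) \notin s -> c n x i = 0.
  move=> dx is_; rewrite -coef_mapE.
  have dF : cplx_d (cdsum (fun _ : I => coind_cplx)) n G (F n G x) = 0.
    by rewrite -cmap_appE dx linear0.
  have HF : Hrel (Dmap F) x (F n G x) by rewrite /= subrr; apply: bdry0.
  (* With zero differential, a coordinate that vanishes in cohomology vanishes. So only the
     coordinates in [s] can be nonzero on cocycles, and these embed the cohomology in a space of
     rows of length [size s]. *)
  have E := bdry_coind (Hrel_Dcomb ((Hrel_deq Fh dx dF).1 HF) is_).
  by rewrite -/F E linear0 ffunE.
pose v n (x : X n G) : 'rV[k]_(size s) := \row_j c n x (tnth (in_tuple s) j).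
pose S w := exists n (x : X n G), cplx_d X n G x = 0 /\ w = v n x.
have [m [Fv [FS spF]]] := finite_span_rV S.
have [deg [x xP]] : exists (deg : 'I_m -> int) (x : forall i, X (deg i) G),
    forall i, cplx_d X (deg i) G (x i) = 0 /\ Fv i = v (deg i) (x i).
  exists (fun i => sval (cid (FS i))), (fun i => sval (cid (svalP (cid (FS i))))) => i.
  exact: (svalP (cid (svalP (cid (FS i))))).
exists 'I_m, deg, x => n z dz.
have [a va] := spF (v n z) (ex_intro _ n (ex_intro _ z (conj dz erefl))).
have ca : c n z = \sum_i a i *: c (deg i) (x i).
  apply: dsumP => b; rewrite dsum_sumE.
  have [bs|bs] := boolP ((b : {classic I}) \in s); last first.
    rewrite c0 // big1 // => i _; rewrite dsumZE c0 ?scaler0 //; exact: (xP i).1.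
  have ib : (index (b : {classic I}) s < size s)%N by rewrite index_mem.
  have tb : tnth (in_tuple s) (Ordinal ib) = b by rewrite (tnth_nth b); exact: (@nth_index {classic I} b b s bs).
  have := congr1 (fun w : 'rV_(size s) => w 0 (Ordinal ib)) va.
  rewrite mxE tb summxE => ->; apply: eq_bigr => i _.
  by rewrite (xP i).2 !mxE tb.
have {}ca : inW n (lpi (@bdry k U X G n) z) =
    \sum_i a i *: inW (deg i) (lpi (@bdry k U X G (deg i)) (x i)).
  apply: (can_inj gK); rewrite -cE ca linear_sum; apply: eq_bigr => i _.
  by rewrite linearZ.
(* The element [x i] regarded in degree [n], or zero if its degree is another one: the component in
   degree [n] of an equation between elements of mixed degrees. *)
pose y i := dsum_in_fun (M := fun n => X n G) (x i) n.
have yE i : dsum_in_fun (M := fun n : int => lquot (@bdry k U X G n))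
    (lpi (@bdry k U X G (deg i)) (x i)) n = lpi (@bdry k U X G n) (y i).
  rewrite /y; have [e|ne] := pselect (deg i = n).
    by move: (deg i) (x i) e => d xi e; subst d; rewrite !dsum_in_id.
  by rewrite !dsum_in_neq // linear0.
exists (\sum_i a i *: y i).
  apply: in_span_sum => i _; apply: in_spanZ; rewrite /y.
  have [e|ne] := pselect (deg i = n); last by rewrite dsum_in_neq //; apply: in_span0.
  by subst n; rewrite dsum_in_id; apply: in_span_gen; exact: (@Listed k U X G _ deg x).
apply/bdry_span/lpi_eq; rewrite linear_sum.
have := congr1 (fun w : W => w n) ca.
rewrite dsum_sumE /= dsum_in_id => ->; apply: eq_bigr => i _.
by rewrite [RHS]lpiZ -yE.
Qed.
End ClassFunctions.

(** * Tensor products *)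

Section TensorCohomology.
Context (k : fieldType) (U : finGroupType -> Prop).
Implicit Types (X Y Z : cplx k U) (G H K : gobj U).

(* The identity if m = n, and 0 otherwise. *)
Definition degcast X (m n : int) : nat_trans (X m) (X n) :=
  if pselect (m = n) is left e
  then match e in _ = n return nat_trans (X m) (X n) with erefl => nt_id (X m) end
  else nt_zero _ _.

Lemma degcast_id X n G (x : X n G) : degcast X n n G x = x.
Proof. by rewrite /degcast; case: pselect => // e; rewrite (eq_axiomK e). Qed.

Lemma degcast_neq X m n G (x : X m G) : m <> n -> degcast X m n G x = 0.
Proof. by rewrite /degcast; case: pselect. Qed.

Lemma degcast_d X m n G (x : X m G) :
  degcast X (m + 1) (n + 1) G (cplx_d X m G x) = cplx_d X n G (degcast X m n G x).
Proof.
have [<-|mn] := pselect (m = n); first by rewrite !degcast_id.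
by rewrite !degcast_neq ?linear0 // => /addIr.
Qed.

Lemma degcast_bdry X m n G (x : X m G) : bdry x -> bdry (degcast X m n G x).
Proof.
move=> bx; have [<-|mn] := pselect (m = n); first by rewrite degcast_id.
by rewrite degcast_neq //; apply: bdry0.
Qed.

Lemma tens_dE X Y n G i j (e : i + j == n) (x : X i G) (y : Y j G) :
  cplx_d (tens X Y) n G (tens_in e x y) =
  tens_in (bidegreel e) (cplx_d X i G x) y +
  (-1) ^+ absz i *: tens_in (bidegreer e) x (cplx_d Y j G y).
Proof. exact: tens_d_modE. Qed.

(** The projection to the quotient by this span vanishes on all pure tensors, hence everywhere by
    [tens_ext]. *)
Lemma tens_span X Y n G (z : tens X Y n G) :
  in_span (fun t : tens X Y n G => exists i j (e : i + j == n) x y, t = tens_in e x y) z.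
Proof.
set R := fun t => _.
have [s sK] := @lquot_section k (tens X Y n G) R.
have : lpi R =1 \0 :> (tens X Y n G -> lquot R).
  apply: (@tens_ext k U X Y n G (lquot R) (lpi R) \0) => i j e x y.
  rewrite -[RHS](linear0 (lpi R)); apply/lpi_eq; rewrite subr0; apply: in_span_gen.
  by exists i, j, e, x, y.
by move=> /(_ z); rewrite -[RHS](linear0 (lpi R)) => /lpi_eq; rewrite subr0.
Qed.

Section Bifunctional.
Context (X Y : cplx k U) (G : gobj U) (n m : int).
Context (f : {linear X n G -> k^o}) (g : {linear Y m G -> k^o}).

Let bi i j q (e : i + j == q) (x : X i G) (y : Y j G) : k^o :=
  f (degcast X i n G x) * g (degcast Y j m G y).

Let bi_l i j q (e : i + j == q) y : linear (fun x => bi e x y).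
Proof.
move=> a x x'; rewrite /bi !linearP.
by rewrite -[_ *: _ in RHS]/(_ * _) mulrDl -mulrA.
Qed.

Let bi_r i j q (e : i + j == q) x : linear (bi e x).
Proof.
move=> a y y'; rewrite /bi !linearP.
by rewrite -[_ *: _ in RHS]/(_ * _) mulrDr mulrCA.
Qed.

Definition bifunctional q : {linear tens X Y q G -> k^o} :=
  tens_lift (fun i j e => @bi_l i j q e) (fun i j e => @bi_r i j q e).

Lemma bifunctionalE q i j (e : i + j == q) x y :
  bifunctional q (tens_in e x y) = f (degcast X i n G x) * g (degcast Y j m G y).
Proof. exact: tens_liftE. Qed.

Hypothesis f_bdry : forall x, bdry x -> f x = 0.
Hypothesis g_bdry : forall y, bdry y -> g y = 0.

Lemma bifunctional_bdry q (z : tens X Y q G) : bdry z -> bifunctional q z = 0.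
Proof.
case=> {q z} q w.
pose F : {linear tens X Y q G -> k^o} := bifunctional (q + 1) \o cplx_d (tens X Y) q G.
suff F0 : F =1 \0 by apply: F0.
apply: tens_ext => i j e x y; rewrite -[LHS]/(bifunctional (q + 1) _) tens_dE.
have fd : f (degcast X (i + 1) n G (cplx_d X i G x)) = 0 by apply/f_bdry/degcast_bdry/Bdry.
have gd : g (degcast Y (j + 1) m G (cplx_d Y j G y)) = 0 by apply/g_bdry/degcast_bdry/Bdry.
rewrite linearD linearZ !bifunctionalE fd gd mul0r mulr0 add0r.
exact: mulr0.
Qed.
End Bifunctional.

Lemma not_acyclic X G : ~ acyclic_at X G ->
  exists n (x : X n G) (f : {linear X n G -> k^o}),
    [/\ cplx_d X n G x = 0, f x = 1 & forall y, bdry y -> f y = 0].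
Proof.
move=> naX; apply: contrapT => H; apply/naX/acyclicP => n x dx.
apply: contrapT => nbx; apply: H.
have [|f [fx fb]] := @functional k (X n G) (@bdry k U X G n) x.
  by move/bdry_span.
by exists n, x, f; split.
Qed.

(** If both are not acyclic, there are cocycles [x] and [y] and functionals [f] and [g] that kill
    boundaries and take the value 1 on them. The functional $f \otimes g$ kills boundaries too and
    takes the value 1 on the cocycle $x \otimes y$. *)
Lemma tens_acyclic X Y G : acyclic_at (tens X Y) G ->
  acyclic_at X G \/ acyclic_at Y G.
Proof.
move=> /acyclicP aXY; apply: contrapT => /not_orP[].
move=> /not_acyclic[n [x [f [dx fx fb]]]] /not_acyclic[m [y [g [dy gy gb]]]].
have dxy : cplx_d (tens X Y) (n + m) G (tens_in (eqxx _) x y) = 0.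
  by rewrite tens_dE dx dy tens_in0l tens_in0r scaler0 addr0.
have := bifunctional_bdry fb gb (aXY _ _ dxy).
rewrite bifunctionalE !degcast_id fx gy mulr1 => /eqP.
by rewrite oner_eq0.
Qed.

Lemma tens_pow_acyclic X G m : (0 < m)%N -> acyclic_at (tens_pow X m) G -> acyclic_at X G.
Proof.
case: m => // m _; elim: m => [//|m IH] /tens_acyclic[|//].
exact: IH.
Qed.

Section Homotopies.
Context (X Y : cplx k U) (G : gobj U).

Lemma pred_bidegreel (i j m : int) : i + j == m + 1 -> i - 1 + j == m.
Proof. by rewrite addrAC subr_eq. Qed.
Lemma pred_bidegreer (i j m : int) : i + j == m + 1 -> i + (j - 1) == m.
Proof. by rewrite addrA subr_eq. Qed.
Lemma succ_bidegreel (i j m : int) : i + 1 + j == m + 1 -> i + j == m.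
Proof. by rewrite addrAC (inj_eq (addIr _)). Qed.
Lemma succ_bidegreer (i j m : int) : i + (j + 1) == m + 1 -> i + j == m.
Proof. by rewrite addrA (inj_eq (addIr _)). Qed.

Section Left.
Context (h : forall n : int, {linear X (n + 1) G -> X n G}).

(** The operator $h \otimes 1$. As [h] starts in degrees of the form [i + 1], [degcast] presents [i]
    as [i - 1 + 1]. *)
Let hl m i j (e : i + j == m + 1) (x : X i G) (y : Y j G) : tens X Y m G :=
  tens_in (pred_bidegreel e) (h (i - 1) (degcast X i (i - 1 + 1) G x)) y.
Let hl_l m i j (e : i + j == m + 1) y : linear (fun x => hl e x y).
Proof. by move=> a x x'; rewrite /hl !linearP tens_in_linearl. Qed.
Let hl_r m i j (e : i + j == m + 1) x : linear (hl e x).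
Proof. by move=> a y y'; rewrite /hl tens_in_linearr. Qed.

Definition htens_l m : {linear tens X Y (m + 1) G -> tens X Y m G} :=
  tens_lift (fun i j e => @hl_l m i j e) (fun i j e => @hl_r m i j e).

Lemma htens_lE m i j (e : i + 1 + j == m + 1) x y :
  htens_l m (tens_in e x y) = tens_in (succ_bidegreel e) (h i x) y.
Proof.
rewrite [LHS]tens_liftE /hl; move: (pred_bidegreel e); move: (i + 1 - 1) (addrK 1 i) => a ai.
by subst a => e'; rewrite degcast_id; congr tens_in; apply: bool_irrelevance.
Qed.

Lemma htens_l_hbd m i j (e : i + 1 + j == m + 1) x y :
  cplx_d (tens X Y) m G (htens_l m (tens_in e x y)) +
  htens_l (m + 1) (cplx_d (tens X Y) (m + 1) G (tens_in e x y)) =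
  tens_in e (cplx_d X i G (h i x) + h (i + 1) (cplx_d X (i + 1) G x)) y.
Proof.
rewrite htens_lE !tens_dE linearD linearZ_LR !htens_lE sign_succ.
have -> : tens_in e (cplx_d X i G (h i x) + h (i + 1) (cplx_d X (i + 1) G x)) y =
    tens_in e (cplx_d X i G (h i x)) y + tens_in e (h (i + 1) (cplx_d X (i + 1) G x)) y.
  by have := tens_in_linearl e y 1 (cplx_d X i G (h i x)) (h (i + 1) (cplx_d X (i + 1) G x));
    rewrite !scale1r.
rewrite (bool_irrelevance (bidegreel (succ_bidegreel e)) e).
rewrite (bool_irrelevance (succ_bidegreel (bidegreel e)) e).
rewrite (bool_irrelevance (succ_bidegreel (bidegreer e)) (bidegreer (succ_bidegreel e))).
by rewrite scaleNr; zmod.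
Qed.
End Left.

Section Right.
Context (h : forall n : int, {linear Y (n + 1) G -> Y n G}).

(** The operator $1 \otimes h$, with the Koszul sign for moving [h], of degree $-1$, past [x]. *)
Let hr m i j (e : i + j == m + 1) (x : X i G) (y : Y j G) : tens X Y m G :=
  (-1) ^+ absz i *: tens_in (pred_bidegreer e) x (h (j - 1) (degcast Y j (j - 1 + 1) G y)).
Let hr_l m i j (e : i + j == m + 1) y : linear (fun x => hr e x y).
Proof.
by move=> a x x'; rewrite /hr tens_in_linearl scalerDr !scalerA [_ * a]mulrC.
Qed.
Let hr_r m i j (e : i + j == m + 1) x : linear (hr e x).
Proof.
by move=> a y y'; rewrite /hr !linearP tens_in_linearr scalerDr !scalerA [_ * a]mulrC.
Qed.

Definition htens_r m : {linear tens X Y (m + 1) G -> tens X Y m G} :=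
  tens_lift (fun i j e => @hr_l m i j e) (fun i j e => @hr_r m i j e).

Lemma htens_rE m i j (e : i + (j + 1) == m + 1) x y :
  htens_r m (tens_in e x y) = (-1) ^+ absz i *: tens_in (succ_bidegreer e) x (h j y).
Proof.
rewrite [LHS]tens_liftE /hr; move: (pred_bidegreer e); move: (j + 1 - 1) (addrK 1 j) => a ai.
by subst a => e'; rewrite degcast_id; congr (_ *: tens_in _ _ _); apply: bool_irrelevance.
Qed.

Lemma htens_r_hbd m i j (e : i + (j + 1) == m + 1) x y :
  cplx_d (tens X Y) m G (htens_r m (tens_in e x y)) +
  htens_r (m + 1) (cplx_d (tens X Y) (m + 1) G (tens_in e x y)) =
  tens_in e x (cplx_d Y j G (h j y) + h (j + 1) (cplx_d Y (j + 1) G y)).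
Proof.
rewrite htens_rE linearZ_LR !tens_dE (linearD (htens_r (m + 1))) (linearZ_LR (htens_r (m + 1))).
rewrite !htens_rE sign_succ.
have -> : tens_in e x (cplx_d Y j G (h j y) + h (j + 1) (cplx_d Y (j + 1) G y)) =
    tens_in e x (cplx_d Y j G (h j y)) + tens_in e x (h (j + 1) (cplx_d Y (j + 1) G y)).
  by have := tens_in_linearr e x 1 (cplx_d Y j G (h j y)) (h (j + 1) (cplx_d Y (j + 1) G y));
    rewrite !scale1r.
rewrite (bool_irrelevance (bidegreer (succ_bidegreer e)) e).
rewrite (bool_irrelevance (succ_bidegreer (bidegreer e)) e).
rewrite (bool_irrelevance (succ_bidegreer (bidegreel e)) (bidegreel (succ_bidegreer e))).
rewrite scaleNr !scalerDr !scalerA -!expr2 sqrr_sign !scale1r; zmod.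
Qed.
End Right.
End Homotopies.

(** The operator [Th1] is the error $1 - (dh + hd)$ in the left factor and [Th2] the one in the
    right factor. Each moves a cocycle by a boundary, and together they bring it into the span of
    the tensors of the two finite families. *)
Lemma tens_fdcoh X Y G : fdcoh X G -> fdcoh Y G -> fdcoh (tens X Y) G.
Proof.
move=> [I [dI [x /splitting[h [x' [_ hE]]]]]] [J [dJ [y /splitting[l [y' [_ lE]]]]]].
pose gdeg (c : I * J) := dI c.1 + dJ c.2.
pose gfam c : tens X Y (gdeg c) G := tens_in (eqxx (gdeg c)) (x' c.1) (y' c.2).
pose gens := @listed k U (tens X Y) G _ gdeg gfam.
exists (I * J)%type, gdeg, gfam.
elim/int_succ => m z dz.
pose Th1 : {linear tens X Y (m + 1) G -> tens X Y (m + 1) G} := idfun \- (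
  (cplx_d (tens X Y) m G \o htens_l Y h m) \+
  (htens_l Y h (m + 1) \o cplx_d (tens X Y) (m + 1) G)).
pose Th2 : {linear tens X Y (m + 1) G -> tens X Y (m + 1) G} := idfun \- (
  (cplx_d (tens X Y) m G \o htens_r X l m) \+
  (htens_r X l (m + 1) \o cplx_d (tens X Y) (m + 1) G)).
have Th1E u : Th1 u = u - (cplx_d (tens X Y) m G (htens_l Y h m u) +
  htens_l Y h (m + 1) (cplx_d (tens X Y) (m + 1) G u)) by [].
have Th2E u : Th2 u = u - (cplx_d (tens X Y) m G (htens_r X l m u) +
  htens_r X l (m + 1) (cplx_d (tens X Y) (m + 1) G u)) by [].
have subl i j (e : i + j == m + 1) u v w :
    tens_in e u w - tens_in e v w = @tens_in k U X Y (m + 1) G i j e (u - v) w.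
  have -> : u - v = (-1) *: v + u by rewrite scaleN1r; zmod.
  by rewrite tens_in_linearl scaleN1r; zmod.
have subr i j (e : i + j == m + 1) u v w :
    tens_in e u v - tens_in e u w = @tens_in k U X Y (m + 1) G i j e u (v - w).
  have -> : v - w = (-1) *: w + v by rewrite scaleN1r; zmod.
  by rewrite tens_in_linearr scaleN1r; zmod.
pose gens1 (t : tens X Y (m + 1) G) := exists a j (e : dI a + j == m + 1) w, t = tens_in e (x' a) w.
have S1 u : in_span gens1 (Th1 u).
  apply: (in_span_map (f := Th1) _ (tens_span u)) => {}u [i [j [e [v [w ->]]]]].
  elim/int_succ: i v e => i v e; rewrite Th1E htens_l_hbd subl.
  pose F : {linear X (i + 1) G -> tens X Y (m + 1) G} := mklin (tens_in_linearl e w).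
  apply: (in_span_map (f := F) _ (hE i v)) => {}v /listed_inv[a [ea ->]].
  apply: in_span_gen; rewrite /F mklinE.
  move: (i + 1) ea v e {F} => i1 ea; subst i1 => _ e; exists a, j, e, w.
  by [].
have S2 u : in_span gens1 u -> in_span (@gens (m + 1)) (Th2 u).
  apply: in_span_map => {}u [a [j [e [w ->]]]].
  elim/int_succ: j w e => j w e; rewrite Th2E htens_r_hbd subr.
  pose F : {linear Y (j + 1) G -> tens X Y (m + 1) G} := mklin (tens_in_linearr e (x' a)).
  apply: (in_span_map (f := F) _ (lE j w)) => {}w /listed_inv[b [eb ->]].
  apply: in_span_gen; rewrite /F mklinE.
  move: (j + 1) eb w e {F} => j1 eb; subst j1 => _ e.
  have e' := eqP e; move: e; rewrite -e' => e /=.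
  rewrite (bool_irrelevance e (eqxx _)).
  exact: (@Listed k U (tens X Y) G _ gdeg gfam (a, b)).
exists (Th2 (Th1 z)); first exact/S2/S1.
have dT1 : cplx_d (tens X Y) (m + 1) G (Th1 z) = 0.
  by rewrite Th1E dz linear0 addr0 linearB dz cplx_dd subrr.
rewrite [Th2 _]Th2E dT1 linear0 addr0 Th1E dz linear0 addr0.
apply: (bdry_trans (y := z - cplx_d (tens X Y) m G (htens_l Y h m z))).
  by rewrite subKr; apply: Bdry.
by rewrite subKr; apply: Bdry.
Qed.

Lemma contraction X G : acyclic_at X G ->
  exists h : forall n : int, {linear X (n + 1) G -> X n G},
    forall n v, cplx_d X n G (h n v) + h (n + 1) (cplx_d X (n + 1) G v) = v.
Proof.
move=> /acyclic_spans/splitting[h [y [_ hE]]]; exists h => n v.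
apply/esym/eqP; rewrite -subr_eq0; apply/eqP.
by apply: in_span_none (hE n v) => z [] [].
Qed.

Lemma acyclic_tens_l X Y G : acyclic_at X G -> acyclic_at (tens X Y) G.
Proof.
move=> /contraction[h hE] m z dz; exists (htens_l Y h m z).
pose F : {linear tens X Y (m + 1) G -> tens X Y (m + 1) G} :=
  (cplx_d (tens X Y) m G \o htens_l Y h m) \+
  (htens_l Y h (m + 1) \o cplx_d (tens X Y) (m + 1) G).
have FE : F =1 idfun.
  apply: tens_ext => i j e x y; rewrite -[RHS]/(tens_in e x y).
  by elim/int_succ: i x e => i x e; rewrite -[in RHS](hE i x); apply: htens_l_hbd.
rewrite -[LHS](FE z) -[LHS]/(cplx_d (tens X Y) m G (htens_l Y h m z) +
  htens_l Y h (m + 1) (cplx_d (tens X Y) (m + 1) G z)).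
by rewrite dz linear0 addr0.
Qed.

Lemma acyclic_tens_r X Y G : acyclic_at Y G -> acyclic_at (tens X Y) G.
Proof.
move=> /contraction[h hE] m z dz; exists (htens_r X h m z).
pose F : {linear tens X Y (m + 1) G -> tens X Y (m + 1) G} :=
  (cplx_d (tens X Y) m G \o htens_r X h m) \+
  (htens_r X h (m + 1) \o cplx_d (tens X Y) (m + 1) G).
have FE : F =1 idfun.
  apply: tens_ext => i j e x y; rewrite -[RHS]/(tens_in e x y).
  by elim/int_succ: j y e => j y e; rewrite -[in RHS](hE j y); apply: htens_r_hbd.
rewrite -[LHS](FE z) -[LHS]/(cplx_d (tens X Y) m G (htens_r X h m z) +
  htens_r X h (m + 1) (cplx_d (tens X Y) (m + 1) G z)).
by rewrite dz linear0 addr0.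
Qed.
End TensorCohomology.

(** * Torsors *)

Section Spheres.
Context (k : fieldType) (U : finGroupType -> Prop).
Implicit Types (M N : psh k U) (X Y Z : cplx k U) (G H K : gobj U).

(** The functor [M] concentrated in degree [n]. A direct sum over the proofs of [n = m] is a copy of
    [M] or zero, and needs no transport. *)
Program Definition sph M (n : int) : cplx k U :=
  @Cplx k U (fun m => psh_dsum (fun _ : n = m => M)) (fun m => nt_zero _ _) _.
Next Obligation. by []. Qed.

Definition sph_gen M n K : {linear M K -> sph M n n K} :=
  dsum_in (fun _ : n = n => M K) erefl.

Lemma sph_ind M n K (P : forall m, sph M n m K -> Prop) :
  (forall x, P n (sph_gen M n K x)) ->
  (forall m x y, P m x -> P m y -> P m (x + y)) -> (forall m, P m 0) ->
  forall m z, P m z.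
Proof.
move=> Pg PD P0 m z; rewrite (dsum_decomp z); elim/big_rec: _ => // e x _.
apply: PD; have Pin (e' : n = m) y : P m (dsum_in (fun _ : n = m => M K) e' y).
  by subst m; apply: Pg.
exact: Pin.
Qed.

Section Out.
Context (M : psh k U) (n : int) (X : cplx k U) (g : nat_trans M (X n)).
Hypothesis dg : forall G x, cplx_d X n G (g G x) = 0.

Program Definition sph_out : cmap (sph M n) X :=
  @CMap k U (sph M n) X (fun m => @NatTrans k U (psh_dsum (fun _ : n = m => M)) (X m)
    (fun K => dsum_elim (fun _ : n = m => degcast X n m K \o g K)) _) _.
Next Obligation.
move=> m K H a.
pose f1 : {linear psh_dsum (fun _ : n = m => M) K -> X m H} :=
  dsum_elim (fun _ : n = m => degcast X n m H \o g H) \o psh_res (psh_dsum (fun _ : n = m => M)) a.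
pose f2 : {linear psh_dsum (fun _ : n = m => M) K -> X m H} :=
  psh_res (X m) a \o dsum_elim (fun _ : n = m => degcast X n m K \o g K).
suff E : f1 =1 f2 by exact: E.
apply: dsum_ext => e x.
rewrite -[LHS]/(dsum_elim (fun _ : n = m => degcast X n m H \o g H)
  (dsum_map (fun _ : n = m => psh_res M a) (dsum_in _ e x))).
rewrite dsum_map_in dsum_elim_in -[RHS]/(psh_res (X m) a (dsum_elim _ (dsum_in _ e x))).
by rewrite dsum_elim_in /= !nat_appE.
Qed.
Next Obligation.
move=> m K z; rewrite [LHS]linear0; elim/(@sph_ind M n K): m / z.
- move=> x; rewrite -[RHS]/(cplx_d X n K (dsum_elim _ (dsum_in _ erefl x))).
  by rewrite dsum_elim_in /= degcast_id dg.
- by move=> m x y Hx Hy; rewrite linearD linearD -Hx -Hy addr0.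
by move=> m; rewrite !linear0.
Qed.

Lemma sph_outE K x : sph_out n K (sph_gen M n K x) = g K x.
Proof. by rewrite [LHS]dsum_elim_in /= degcast_id. Qed.
End Out.

Section In.
Context (M : psh k U) (n : int) (X : cplx k U).
Context (r : forall m : int, nat_trans (X m) M).
Hypothesis rd : forall m G x, r (m + 1) G (cplx_d X m G x) = 0.

Definition sph_put m K : {linear M K -> sph M n m K} :=
  if pselect (n = m) is left e then dsum_in (fun _ : n = m => M K) e else \0.

Lemma sph_put_id K x : sph_put n K x = sph_gen M n K x.
Proof. by rewrite /sph_put; case: pselect => // e; rewrite (eq_axiomK e). Qed.

Program Definition sph_in : cmap X (sph M n) :=
  @CMap k U X (sph M n) (fun m => @NatTrans k U (X m) (psh_dsum (fun _ : n = m => M))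
    (fun K => sph_put m K \o r m K) _) _.
Next Obligation.
move=> m K H a x /=; rewrite nat_appE /sph_put; case: pselect => [e|ne] /=.
  exact: esym (dsum_map_in (fun _ : n = m => psh_res M a) _).
by apply: dsumP => i; rewrite /= linear0.
Qed.
Next Obligation. by move=> m K x /=; rewrite rd linear0. Qed.

Lemma sph_inE K x : sph_in n K x = sph_gen M n K (r n K x).
Proof. exact: sph_put_id. Qed.
End In.

Lemma sph_fdcoh M n K (I : finType) (x : I -> M K) :
  (forall z, in_span (fun y => exists i, y = x i) z) -> fdcoh (sph M n) K.
Proof.
move=> sx; exists I, (fun=> n), (fun i => sph_gen M n K (x i)) => m z _.
exists z; last by rewrite subrr; apply: bdry0.
elim/(@sph_ind M n K): m / z.
- move=> z; apply: in_span_map (sx z) => _ [i ->]; apply: in_span_gen.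
  exact: (@Listed k U (sph M n) K _ (fun=> n) (fun i => sph_gen M n K (x i)) i).
- by move=> m y z; apply: in_spanD.
by move=> m; apply: in_span0.
Qed.

Lemma sph_acyclic M n K : (forall x : M K, x = 0) -> acyclic_at (sph M n) K.
Proof.
move=> M0; apply/acyclicP => m z _; elim/(@sph_ind M n K): m / z.
- by move=> x; rewrite (M0 x) linear0; apply: bdry0.
- by move=> m y z; apply: bdryD.
by move=> m; apply: bdry0.
Qed.

Lemma sph_not_acyclic M n K (x : M K) : x <> 0 -> ~ acyclic_at (sph M n) K.
Proof.
move=> x0 /acyclicP/(_ n (sph_gen M n K x) erefl).
have bd0 m (z : sph M n m K) : bdry z -> z = 0 by case=> {m z}.
move=> /bd0 /(congr1 (fun f : dsum (fun _ : n = n => M K) => f erefl)) /=.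
by rewrite dsum_in_id.
Qed.
End Spheres.

Section Torsor.
Context (k : fieldType) (U : finGroupType -> Prop) (G : gobj U).
Implicit Types (X Y Z : cplx k U) (H K : gobj U).

Lemma torsor_inner (a : epi G G) : epi_conj (epi_id G) a ->
  epi_conj (epi_id G) a /\ forall v : k^o, (idfun : {linear k^o -> k^o}) v = v.
Proof. by []. Qed.

Definition torsor : psh k U := @ind_psh k U G k^o (epi_conj (epi_id G)) (fun=> idfun)
  True torsor_inner.

Definition tgen K (p : epi K G) : {linear k^o -> torsor K} :=
  @ind_gen k U G k^o (epi_conj (epi_id G)) (fun=> idfun) True K p.

Lemma tgen_res H K (c : epi H K) (p : epi K G) v :
  psh_res torsor c (tgen p v) = tgen (epi_comp p c) v.
Proof. exact: ind_pshE. Qed.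

Lemma tgen_kill K (p : epi K G) v : #|K| <> #|G| -> tgen p v = 0.
Proof. exact: ind_gen_kill. Qed.

Lemma tgen_act K (p : epi K G) (a : epi G G) v : epi_conj (epi_id G) a ->
  tgen p v = tgen (epi_comp a p) v.
Proof. exact: (@ind_gen_act k U G k^o (epi_conj (epi_id G)) (fun=> idfun)). Qed.

Lemma tgenZ K (p : epi K G) (v : k^o) : tgen p v = (v : k) *: tgen p 1.
Proof. by rewrite -linearZ_LR; congr (tgen p _); rewrite -[RHS]/(v * 1) mulr1. Qed.

Lemma torsor_ext K (W : lmodType k) (f g : {linear torsor K -> W}) :
  (forall p v, f (tgen p v) = g (tgen p v)) -> f =1 g.
Proof. exact: ind_ext. Qed.

Lemma torsor_zero K (t : torsor K) : ~ gobj_iso G K -> t = 0.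
Proof.
move=> nGK; apply: (torsor_ext (f := idfun) (g := \0)) => p v.
apply: tgen_kill => KG; apply: nGK; apply/gobj_isoP; by exists p.
Qed.

Lemma torsor_fdcoh n K : fdcoh (sph torsor n) K.
Proof.
apply: (@sph_fdcoh _ _ _ _ _ _ (fun p : epi K G => tgen p 1)) => z.
apply: in_span_sub (ind_span z) => _ [p [v ->]].
rewrite -[ind_gen _ _ _ p v]/(tgen p v) tgenZ.
by apply/in_spanZ/in_span_gen; exists p.
Qed.

Lemma torsor_acyclic n K : ~ gobj_iso G K -> acyclic_at (sph torsor n) K.
Proof. by move=> nGK; apply: sph_acyclic => x; apply: torsor_zero. Qed.

Section Augmentation.
Context (K : gobj U).

Definition aug_fun (p : epi K G) : {linear k^o -> k^o} := 
  if #|K| == #|G| then (idfun : {linear k^o -> k^o}) else (\0 : {linear k^o -> k^o}).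

Lemma aug_act p (a : epi G G) v : epi_conj (epi_id G) a ->
  aug_fun p ((idfun : {linear k^o -> k^o}) v) = aug_fun (epi_comp a p) v.
Proof. by []. Qed.

Lemma aug_kill (p : epi K G) v : True -> #|K| <> #|G| -> aug_fun p v = 0.
Proof. by move=> _ /eqP/negPf KG; rewrite /aug_fun KG. Qed.

(** The sum of the coefficients. It shows that generators at [G] are nonzero, and serves as the
    evaluation that undoes averaging. *)
Definition aug : {linear torsor K -> k^o} := ind_lift aug_act aug_kill.

Lemma augE p v : #|K| = #|G| -> aug (tgen p v) = v.
Proof. by move=> KG; rewrite [LHS]ind_liftE /aug_fun KG eqxx. Qed.
End Augmentation.

Lemma torsor_not_acyclic n : ~ acyclic_at (sph torsor n) G.
Proof.
apply: (@sph_not_acyclic _ _ _ _ _ (tgen (epi_id G) 1)) => /(congr1 (@aug G)).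
by rewrite augE // linear0 => /eqP; rewrite oner_eq0.
Qed.
End Torsor.

(** * Splitting the torsor off a tensor product *)

Section TorsorMaps.
Context (k : fieldType) (U : finGroupType -> Prop) (G : gobj U).
Implicit Types (M : psh k U) (X Y Z : cplx k U) (H K : gobj U).

Section Out.
Context (M : psh k U) (y : M G).
Hypothesis y_kill : forall K (p : epi K G), #|K| <> #|G| -> psh_res M p y = 0.

Lemma scale1_linear : linear (fun c : k^o => (c : k) *: y).
Proof. by move=> a b c; rewrite scalerDl scalerA. Qed.

Lemma torsor_nt_act (a : epi G G) v : epi_conj (epi_id G) a ->
  mklin scale1_linear ((idfun : {linear k^o -> k^o}) v) =
  psh_res M a (mklin scale1_linear v).
Proof. by move=> ca; rewrite -(psh_res_conj ca) psh_res_id. Qed.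

Lemma torsor_nt_kill K (p : epi K G) v : True -> #|K| <> #|G| ->
  psh_res M p (mklin scale1_linear v) = 0.
Proof. by move=> _ KG; rewrite mklinE linearZ_LR y_kill // scaler0. Qed.

Definition torsor_nt : nat_trans (torsor k G) M := ind_nt _ torsor_nt_act torsor_nt_kill.

Lemma torsor_ntE K (p : epi K G) v : torsor_nt K (tgen k p v) = (v : k) *: psh_res M p y.
Proof. by rewrite [LHS]ind_ntE mklinE linearZ_LR. Qed.
End Out.

(* Restriction along the inverse of p, and 0 if p is not invertible. *)
Definition pinv M K (p : epi K G) : {linear M K -> M G} :=
  if pselect (exists q : epi G K, epi_comp p q = epi_id G) is left e
  then psh_res M (sval (cid e)) else \0.

Lemma pinvE M K (p : epi K G) (q : epi G K) y :
  epi_comp p q = epi_id G -> pinv M p y = psh_res M q y.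
Proof.
move=> pq; rewrite /pinv; case: pselect => [e|]; last by case; exists q.
congr (psh_res M _ _); apply: (epi_comp_inj (b := p)).
  by apply/eqP; rewrite eqn_leq (epi_leq p) (epi_leq q).
by rewrite (svalP (cid e)) pq.
Qed.

Lemma pinv_act M K (p : epi K G) (a : epi G G) y : epi_conj (epi_id G) a ->
  #|K| = #|G| -> pinv M p y = pinv M (epi_comp a p) y.
Proof.
move=> [g ga] KG; have [q [pq qp]] := epi_inverse p KG.
rewrite (pinvE y pq) (@pinvE _ _ _ (epi_comp q (epi_inv a))); last first.
  by rewrite epi_compA -(epi_compA a) pq epi_comp_idr epi_invr.
(* The inverse of [a] is conjugation by the inverse of [g], and [q] carries it to conjugation by
   [q g^-1]. *)
apply: psh_res_conj; exists (q g^-1%g) => x /=.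
have : a (epi_inv a x) = x by rewrite -[LHS]/(epi_comp a (epi_inv a) x) epi_invr.
by rewrite ga /=; move: (epi_inv a x) => z <-; rewrite -epiJ conjgK.
Qed.

Lemma pinv_d X n K (p : epi K G) (y : X n K) :
  pinv (X (n + 1)) p (cplx_d X n K y) = cplx_d X n G (pinv (X n) p y).
Proof.
rewrite /pinv; case: pselect => [e|ne] /=; last by rewrite linear0.
by rewrite nat_appE.
Qed.

Section Coefficients.
Context (K : gobj U).

(** What multiplication of the generators by coefficients needs to respect the relations; off the
    class of [G] the generators are zero and nothing is asked. *)
Definition coef_invariant (c : epi K G -> k) :=
  forall p (a : epi G G), epi_conj (epi_id G) a -> #|K| = #|G| -> c p = c (epi_comp a p).

Section Fixed.
Context (c : epi K G -> k).
Hypothesis c_inv : coef_invariant c.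

Lemma coef_mul_linear p : linear (fun v : k^o => c p *: tgen k p v).
Proof. by move=> a u v; rewrite linearP scalerDr !scalerA mulrC. Qed.

Lemma coef_mul_act p (a : epi G G) v : epi_conj (epi_id G) a ->
  mklin (coef_mul_linear p) ((idfun : {linear k^o -> k^o}) v) =
  mklin (coef_mul_linear (epi_comp a p)) v.
Proof.
move=> ca; rewrite -[LHS]/(c p *: tgen k p v) -[RHS]/(c (epi_comp a p) *: tgen k (epi_comp a p) v).
rewrite -(tgen_act p v ca).
have [KG|KG] := eqVneq #|K| #|G|; first by rewrite (c_inv p ca KG).
by rewrite tgen_kill ?scaler0 //; apply/eqP.
Qed.

Lemma coef_mul_kill p v : True -> #|K| <> #|G| -> mklin (coef_mul_linear p) v = 0.
Proof. by move=> _ KG; rewrite mklinE tgen_kill // scaler0. Qed.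

Definition coef_mul : {linear torsor k G K -> torsor k G K} :=
  ind_lift coef_mul_act coef_mul_kill.

Lemma coef_mulE p v : coef_mul (tgen k p v) = c p *: tgen k p v.
Proof. exact: ind_liftE. Qed.
End Fixed.

Lemma coef_mulP (c c' c2 : epi K G -> k) (h : coef_invariant c) (h' : coef_invariant c')
    (h2 : coef_invariant c2) a t :
  (forall p, c2 p = a * c p + c' p) ->
  coef_mul h2 t = a *: coef_mul h t + coef_mul h' t.
Proof.
move=> e; have lin : linear (fun t => a *: coef_mul h t + coef_mul h' t).
  move=> b u v; rewrite (linearP (coef_mul h)) (linearP (coef_mul h')) !scalerDr !scalerA.
  by rewrite (mulrC a b) addrACA.
move: t; apply: (torsor_ext (g := mklin lin)) => p v.
by rewrite mklinE !coef_mulE e scalerDl scalerA.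
Qed.
End Coefficients.

Definition sph_val M n m K : {linear sph M n m K -> M K} :=
  dsum_elim (fun _ : n = m => (idfun : {linear M K -> M K})).
Arguments sph_val : clear implicits.

Lemma sph_valE M n K x : sph_val M n n K (sph_gen M n K x) = x.
Proof. exact: dsum_elim_in. Qed.

Lemma sph_val_res M n m H K (a : epi H K) (z : sph M n m K) :
  sph_val M n m H (psh_res (sph M n m) a z) = psh_res M a (sph_val M n m K z).
Proof.
elim/(@sph_ind k U M n K): m / z.
- move=> x; rewrite sph_valE.
  have -> : psh_res (sph M n n) a (sph_gen M n K x) = sph_gen M n H (psh_res M a x).
    exact: (dsum_map_in (fun _ : n = n => psh_res M a)).
  exact: sph_valE.
- by move=> m x y Hx Hy; rewrite !linearD Hx Hy.
by move=> m; rewrite !linear0.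
Qed.

Section SplitOff.
Context (X : cplx k U) (n : int) (x : X n G) (f : {linear X n G -> k^o}).
Hypothesis dx : cplx_d X n G x = 0.
Hypothesis fx : f x = 1.
Hypothesis f_bdry : forall y, bdry y -> f y = 0.

(** Degree [- n] places the product of [x] with a generator in degree 0. *)
Let S := sph (torsor k G) (- n).

(** The retraction will send $y \otimes p$ to $f((p^{-1})^* y)\, p$. Since [p] is visible in the
    second factor, [y] can be transported to [G] before [f] is applied, so no invariance of [f] is
    required. *)
Let ex_coef i K (y : X i K) (p : epi K G) : k := f (degcast X i n G (pinv (X i) p y)).

Let ex_coef_inv i K (y : X i K) : coef_invariant (ex_coef y).
Proof. by move=> p a ca KG; rewrite /ex_coef (pinv_act p y ca KG). Qed.

Let ex_b m K i j (e : i + j == m) (y : X i K) (t : S j K) : torsor k G K :=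
  coef_mul (ex_coef_inv y) (sph_val (torsor k G) (- n) j K t).

Let ex_bl m K i j (e : i + j == m) t : linear (fun y => @ex_b m K i j e y t).
Proof.
move=> a y y'; apply: coef_mulP => p; rewrite /ex_coef !linearP.
by [].
Qed.

Let ex_br m K i j (e : i + j == m) y : linear (@ex_b m K i j e y).
Proof. by move=> a t t'; rewrite /ex_b !linearP. Qed.

Let ex_lin m K : {linear tens X S m K -> torsor k G K} :=
  tens_lift (fun i j e => @ex_bl m K i j e) (fun i j e => @ex_br m K i j e).

Let ex_linE m K i j (e : i + j == m) y t :
  ex_lin m K (tens_in e y t) = coef_mul (ex_coef_inv y) (sph_val (torsor k G) (- n) j K t).
Proof. exact: tens_liftE. Qed.

Let ex_nat m K H (a : epi H K) z :
  ex_lin m H (psh_res (tens X S m) a z) = psh_res (torsor k G) a (ex_lin m K z).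
Proof.
pose f1 : {linear tens X S m K -> torsor k G H} := ex_lin m H \o psh_res (tens X S m) a.
pose f2 : {linear tens X S m K -> torsor k G H} := psh_res (torsor k G) a \o ex_lin m K.
suff E : f1 =1 f2 by exact: E.
apply: tens_ext => i j e y t.
rewrite -[LHS]/(ex_lin m H (tens_res X S m a (tens_in e y t))) tens_resE ex_linE.
rewrite sph_val_res -[RHS]/(psh_res (torsor k G) a (ex_lin m K (tens_in e y t))) ex_linE.
move: (sph_val (torsor k G) (- n) j K t) => u.
pose g1 : {linear torsor k G K -> torsor k G H} :=
  coef_mul (ex_coef_inv (psh_res (X i) a y)) \o psh_res (torsor k G) a.
pose g2 : {linear torsor k G K -> torsor k G H} :=
  psh_res (torsor k G) a \o coef_mul (ex_coef_inv y).
suff E : g1 =1 g2 by exact: E.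
apply: torsor_ext => p v.
rewrite -[LHS]/(coef_mul (ex_coef_inv (psh_res (X i) a y)) (psh_res (torsor k G) a (tgen k p v))).
rewrite -[RHS]/(psh_res (torsor k G) a (coef_mul (ex_coef_inv y) (tgen k p v))).
rewrite tgen_res !coef_mulE linearZ_LR tgen_res.
have [HG|HG] := eqVneq #|H| #|G|; last by rewrite tgen_kill ?scaler0 //; apply/eqP.
congr (_ *: _); congr (f (degcast X i n G _)).
have [q [pq qp]] := epi_inverse (epi_comp p a) HG.
rewrite (pinvE _ pq) psh_res_comp'; apply/esym/pinvE.
by rewrite epi_compA.
Qed.

Let ex_nt m : nat_trans (tens X S m) (torsor k G) :=
  @NatTrans k U (tens X S m) (torsor k G) (ex_lin m) (@ex_nat m).

Let ex_d m K z : ex_nt (m + 1) K (cplx_d (tens X S) m K z) = 0.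
Proof.
pose F : {linear tens X S m K -> torsor k G K} := ex_lin (m + 1) K \o cplx_d (tens X S) m K.
suff F0 : F =1 \0 by apply: F0.
apply: tens_ext => i j e y t; rewrite -[LHS]/(ex_lin (m + 1) K _) tens_dE.
rewrite -[cplx_d S j K t]/(0 : S (j + 1) K) tens_in0r scaler0 addr0 ex_linE.
move: (sph_val (torsor k G) (- n) j K t) => u; move: u; apply: (torsor_ext (g := \0)) => p v.
rewrite coef_mulE /ex_coef pinv_d f_bdry ?scale0r //.
exact/degcast_bdry/Bdry.
Qed.

Let unit_el : tens X S 0 G :=
  tens_in (introT eqP (subrr n)) x (sph_gen (torsor k G) (- n) G (tgen k (epi_id G) 1)).

Let unit_res K (p : epi K G) : psh_res (tens X S 0) p unit_el =
  tens_in (introT eqP (subrr n)) (psh_res (X n) p x)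
    (sph_gen (torsor k G) (- n) K (tgen k p 1)).
Proof.
rewrite [LHS]tens_resE; congr tens_in.
rewrite -[LHS]/(dsum_map _ (dsum_in _ _ _)) dsum_map_in; congr (dsum_in _ _ _).
by rewrite tgen_res epi_comp_idl.
Qed.

Let unit_kill K (p : epi K G) : #|K| <> #|G| -> psh_res (tens X S 0) p unit_el = 0.
Proof. by move=> KG; rewrite unit_res tgen_kill // linear0 tens_in0r. Qed.

Let unit_nt : nat_trans (torsor k G) (tens X S 0) := torsor_nt unit_kill.

Let unit_d K t : cplx_d (tens X S) 0 K (unit_nt K t) = 0.
Proof.
pose F : {linear torsor k G K -> tens X S (0 + 1) K} := cplx_d (tens X S) 0 K \o unit_nt K.
suff F0 : F =1 \0 by apply: F0.
apply: torsor_ext => p v; rewrite -[LHS]/(cplx_d (tens X S) 0 K (unit_nt K _)) torsor_ntE.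
rewrite linearZ_LR nat_appE tens_dE.
rewrite -[cplx_d S _ _ _]/(0 : S (- n + 1) G) tens_in0r scaler0 addr0 dx tens_in0l.
by rewrite linear0 scaler0.
Qed.

(** The composite takes [p] to $p^* x \otimes p$ and then to $f((p^{-1})^* p^* x)\, p = f(x)\, p =
    p$. It commutes with differentials because [x] is a cocycle and [f] kills boundaries. *)
Lemma torsor_retract : Dretract (sph (torsor k G) 0) (tens X S).
Proof.
exists (Dmap (sph_out unit_d)), (Dmap (sph_in 0 ex_d)).
apply: deq_mapcomp => m K z; elim/(@sph_ind k U (torsor k G) 0 K): m / z.
- move=> t; rewrite -[LHS]/(sph_in 0 ex_d 0 K (sph_out unit_d 0 K (sph_gen (torsor k G) 0 K t))) sph_outE sph_inE.
  rewrite -[RHS]/(sph_gen (torsor k G) 0 K t); congr (sph_gen _ _ _ _).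
  pose F : {linear torsor k G K -> torsor k G K} := ex_nt 0 K \o unit_nt K.
  suff FE : F =1 idfun by apply: FE.
  apply: torsor_ext => p v; rewrite -[LHS]/(ex_lin 0 K (unit_nt K _)) torsor_ntE.
  rewrite linearZ_LR unit_res ex_linE sph_valE coef_mulE -[RHS]/(tgen k p v).
  have [KG|KG] := eqVneq #|K| #|G|; last by rewrite !tgen_kill ?scaler0 //; apply/eqP.
  have [q [pq qp]] := epi_inverse p KG.
  rewrite /ex_coef (pinvE _ pq) (res_inv _ pq) degcast_id fx scale1r.
  exact/esym/tgenZ.
- by move=> m y z Hy Hz; rewrite linearD Hy Hz linearD.
by move=> m; rewrite !linear0.
Qed.
End SplitOff.
End TorsorMaps.

(** * Truncations *)

Section Truncation.
Context (k : fieldType) (U : finGroupType -> Prop).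
Implicit Types (M N : psh k U) (X Y Z : cplx k U) (G H K L : gobj U).

(** Without this condition, a restriction between two groups of [A] could factor through a group at
    which the truncation is zero, and functoriality would fail. *)
Definition convex (A : gobj U -> Prop) := forall K H L (a : epi H K) (b : epi L H),
  A K -> A L -> A H.

Section Convex.
Context (A : gobj U -> Prop) (cA : convex A).

(** All of [M K] if [A K] holds and zero otherwise, written as a subspace so that the type does not
    depend on a decision of [A K]. *)
Program Definition tr_sub M K : subspace (M K) :=
  @Subspace k (M K) (fun x => ~ A K -> x = 0) _ _.
Next Obligation. by []. Qed.
Next Obligation. by move=> M K a x y Hx Hy nA; rewrite Hx // Hy // scaler0 addr0. Qed.

Definition tr_ob M K : lmodType k := lsub_mod (tr_sub M K).

Definition trval M K : {linear tr_ob M K -> M K} := lval (tr_sub M K).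

Lemma trval_inj M K : injective (trval M K).
Proof. exact: lval_inj. Qed.

Lemma trval0 M K (x : tr_ob M K) : ~ A K -> trval M K x = 0.
Proof. by move=> nA; exact: (lvalP x nA). Qed.

Lemma tr_if_linear M N K (f : {linear M K -> N K}) :
  linear (fun x => if pselect (A K) then f x else 0).
Proof. by move=> a x y; case: pselect => [AK|nAK]; rewrite ?linearP ?scaler0 ?addr0. Qed.

Lemma tr_ifP (V : lmodType k) M K (f : V -> M K) x :
  tr_sub M K (if pselect (A K) then f x else 0).
Proof. by move=> nA; case: pselect. Qed.

Lemma tpr_linear M K : linear (fun x : M K => if pselect (A K) then x else 0).
Proof. exact: (@tr_if_linear M M K idfun). Qed.

Definition tpr M K : {linear M K -> tr_ob M K} :=
  lcor (f := mklin (@tpr_linear M K)) (fun x => @tr_ifP (M K) M K idfun x).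

Lemma tprE M K x : A K -> trval M K (tpr M K x) = x.
Proof. by move=> AK; rewrite [LHS]lcorE mklinE; case: pselect. Qed.

Lemma tpr0 M K x : ~ A K -> tpr M K x = 0.
Proof. by move=> AK; apply: trval_inj; rewrite linear0 trval0. Qed.

Lemma trvalK M K x : tpr M K (trval M K x) = x.
Proof.
apply: trval_inj; have [AK|nAK] := pselect (A K); first by rewrite tprE.
by rewrite !trval0.
Qed.

Definition tr_res M K H (a : epi H K) : {linear tr_ob M K -> tr_ob M H} :=
  tpr M H \o (psh_res M a \o trval M K).

Lemma tr_resE M K H (a : epi H K) x :
  tr_res M a x = tpr M H (psh_res M a (trval M K x)).
Proof. by []. Qed.

(* The value at K is that of M if A K holds, and 0 otherwise. *)
Program Definition trunc M : psh k U := @Psh k U (tr_ob M) (@tr_res M) _ _ _.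
Next Obligation. by move=> M K H a b ab x; rewrite !tr_resE (psh_res_conj ab). Qed.
Next Obligation. by move=> M K x; rewrite tr_resE psh_res_id trvalK. Qed.
Next Obligation.
move=> M K H L a b x; rewrite -[RHS]/(tr_res M b (tr_res M a x)) !tr_resE -psh_res_comp'.
have [AL|nAL] := pselect (A L); last by rewrite !tpr0.
have [AK|nAK] := pselect (A K); last by rewrite trval0 // !linear0.
have AH : A H by apply: cA a b AK AL.
by rewrite -[X in psh_res M b X](tprE _ AH).
Qed.

Lemma truncE M K H (a : epi H K) (x : trunc M K) :
  psh_res (trunc M) a x = tpr M H (psh_res M a (trval M K x)).
Proof. by []. Qed.

Program Definition trunc_nt M N (f : nat_trans M N) : nat_trans (trunc M) (trunc N) :=
  @NatTrans k U (trunc M) (trunc N) (fun K => tpr N K \o (f K \o trval M K)) _.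
Next Obligation.
move=> M N f K H a x.
rewrite -[LHS]/(tpr N H (f H (trval M H (tpr M H (psh_res M a (trval M K x)))))).
rewrite -[RHS]/(tpr N H (psh_res N a (trval N K (tpr N K (f K (trval M K x)))))).
have [AH|nAH] := pselect (A H); last by rewrite !tpr0.
have [AK|nAK] := pselect (A K); last by rewrite (trval0 x nAK) !linear0.
by rewrite !tprE // nat_appE.
Qed.

Lemma trunc_ntE M N (f : nat_trans M N) K x :
  trval N K (trunc_nt f K x) = f K (trval M K x).
Proof.
have [AK|nAK] := pselect (A K); first exact: tprE.
by rewrite !trval0 // linear0.
Qed.

Program Definition truncC X : cplx k U :=
  @Cplx k U (fun n => trunc (X n)) (fun n => trunc_nt (cplx_d X n)) _.
Next Obligation. by move=> X n K x; apply: trval_inj; rewrite !trunc_ntE cplx_dd linear0. Qed.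

Lemma trval_d X n K (x : truncC X n K) :
  trval (X (n + 1)) K (cplx_d (truncC X) n K x) = cplx_d X n K (trval (X n) K x).
Proof. exact: trunc_ntE. Qed.

Lemma tpr_d X n K x :
  tpr (X (n + 1)) K (cplx_d X n K x) = cplx_d (truncC X) n K (tpr (X n) K x).
Proof.
apply: trval_inj; rewrite trval_d.
have [AK|nAK] := pselect (A K); first by rewrite !tprE.
by rewrite !trval0 // linear0.
Qed.

Lemma tpr_bdry X n K (x : X n K) : bdry x -> bdry (tpr (X n) K x : truncC X n K).
Proof. by case=> {n x} n w; rewrite tpr_d; apply: Bdry. Qed.

Lemma trunc_fdcoh X K : fdcoh X K -> fdcoh (truncC X) K.
Proof.
move=> [I [deg [x sx]]]; exists I, deg, (fun i => tpr (X (deg i)) K (x i)) => n z dz.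
have [|y sy b] := sx n (trval (X n) K z); first by rewrite -trval_d dz linear0.
exists (tpr (X n) K y).
  apply: in_span_map sy => _ [i]; apply: in_span_gen.
  exact: (@Listed k U (truncC X) K _ deg (fun i => tpr (X (deg i)) K (x i)) i).
by rewrite -[z]trvalK -linearB; apply: tpr_bdry.
Qed.

Lemma trunc_acyclic X K : (A K -> acyclic_at X K) -> acyclic_at (truncC X) K.
Proof.
move=> aX; apply/acyclicP => n z dz; rewrite -[z]trvalK; apply: tpr_bdry.
have [/aX/acyclicP aXK|nAK] := pselect (A K); last by rewrite trval0 //; apply: bdry0.
by apply: aXK; rewrite -trval_d dz linear0.
Qed.

Section Whole.
Context (X : cplx k U).
Hypothesis A_all : forall K, A K.

Program Definition trunc_whole : cmap (truncC X) X :=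
  @CMap k U (truncC X) X (fun n => @NatTrans k U (trunc (X n)) (X n) (trval (X n)) _) _.
Next Obligation. by move=> n K H a x; rewrite truncE tprE. Qed.
Next Obligation. by move=> n K x; apply: trval_d. Qed.

Lemma trunc_whole_qis : qis trunc_whole.
Proof.
apply/qisP => K n; split=> [x dx b|y dy].
  by rewrite -[x]trvalK; apply: tpr_bdry.
exists (tpr (X n) K y); first by rewrite -tpr_d dy linear0.
by rewrite -[trunc_whole n K _]/(trval (X n) K (tpr (X n) K y)) tprE // subrr; apply: bdry0.
Qed.
End Whole.
End Convex.

Section Comparison.
Context (A B : gobj U -> Prop) (cA : convex A) (cB : convex B) (X : cplx k U).
(* What naturality of the map that is the identity on A /\ B amounts to. *)
Hypothesis AB_res : forall K H (a : epi H K), A K -> B H -> A H /\ B K.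

Program Definition trunc_cmp : cmap (truncC cA X) (truncC cB X) :=
  @CMap k U (truncC cA X) (truncC cB X)
    (fun n => @NatTrans k U (trunc cA (X n)) (trunc cB (X n))
      (fun K => tpr B (X n) K \o trval A (X n) K) _) _.
Next Obligation.
move=> n K H a x.
rewrite -[LHS]/(tpr B (X n) H (trval A (X n) H (tpr A (X n) H
  (psh_res (X n) a (trval A (X n) K x))))).
rewrite -[RHS]/(tpr B (X n) H (psh_res (X n) a (trval B (X n) K
  (tpr B (X n) K (trval A (X n) K x))))).
have [BH|nBH] := pselect (B H); last by rewrite !tpr0.
have [AK|nAK] := pselect (A K); last by rewrite (trval0 x nAK) !linear0.
by have [AH BK] := AB_res a AK BH; rewrite !tprE.
Qed.
Next Obligation.
move=> n K x.
rewrite -[LHS]/(tpr B (X (n + 1)) K (trval A (X (n + 1)) K (cplx_d (truncC cA X) n K x))).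
by rewrite trval_d tpr_d.
Qed.

Lemma trunc_cmpE n K x : trunc_cmp n K x = tpr B (X n) K (trval A (X n) K x).
Proof. by []. Qed.
End Comparison.

Section ShortExact.
Context (X Y Z : cplx k U) (i : cmap X Y) (p : cmap Y Z).
Hypothesis i_inj : forall n K x, i n K x = 0 -> x = 0.
Hypothesis p_surj : forall n K z, exists y, z = p n K y.
Hypothesis pi0 : forall n K x, p n K (i n K x) = 0.
Hypothesis exact_mid : forall n K y, p n K y = 0 -> exists x, y = i n K x.

Program Definition cone_quot : cmap (cone i) Z :=
  @CMap k U (cone i) Z (fun n => nt_comp (p n) (nt_snd (X (n + 1)) (Y n))) _.
Next Obligation.
move=> n K [x y]; rewrite -[LHS]/(p (n + 1) K (i (n + 1) K x + cplx_d Y n K y)).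
by rewrite linearD pi0 add0r cmap_appE.
Qed.

(** Makes a triangle out of an injection and its quotient, given only by exactness in each degree
    and at each group. *)
Lemma ses_qis : qis cone_quot.
Proof.
move=> K n; split=> [[x y] /=|z dz].
  move=> [/oppr_eq0P dx e] [w]; have [w' ->] := p_surj w => ew.
  have [|x' ex] := @exact_mid (n + 1) K (y - cplx_d Y n K w').
    by rewrite linearB cmap_appE ew subrr.
  exists (x', w'); apply: pairP => /=; last by rewrite -ex subrK.
  apply/eqP; rewrite -subr_eq0; apply/eqP; apply: i_inj.
  by rewrite opprK linearD cmap_appE -ex linearB cplx_dd subr0.
have [y ey] := p_surj z.
have [|x ex] := @exact_mid (n + 1 + 1) K (cplx_d Y (n + 1) K y).
  by rewrite cmap_appE -ey.
exists (- x, y), 0; split; last by rewrite linear0 addr0.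
apply: pairP => /=; last by rewrite linearN ex addNr.
by rewrite linearN opprK; apply: i_inj; rewrite cmap_appE -ex cplx_dd.
Qed.
End ShortExact.
End Truncation.

(** * Thick ideals and their supports *)

Section Averaging.
Context (k : fieldType) (U : finGroupType -> Prop) (G : gobj U).
Implicit Types (X Y Z : cplx k U) (H K L : gobj U).
Context (B : gobj U -> Prop) (cB : convex B).
(** With the next hypothesis, [B] is either the isomorphism class of [G] or empty. The second case
    covers a list in which a class recurs. *)
Hypothesis B_sub : forall K, B K -> gobj_iso G K.
Hypothesis B_iso : forall K, gobj_iso G K -> forall H, B H -> B K.
Hypothesis char0 : [pchar k] =i pred0.
Context (X : cplx k U).

Let T := sph (torsor k G) 0.
Let C := truncC cB X.

Lemma add0_eq (m : int) : 0 + m == m. Proof. by rewrite add0r. Qed.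

Let N K : k := #|{: epi K G}|%:R^-1.

(** A group [K] in the class of [G] has no preferred isomorphism to [G], so all are averaged. The
    result is natural because composition with an isomorphism permutes them. *)
Let avg m K (x : X m K) : tens T X m K :=
  N K *: \sum_(p : epi K G) tens_in (add0_eq m) (sph_gen (torsor k G) 0 K (tgen k p 1)) x.

Let avg_lin m K : linear (@avg m K).
Proof.
move=> a x y; rewrite /avg scalerA mulrC -scalerA -scalerDr; congr (_ *: _).
rewrite scaler_sumr -big_split; apply: eq_bigr => p _.
by rewrite tens_in_linearr.
Qed.

Let avg0 m K : avg (0 : X m K) = 0.
Proof. by rewrite /avg big1 ?scaler0 // => p _; rewrite tens_in0r. Qed.

Let avg_res m K H (a : epi H K) (x : X m K) : #|K| = #|G| -> 
  psh_res (tens T X m) a (avg x) = if #|H| == #|G| then avg (psh_res (X m) a x) else 0.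
Proof.
move=> KG; rewrite /avg linearZ_LR (linear_sum (psh_res (tens T X m) a)).
have E (p : epi K G) : psh_res (tens T X m) a (tens_in (add0_eq m)
   (sph_gen (torsor k G) 0 K (tgen k p 1)) x) =
   tens_in (add0_eq m) (sph_gen (torsor k G) 0 H (tgen k (epi_comp p a) 1)) (psh_res (X m) a x).
  rewrite [LHS]tens_resE; congr tens_in.
  rewrite -[LHS]/(dsum_map _ (dsum_in _ _ _)) dsum_map_in; congr (dsum_in _ _ _).
  exact: tgen_res.
transitivity (N K *: \sum_(p : epi K G) tens_in (add0_eq m)
    (sph_gen (torsor k G) 0 H (tgen k (epi_comp p a) 1)) (psh_res (X m) a x)).
  by congr (_ *: _); apply: eq_bigr => p _; apply: E.
case: eqP => [HG|HG]; last first.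
  by rewrite big1 ?scaler0 // => p _; rewrite tgen_kill // linear0 tens_in0l.
have bij : bijective (fun p : epi K G => epi_comp p a) by apply: epi_compr_bij; rewrite HG KG.
by rewrite /N -(bij_eq_card bij) [in RHS](reindex _ (onW_bij _ bij)).
Qed.

Let avg_d m K (x : X m K) : cplx_d (tens T X) m K (avg x) = avg (cplx_d X m K x).
Proof.
rewrite /avg linearZ_LR (linear_sum (cplx_d (tens T X) m K)); congr (_ *: _); apply: eq_bigr => p _.
rewrite tens_dE -[cplx_d T _ _ _]/(0 : T (0 + 1) K) tens_in0l add0r expr0 scale1r.
by congr tens_in; apply: bool_irrelevance.
Qed.

Program Definition avg_map : cmap C (tens T X) :=
  @CMap k U C (tens T X) (fun m => @NatTrans k U (C m) (tens T X m)
    (fun K => mklin (@avg_lin m K) \o trval B (X m) K) _) _.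
Next Obligation.
move=> m K H a x.
rewrite -[LHS]/(avg (trval B (X m) H (psh_res (trunc cB (X m)) a x))) truncE.
rewrite -[RHS]/(psh_res (tens T X m) a (avg (trval B (X m) K x))).
have [BK|nBK] := pselect (B K); last by rewrite (trval0 x nBK) avg0 !linear0 avg0.
rewrite avg_res; last exact/gobj_iso_card/B_sub.
have [BH|nBH] := pselect (B H).
  by rewrite tprE // (gobj_iso_card (B_sub BH)) eqxx.
rewrite trval0 // avg0; case: eqP => // HG.
have [p pK] := (gobj_isoP G K).1 (B_sub BK).
case: nBH; apply: B_iso BK; apply/gobj_isoP.
by exists (epi_comp p a).
Qed.
Next Obligation.
move=> m K x.
rewrite -[LHS]/(avg (trval B (X (m + 1)) K (cplx_d C m K x))) trval_d.
by rewrite -[RHS]/(cplx_d (tens T X) m K (avg (trval B (X m) K x))) avg_d.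
Qed.

Let ev m K i j (e : i + j == m) (t : T i K) (y : X j K) : C m K :=
  (aug k G K (sph_val (torsor k G) 0 i K t) : k) *: tpr B (X m) K (degcast X j m K y).

Let ev_l m K i j (e : i + j == m) y : linear (fun t => @ev m K i j e t y).
Proof. by move=> a t t'; rewrite /ev !linearP scalerDl scalerA. Qed.
Let ev_r m K i j (e : i + j == m) t : linear (@ev m K i j e t).
Proof.
move=> a y y'; rewrite /ev (linearP (degcast X j m K)) (linearP (tpr B (X m) K)).
by rewrite scalerDr !scalerA mulrC.
Qed.

Let ev_lin m K : {linear tens T X m K -> C m K} :=
  tens_lift (fun i j e => @ev_l m K i j e) (fun i j e => @ev_r m K i j e).

Let ev_linE m K i j (e : i + j == m) t y : ev_lin m K (tens_in e t y) = ev e t y.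
Proof. exact: tens_liftE. Qed.

Let aug_res K H (a : epi H K) u : B K -> B H ->
  aug k G H (psh_res (torsor k G) a u) = aug k G K u.
Proof.
move=> /B_sub/gobj_iso_card KG /B_sub/gobj_iso_card HG.
pose F : {linear torsor k G K -> k^o} := aug k G H \o psh_res (torsor k G) a.
suff FE : F =1 aug k G K by apply: FE.
apply: torsor_ext => p v; rewrite -[LHS]/(aug k G H (psh_res (torsor k G) a (tgen k p v))).
by rewrite tgen_res !augE.
Qed.

Let ev_nat m K H (a : epi H K) z :
  ev_lin m H (psh_res (tens T X m) a z) = psh_res (C m) a (ev_lin m K z).
Proof.
pose f1 : {linear tens T X m K -> C m H} := ev_lin m H \o psh_res (tens T X m) a.
pose f2 : {linear tens T X m K -> C m H} := psh_res (C m) a \o ev_lin m K.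
suff E : f1 =1 f2 by exact: E.
apply: tens_ext => i j e t y.
rewrite -[LHS]/(ev_lin m H (tens_res T X m a (tens_in e t y))) tens_resE ev_linE.
rewrite -[RHS]/(psh_res (C m) a (ev_lin m K (tens_in e t y))) ev_linE /ev.
rewrite sph_val_res nat_appE linearZ_LR.
have resE c : psh_res (C m) a c = tpr B (X m) H (psh_res (X m) a (trval B (X m) K c)) by [].
rewrite resE.
move: (sph_val _ _ _ _ t) => u; move: (degcast X j m K y) => {}y.
have [BH|nBH] := pselect (B H); last by rewrite !(tpr0 _ nBH) !scaler0.
have [BK|nBK] := pselect (B K); first by rewrite tprE // aug_res.
(* Here [H] lies in [B] and [K] does not. Then [K] is not isomorphic to [G], the torsor vanishes at
   [K], and both sides are zero. *)
rewrite (tpr0 _ nBK) !linear0 ?scaler0.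
rewrite (@torsor_zero k U G K u) ?linear0 ?scale0r // => GK; apply: nBK.
exact: B_iso GK _ BH.
Qed.

Let sph_val_neq i K (t : T i K) : 0 <> i -> sph_val (torsor k G) 0 i K t = 0.
Proof.
elim/(@sph_ind k U (torsor k G) 0 K): i / t => // [i x y Hx Hy ne|i ne].
  by rewrite linearD Hx // Hy // addr0.
by rewrite linear0.
Qed.

Let ev_d m K z : ev_lin (m + 1) K (cplx_d (tens T X) m K z) = cplx_d C m K (ev_lin m K z).
Proof.
pose f1 : {linear tens T X m K -> C (m + 1) K} := ev_lin (m + 1) K \o cplx_d (tens T X) m K.
pose f2 : {linear tens T X m K -> C (m + 1) K} := cplx_d C m K \o ev_lin m K.
suff E : f1 =1 f2 by exact: E.
apply: tens_ext => i j e t y.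
rewrite -[LHS]/(ev_lin (m + 1) K (cplx_d (tens T X) m K (tens_in e t y))) tens_dE.
rewrite -[cplx_d T i K t]/(0 : T (i + 1) K) tens_in0l add0r linearZ_LR.
rewrite -[RHS]/(cplx_d C m K (ev_lin m K (tens_in e t y))) !ev_linE /ev.
rewrite (linearZ_LR (cplx_d C m K)) degcast_d tpr_d.
have [i0|ne] := pselect (0 = i); first by subst i; rewrite expr0 scale1r.
by rewrite sph_val_neq // linear0 !scale0r scaler0.
Qed.

Definition ev_map : cmap (tens T X) C :=
  @CMap k U (tens T X) C (fun m => @NatTrans k U (tens T X m) (C m) (ev_lin m) (@ev_nat m)) ev_d.

(** Evaluation gives [x] on each term of the average. The number of isomorphisms is invertible
    because the characteristic is zero. *)
Lemma trunc_retract : Dretract C (tens T X).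
Proof.
exists (Dmap avg_map), (Dmap ev_map); apply: deq_mapcomp => m K x.
rewrite -[LHS]/(ev_lin m K (avg (trval B (X m) K x))) -[RHS]/x.
have [BK|nBK] := pselect (B K); last first.
  by rewrite (trval0 x nBK) avg0 linear0 -[x]trvalK (trval0 x nBK) linear0.
have KG := gobj_iso_card (B_sub BK).
rewrite /avg linearZ_LR (linear_sum (ev_lin m K)) (eq_bigr (fun=> x)) => [|p _].
  rewrite sumr_const -scaler_nat scalerA mulVf ?scale1r //; apply: (natr_unit char0).
  have [p _] := (gobj_isoP G K).1 (B_sub BK).
  by apply/card_gt0P; exists p.
by rewrite ev_linE /ev sph_valE augE // scale1r degcast_id trvalK.
Qed.
End Averaging.

(** * Generation of thick ideals by support *)

Section ThickIdeals.
Context (k : fieldType) (U : finGroupType -> Prop).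
Implicit Types (X Y Z : cplx k U) (G H K L : gobj U) (J : cplx k U -> Prop).

Lemma Diso_id X : Diso (Did X).
Proof. by exists (Did X); split; apply: deq_idl. Qed.

Lemma distinguished_cone X Y (f : cmap X Y) :
  distinguished (Dmap f) (Dmap (cone_in f)) (Dmap (cone_out f)).
Proof.
exists X, Y, f, (Did X), (Did Y), (Did (cone f)); split; first by split; apply: Diso_id.
split.
- by apply: deq_trans (deq_idl _) _; apply: deq_sym; apply: deq_idr.
- by apply: deq_trans (deq_idl _) _; apply: deq_sym; apply: deq_idr.
apply: deq_trans (deq_mapcomp (h := cone_out f) _) _; first by [].
by apply: deq_sym; apply: deq_idr.
Qed.

Lemma qis_retract X Y (f : cmap X Y) : qis f -> Dretract X Y /\ Dretract Y X.
Proof.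
move=> qf; split; first by exists (Dmap f), (Dinv qf); apply: deq_invl.
by exists (Dinv qf), (Dmap f); apply: deq_invr.
Qed.

Lemma thick_acyclic J X : thick J -> compact X -> (forall G, acyclic_at X G) -> J X.
Proof.
move=> tJ cX aX; apply: (thick_retract tJ) cX _ (thick_zero tJ).
have q : qis (cmap_zero X (cplx_zero k U)).
  apply/qisP => G n; split=> [x dx _|y _]; first by have /acyclicP := aX G; apply.
  exists 0; first exact: (linear0 (cplx_d X n G)).
  by rewrite (_ : y - _ = 0); [apply: bdry0|apply/rowP => -[]].
exact: (qis_retract q).1.
Qed.

Lemma cone_acyclic_triangle X Y (f : cmap X Y) G :
  [/\ acyclic_at X G -> acyclic_at Y G -> acyclic_at (cone f) G,
      acyclic_at Y G -> acyclic_at (cone f) G -> acyclic_at X G &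
      acyclic_at X G -> acyclic_at (cone f) G -> acyclic_at Y G].
Proof.
split; first exact: cone_acyclic2.
  move=> /acyclicP aY /cone_acyclic H; apply/acyclicP => n x dx.
  by apply: (H n).1 => //; apply: aY; rewrite -cmap_appE dx linear0.
move=> /acyclicP aX /cone_acyclic H; apply/acyclicP => n y dy.
have [x dx b] := (H n).2 y dy; rewrite -[y](subrK (f n G x)).
by apply: bdryD => //; apply/bdry_cmap/aX.
Qed.

Lemma distinguished_acyclic X Y Z (u : dhom X Y) (v : dhom Y Z) (w : dhom Z (shift X)) G :
  distinguished u v w ->
  [/\ acyclic_at X G -> acyclic_at Y G -> acyclic_at Z G,
      acyclic_at Y G -> acyclic_at Z G -> acyclic_at X G &
      acyclic_at X G -> acyclic_at Z G -> acyclic_at Y G].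
Proof.
move=> [A [B [f [a [b [c [[ia ib ic] _]]]]]]].
have [H1 H2 H3] := cone_acyclic_triangle f G.
have [[ea eb] ec] := (Diso_acyclic G ia, Diso_acyclic G ib, Diso_acyclic G ic).
split=> [/ea ? /eb ?|/eb ? /ec ?|/ea ? /ec ?].
- by apply/ec/H1.
- by apply/ea/H2.
by apply/eb/H3.
Qed.

(** If [H] is not covered, its order is at most that of the representative of [K], onto which it
    surjects; this surjection is then an isomorphism. *)
Lemma covered_upward (I0 : finType) (rep : I0 -> gobj U) l K H (a : epi H K) :
  upward rep l -> covered rep l K -> covered rep l H.
Proof.
move=> [_ /(_ H)[//|bH]] /hasP[i il /asboolP iK]; apply/hasP; exists i => //.
apply/asboolP/gobj_isoP; have [p pK] := (gobj_isoP _ _).1 iK.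
exists (epi_comp p a); apply/eqP; rewrite eqn_leq (allP bH) //.
by rewrite (epi_leq (epi_comp p a)).
Qed.

Hypothesis char0 : [pchar k] =i pred0.
Hypothesis U_finite : essentially_finite U.

Lemma compactP X : compact X <-> forall G, fdcoh X G.
Proof. by split=> [cX G|]; [apply: compact_fdcoh|apply: fdcoh_compact]. Qed.

Lemma torsor_compact G n : compact (sph (torsor k G) n).
Proof. by apply/compactP => K; apply: torsor_fdcoh. Qed.

(** By induction on an [upward] list, [J] contains the truncation of [X] to the groups that the list
    covers. Each step adds the layer at one isomorphism class, or nothing if the class recurs in the
    rest of the list. *)
Lemma thick_support J X : thick_ideal J -> compact X ->
  (forall G, ~ acyclic_at X G -> exists2 Y, J Y & ~ acyclic_at Y G) -> J X.
Proof.
move=> [tJ iJ] cX sX.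
have trc (A : gobj U -> Prop) (cA : convex A) : compact (truncC cA X).
  by apply/compactP => G; apply/trunc_fdcoh/((compactP X).1 cX).
have [n0 [rep [l0 [ul0 cl0]]]] := upward_exists U_finite.
have cov_convex l : upward rep l -> convex (covered rep l).
  by move=> ul K H L a _ cK _; apply: covered_upward a ul cK.
suff step l (ul : upward rep l) (cA : convex (covered rep l)) : J (truncC cA X).
  apply: (thick_retract tJ cX (qis_retract (trunc_whole_qis (cov_convex _ ul0) X cl0)).2).
  exact: step.
elim: l ul cA => [|i l IH] ul cA.
  apply: thick_acyclic => // G; apply: trunc_acyclic; by [].
have ul' := upward_cons ul; have cA' := cov_convex l ul'.
set A := covered rep (i :: l) in cA *; set A' := covered rep l in cA' *.
pose B K := gobj_iso (rep i) K /\ ~ A' K.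
have A'A K : A' K -> A K by move=> A'K; apply/covered_cons; right.
have AE K : A K -> A' K \/ B K.
  move=> /covered_cons[iK|]; last by left.
  by have [?|?] := pselect (A' K); [left|right].
have cB : convex B.
  move=> K H L a b [iK nK] [iL nL]; split; last first.
    by move=> A'H; apply: nL; apply: covered_upward b ul' A'H.
  have : A H by apply: cA a b _ _; apply/covered_cons; left.
  move=> /AE[A'H|[//]]; case: nL; exact: covered_upward b ul' A'H.
(* Restriction leads to groups that map onto the given one, and [A'] is closed under passing to
   these. So the part on [A'] is a subcomplex, and the part on [B] is the quotient. *)
have inc K H (a : epi H K) : A' K -> A H -> A' H /\ A K.
  by move=> A'K _; split; [apply: covered_upward a ul' A'K|apply: A'A].
have prj K H (a : epi H K) : A K -> B H -> A H /\ B K.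
  move=> AK [iH nH]; split; first by apply/covered_cons; left.
  by case: (AE K AK) => // A'K; case: nH; apply: covered_upward a ul' A'K.
pose iota := trunc_cmp cA' cA X inc; pose pi := trunc_cmp cA cB X prj.
have valA n K x : trval A (X n) K (iota n K x) = trval A' (X n) K x.
  rewrite trunc_cmpE; have [AK|nAK] := pselect (A K); first by rewrite tprE.
  by rewrite tpr0 // linear0 trval0 // => /A'A.
have pi_tpr n K x : pi n K x = tpr B (X n) K (trval A (X n) K x) by [].
have i_inj n K x : iota n K x = 0 -> x = 0.
  by move=> e; apply: trval_inj; rewrite -valA e !linear0.
have p_surj n K z : exists y, z = pi n K y.
  exists (tpr A (X n) K (trval B (X n) K z)); rewrite pi_tpr.
  have [BK|nBK] := pselect (B K).
    by rewrite tprE ?trvalK //; apply/covered_cons; left; case: BK.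
  by rewrite (trval0 z nBK) !linear0 -[z]trvalK (trval0 z nBK) linear0.
have p_i n K x : pi n K (iota n K x) = 0.
  rewrite pi_tpr valA; have [A'K|nA'K] := pselect (A' K); last by rewrite trval0 // linear0.
  by rewrite tpr0 // => -[_].
have mid n K y : pi n K y = 0 -> exists x, y = iota n K x.
  rewrite pi_tpr => e; exists (tpr A' (X n) K (trval A (X n) K y)).
  apply: trval_inj; rewrite valA; have [A'K|nA'K] := pselect (A' K); first by rewrite tprE.
  rewrite tpr0 // linear0; have [AK|nAK] := pselect (A K); last by rewrite trval0.
  case: (AE K AK) => [A'K|BK]; first by case: nA'K.
  by rewrite -(@tprE _ _ B (X n) K (trval A (X n) K y) BK) e linear0.
have q := ses_qis i_inj p_surj p_i mid.
have cC : compact (cone iota).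
  by apply/compactP => G; apply: cone_fdcoh; apply/(compactP _).1/trc.
have [_ _ tri] := thick_triangle tJ (trc _ cA') (trc _ cA) cC (distinguished_cone iota).
apply: tri; first exact: IH.
apply: (thick_retract tJ cC (qis_retract q).1).
have [aX|naX] := pselect (acyclic_at X (rep i)).
  apply: (thick_acyclic tJ) => // K; apply: trunc_acyclic => -[iK _].
  exact: acyclic_iso iK aX.
(* The ideal contains [tens Y] of a shifted torsor, hence its retract [sph (torsor k (rep i)) 0],
   hence the product of this with [X], of which the layer is a retract. *)
have [Y JY naY] := sX _ naX.
have [m [y [f [dy fy fb]]]] := not_acyclic naY.
have JT : J (sph (torsor k (rep i)) 0).
  apply: (thick_retract tJ (torsor_compact _ _) (torsor_retract dy fy fb)).
  by apply: iJ => //; apply: torsor_compact.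
have Biso K : gobj_iso (rep i) K -> forall H, B H -> B K.
  move=> iK H [iH nH]; split=> // A'K; apply: nH.
  have [a _] : exists a : epi H K, #|H| = #|K|.
    by apply/gobj_isoP; apply: gobj_iso_trans iH; apply: gobj_iso_sym.
  exact: covered_upward a ul' A'K.
apply: (thick_retract tJ (trc _ cB) (trunc_retract cB (fun K (BK : B K) => BK.1) Biso char0 X)).
exact: iJ.
Qed.
End ThickIdeals.

(** * The spectrum *)

Section Spectrum.
Context (k : fieldType) (U : finGroupType -> Prop).
Implicit Types (X Y Z : cplx k U) (G H K L : gobj U) (J P : cplx k U -> Prop).

Lemma bdry_shift X n K (z : X (n + 1) K) : bdry (z : shift X n K) <-> bdry z.
Proof.
elim/int_succ: n z => n z; split=> /bdryP[w e]; apply/bdryP.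
  by exists (- w); rewrite linearN.
by exists (- w); rewrite /= linearN opprK.
Qed.

Lemma shift_acyclic X K : acyclic_at (shift X) K <-> acyclic_at X K.
Proof.
split=> /acyclicP aX; apply/acyclicP.
  elim/int_succ => n z dz; apply/bdry_shift/aX.
  by rewrite /= dz oppr0.
by move=> n z /= /oppr_eq0P dz; apply/bdry_shift/aX.
Qed.

Lemma shift_fdcoh X K : fdcoh X K -> fdcoh (shift X) K.
Proof.
move=> /fdcoh_succ[I [m [x sx]]]; exists I, m, x => n z /= /oppr_eq0P dz.
have [y sy b] := sx (n + 1) z dz; exists y; last exact/bdry_shift.
apply: (in_span_sub (V := X (n + 1) K)) sy => t /listed_inv[i [e ->]]; apply: in_span_gen.
have e' := addIr _ e; subst n; rewrite (eq_axiomK e).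
exact: (@Listed k U (shift X) K I m x).
Qed.

Lemma csum_fdcoh X Y K : fdcoh X K -> fdcoh Y K -> fdcoh (csum X Y) K.
Proof.
move=> [I [dI [x sx]]] [J [dJ [y sy]]].
pose in1 := cmap_pairing (cmap_id X) (cmap_zero X Y).
pose in2 := cmap_pairing (cmap_zero Y X) (cmap_id Y).
pose deg (c : I + J) := match c with inl i => dI i | inr j => dJ j end.
pose c i : csum X Y (deg i) K := match i with
  | inl i => in1 (dI i) K (x i) | inr j => in2 (dJ j) K (y j) end.
exists (I + J)%type, deg, c => n [u v] dz.
move/(congr1 fst): (dz) => /= du; move/(congr1 snd): dz => /= dv.
have [u1 su bu] := sx n u du; have [v1 sv bv] := sy n v dv.
exists (in1 n K u1 + in2 n K v1).
  apply: in_spanD.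
    apply: in_span_map su => _ [i]; apply: in_span_gen.
    exact: (@Listed k U (csum X Y) K _ deg c (inl i)).
  apply: in_span_map sv => _ [j]; apply: in_span_gen.
  exact: (@Listed k U (csum X Y) K _ deg c (inr j)).
have -> : (u, v) - (in1 n K u1 + in2 n K v1) = in1 n K (u - u1) + in2 n K (v - v1).
  by apply: pairP => /=; zmod.
by apply: bdryD; apply: bdry_cmap.
Qed.

Lemma csum_acyclic X Y K :
  acyclic_at (csum X Y) K <-> acyclic_at X K /\ acyclic_at Y K.
Proof.
split=> [/acyclicP aXY|[/acyclicP aX /acyclicP aY]].
  split; apply/acyclicP => n z dz.
    have [|//] := @bdry_csum k U X Y n K (z, 0); apply: aXY.
    by apply: pairP; rewrite /= ?linear0.
  have [|//] := @bdry_csum k U X Y n K (0, z); apply: aXY.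
  by apply: pairP; rewrite /= ?linear0.
apply/acyclicP => n [u v] dz.
move/(congr1 fst): (dz) => /= /aX bu; move/(congr1 snd): dz => /= /aY bv.
have -> : (u, v) = cmap_pairing (cmap_id X) (cmap_zero X Y) n K u +
    cmap_pairing (cmap_zero Y X) (cmap_id Y) n K v :> csum X Y n K.
  by apply: pairP => /=; zmod.
by apply: bdryD; apply: bdry_cmap.
Qed.

Lemma zero_acyclic K : acyclic_at (cplx_zero k U) K.
Proof. by move=> n x _; exists 0; apply/rowP => -[]. Qed.

Lemma acyclic_fdcoh X K : acyclic_at X K -> fdcoh X K.
Proof.
move=> aX; exists void, (fun=> 0), (fun i : void => match i return X 0 K with end).
exact: acyclic_spans.
Qed.

Lemma group_prime_iso G H : gobj_iso G H -> group_prime (k := k) G = group_prime H.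
Proof.
move=> GH; apply: functional_extensionality_dep => X; apply/propext.
by split=> -[cX aX]; split=> //; apply: acyclic_iso aX => //; apply: gobj_iso_sym.
Qed.

Hypothesis char0 : [pchar k] =i pred0.
Hypothesis U_finite : essentially_finite U.

Lemma tens_compact X Y : compact X -> compact Y -> compact (tens X Y).
Proof.
move=> cX cY; apply/(compactP char0 U_finite) => G.
by apply: tens_fdcoh; apply: compact_fdcoh.
Qed.

(** Where [X] is not acyclic, neither are its positive powers, so the power in [J] provides the
    support needed for [X]. *)
Lemma thick_ideal_radical J : thick_ideal J -> radical J.
Proof.
move=> tJ X m cX m0 JXm; apply: (thick_support char0 U_finite tJ) => // G naX.
by exists (tens_pow X m) => // aXm; apply: naX; apply: tens_pow_acyclic aXm.
Qed.

Lemma group_prime_prime G : prime_ideal (group_prime (k := k) G).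
Proof.
split.
- split; first split.
  + by move=> X [].
  + split; last exact: zero_acyclic.
    by apply/(compactP char0 U_finite) => K; apply/acyclic_fdcoh/zero_acyclic.
  + move=> X cX; split=> -[_ aX]; split=> //; try exact/shift_acyclic.
    by apply/(compactP char0 U_finite) => K; apply/shift_fdcoh/compact_fdcoh.
  + move=> X Y Z u v w cX cY cZ /(distinguished_acyclic G)[H1 H2 H3].
    by split=> -[_ a1] [_ a2]; split=> //; [apply: H1|apply: H2|apply: H3].
  + by move=> X Y cX rXY [_ aY]; split=> //; apply: retract_acyclic rXY aY.
  by move=> X Y [cX aX] cY; split; [apply: tens_compact|apply: acyclic_tens_l].
- exists (sph (torsor k G) 0); split; first exact: torsor_compact.
  by move=> [_]; apply: torsor_not_acyclic.
by move=> X Y cX cY [_ /tens_acyclic[aX|aY]]; [left|right].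
Qed.

(** Were every group in the support of some member of [P], then [P] would contain all compact
    objects. So all members are acyclic at some [G]. Conversely, if [X] is acyclic at [G], its
    product with the torsor of [G] is acyclic everywhere and lies in [P]; the torsor does not, hence
    [X] does. *)
Lemma prime_group P : prime_ideal P -> exists G, P = group_prime G.
Proof.
move=> [tP [X0 [cX0 nX0]] pP].
have [G nG] : exists G, forall Y, P Y -> acyclic_at Y G.
  apply: contrapT => nG; apply: nX0; apply: (thick_support char0 U_finite tP) => // G _.
  apply: contrapT => H; apply: nG; exists G => Y PY; apply: contrapT => naY.
  by apply: H; exists Y.
exists G; apply: functional_extensionality_dep => X; apply/propext; split=> [PX|[cX aX]].
  by split; [exact: (thick_compact (thick_ideal_thick tP)) PX|exact: nG].
have cT := @torsor_compact k U char0 U_finite G 0.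
have : P (tens (sph (torsor k G) 0) X).
  apply: (thick_acyclic (thick_ideal_thick tP)); first exact: tens_compact.
  move=> K; have [GK|nGK] := pselect (gobj_iso G K).
    by apply/acyclic_tens_r/(acyclic_iso GK aX).
  by apply/acyclic_tens_l/torsor_acyclic.
move=> /(pP _ _ cT cX)[PT|//].
by have := nG _ PT => /torsor_not_acyclic.
Qed.

Definition group_point G : Spc k U := exist _ (group_prime G) (group_prime_prime G).

Lemma Spc_eq (P Q : Spc k U) : sval P = sval Q -> P = Q.
Proof. by case: P Q => [P hP] [Q hQ] /= e; apply: eq_exist. Qed.

Lemma Spc_point (P : Spc k U) : exists G, P = group_point G.
Proof. by have [G e] := prime_group (svalP P); exists G; apply: Spc_eq. Qed.

Definition class_point (C : pi0 U) : Spc k U := group_point (sval (cid (svalP C))).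

Lemma class_pointE G : class_point (iso_class G) = group_point G.
Proof.
apply: Spc_eq; apply: group_prime_iso; rewrite /class_point.
case: cid => /= H e; have : gobj_iso G H by rewrite e; apply: gobj_iso_refl.
exact: gobj_iso_sym.
Qed.

Lemma group_point_inj G H : group_point G = group_point H -> iso_class G = iso_class H.
Proof.
move=> /(congr1 sval) /= e; have GH : gobj_iso G H.
  apply: contrapT => nGH.
  have : group_prime H (sph (torsor k G) 0).
    by split; [apply: torsor_compact|apply: torsor_acyclic].
  by rewrite -e => -[_ /torsor_not_acyclic].
apply: eq_exist; apply: functional_extensionality_dep => K; apply/propext.
by split; apply: gobj_iso_trans => //; apply: gobj_iso_sym.
Qed.

Lemma pi0_class (C : pi0 U) : exists G, C = iso_class G.
Proof. by case: C => C [G e]; exists G; apply: eq_exist. Qed.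

Lemma Spc_finite : finite_type (Spc k U).
Proof.
have [n [f fsurj]] := U_finite; exists n, (fun i => class_point (f i)) => P.
have [G ->] := Spc_point P; have [i fi] := fsurj (iso_class G).
by exists i; rewrite fi class_pointE.
Qed.

(** Every subset is the support of one object, the direct sum of the torsors of its groups;
    essential finiteness makes the sum finite and hence compact. *)
Lemma Spc_discrete (S : Spc k U -> Prop) : Spc_closed S.
Proof.
have [n [f fsurj]] := U_finite.
have [r rP] : exists r : 'I_n -> gobj U, forall i, f i = iso_class (r i).
  exists (fun i => sval (cid (pi0_class (f i)))) => i; by case: cid.
pose s := [seq i <- enum 'I_n | `[< S (group_point (r i)) >]].
pose X := foldr (fun i X => csum (sph (torsor k (r i)) 0) X) (cplx_zero k U) s.
have cX : compact X.
  apply/(compactP char0 U_finite) => K; rewrite /X; elim: (s) => [|i s' IH] /=.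
    exact/acyclic_fdcoh/zero_acyclic.
  by apply: csum_fdcoh => //; apply: torsor_fdcoh.
have aX K : acyclic_at X K <-> forall i, i \in s -> ~ gobj_iso (r i) K.
  rewrite /X; elim: (s) => [|i s' IH] /=; first by split=> // _; apply: zero_acyclic.
  split=> [/csum_acyclic[aT /IH H] j|H].
    rewrite inE => /orP[/eqP -> iK|/H //].
    exact: (@torsor_not_acyclic k U (r i) 0) (acyclic_iso (gobj_iso_sym iK) aT).
  apply/csum_acyclic; split; first by apply/torsor_acyclic/H; rewrite inE eqxx.
  by apply/IH => j js; apply: H; rewrite inE js orbT.
exists (fun A => A = supp X); split=> [A ->|P]; first by exists X.
have [G ->] := Spc_point P.
suff E : S (group_point G) <-> ~ acyclic_at X G.
  split=> [/E naX A ->|/(_ _ erefl) nX]; first by move=> [].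
  by apply/E => aXG; apply: nX.
have iE i : gobj_iso (r i) G -> group_point (r i) = group_point G.
  by move=> iG; apply: Spc_eq; apply: group_prime_iso.
split=> [SG /aX H|naX].
  have [i fi] := fsurj (iso_class G).
  have iG : gobj_iso (r i) G.
    by have /(congr1 sval) /= -> : iso_class (r i) = iso_class G; rewrite -?rP ?fi //; apply: gobj_iso_refl.
  apply: (H i) => //; rewrite mem_filter mem_enum andbT.
  by apply/asboolP; rewrite iE.
apply: contrapT => nS; apply: naX; apply/aX => i.
by rewrite mem_filter => /andP[/asboolP Si _] iG; apply: nS; rewrite -(iE i).
Qed.
End Spectrum.

Theorem theorem5p3 (k : fieldType) (U : finGroupType -> Prop)
    (char0 : [pchar k]%R =i pred0)
    (U_replete : replete U)
    (U_wide : widely_closed U)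
    (U_finite : essentially_finite U)
    (unit_compact : compact (cplx_unit k U)) :
  (forall J : cplx k U -> Prop, thick_ideal J -> radical J) /\
  (exists phi : pi0 U -> Spc k U,
     (forall G : gobj U, sval (phi (iso_class G)) = group_prime G) /\
     homeomorphism (@discrete_closed (pi0 U)) (@Spc_closed k U) phi) /\
  finite_type (Spc k U) /\
  (forall Z : Spc k U -> Prop, Spc_closed Z) /\
  (forall P : Spc k U, exists G : gobj U, sval P = group_prime G).
Proof.
split; first by move=> J; apply: thick_ideal_radical.
split; last first.
  split; first exact: Spc_finite.
  split; first exact: Spc_discrete.
  by move=> P; have [G e] := prime_group char0 U_finite (svalP P); exists G.
exists (class_point char0 U_finite); split.
  by move=> G; rewrite class_pointE.
split.
- move=> C D; have [G ->] := pi0_class C; have [H ->] := pi0_class D.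
  by rewrite !class_pointE => /group_point_inj.
- move=> P; have [G ->] := Spc_point char0 U_finite P.
  by exists (iso_class G); rewrite class_pointE.
- by [].
by move=> Z _; apply: Spc_discrete.
Qed.
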